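(* Let $n>4$ be an integer. The universal enveloping algebra $U(\mathfrak{sl}(2n)[u]^{\widetilde{\tau}})$ of the twisted current algebra $\mathfrak{sl}(2n)[u]^{\widetilde{\tau}}$ is isomorphic, as an associative algebra, to the associative algebra $L$ defined by generators and relations in the context.
   Context: The ground field is $\mathbb{C}$, and $[x,y]=xy-yx$ in associative algebras. **Twisted current algebra.** Let $I_n=\{\pm1,\dots,\pm n\}$ and let $\mathfrak{gl}(2n)=\bigoplus_{i,j\in I_n}\mathbb{C}E_{i,j}$, where $E_{i,j}$ are the matrix units. Let $\tau$ be the involution $\tau(E_{i,j})=-E_{-j,-i}$, which restricts to $\mathfrak{sl}(2n)$. On the current algebra $\mathfrak{sl}(2n)[u]=\mathfrak{sl}(2n)\otimes\mathbb{C}[u]$ (with bracket $[x\otimes u^r,y\otimes u^s]=[x,y]\otimes u^{r+s}$) let $\widetilde{\tau}(x\otimes u^r)=(-1)^r\tau(x)\otimes u^r$, and put $\mathfrak{sl}(2n)[u]^{\widetilde{\tau}}=\{x\in\mathfrak{sl}(2n)[u]\mid\widetilde{\tau}(x)=x\}$. **Matrices.** For $1\le i,j\le n$ let $a_{i,j}=2\delta_{i,j}-\delta_{i,j+1}-\delta_{i+1,j}$ if $i,j\le n-1$, and $a_{i,j}=2\delta_{i,j}-\delta_{i,n-2}-\delta_{j,n-2}$ if $i=n$ or $j=n$. For an integer $r\ge0$ let $a^r_{i,j}=a_{i,j}$ ($1\le i,j\le n$) if $r$ is even, and $a^r_{i,j}=a_{i,j}+2\delta_{i,n-1}\delta_{j,n}$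 ($1\le i\le n-1$, $1\le j\le n$) if $r$ is odd. **The algebra $L$.** $L$ is the associative algebra generated by $$\{H_{i,2r},X^\pm_{i,2r}\mid 1\le i\le n,\ r\ge0\}\cup\{H_{i,2r+1},X^\pm_{j,2r+1}\mid 1\le i\le n-1,\ 1\le j\le n+1,\ r\ge0\}$$ (so $H_{n,r}$ exists only for $r$ even and $X^\pm_{n+1,r}$ only for $r$ odd) subject to the following relations, imposed for all indices for which the symbols occurring are defined; in a relation with $\pm$, all upper or all lower signs are taken: - $[H_{i,r},H_{j,s}]=0$; - $[H_{i,r},X^\pm_{j,s}]=\pm a^r_{i,j}X^\pm_{j,r+s}$ for $j\ne n+1$; - $[H_{i,r},X^\pm_{n+1,s}]=0$ if $r$ is odd, and $=\pm(2\delta_{i,n}-2\delta_{i,n-1})X^\pm_{n+1,r+s}$ if $r$ is even; - $[X^+_{i,r},X^-_{j,s}]=\delta_{i,j}H_{i,r+s}$ for $1\le i,j\le n-1$; - for $j\ne n-1,n+1$: $[X^+_{n,r},X^-_{j,s}]=\delta_{n,j}H_{n,r+s}$ if $r+s$ is even, and $=\delta_{n,j}H_{n-1,r+s}$ if $r+s$ is odd; - $[X^+_{n,r},X^-_{n-1,s}]=0$ if $r+s$ is even, and $=-X^+_{n+1,r+s}$ if $r+s$ is odd; - for $j\ne n-1,n+1$: $[X^+_{j,r},X^-_{n,s}]=\delta_{n,j}H_{n,r+s}$ if $r+s$ is even, and $=\delta_{n,j}H_{n-1,r+s}$ if $r+s$ is odd; - $[X^+_{n-1,r},X^-_{n,s}]=0$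 if $r+s$ is even, and $=-X^-_{n+1,r+s}$ if $r+s$ is odd; - $[X^+_{n+1,2r+1},X^-_{n+1,2s+1}]=2(H_{n,2r+2s+2}-H_{n-1,2r+2s+2})$; - $[X^\pm_{i,r+1},X^\pm_{j,s}]=[X^\pm_{i,r},X^\pm_{j,s+1}]$ for $1\le i,j\le n$ and $(i,j)\ne(n-1,n),(n,n-1)$; - $[X^\pm_{n,r+1},X^\pm_{n-1,s}]=-[X^\pm_{n,r},X^\pm_{n-1,s+1}]$; - $[X^\pm_{n+1,2r+1},X^\pm_{n+1,2s+1}]=0$; - $[X^\pm_{i,r},X^\pm_{i,s}]=0$ for $1\le i\le n$; - $[X^+_{n+1,2r+1},X^\pm_{j,s}]=0$ and $[X^-_{n+1,2r+1},X^\pm_{j,s}]=0$ for $j<n-1$; - $[X^+_{n+1,2r+1},X^+_{n-1,s}]=-2X^+_{n,2r+s+1}$, $[X^+_{n+1,2r+1},X^-_{n-1,s}]=0$; - $[X^+_{n+1,2r+1},X^-_{n,s}]=2X^-_{n-1,2r+s+1}$, $[X^+_{n+1,2r+1},X^+_{n,s}]=0$; - $[X^-_{n+1,2r+1},X^-_{n-1,s}]=2X^-_{n,2r+s+1}$, $[X^-_{n+1,2r+1},X^+_{n-1,s}]=0$; - $[X^-_{n+1,2r+1},X^+_{n,s}]=-2X^+_{n-1,2r+s+1}$, $[X^-_{n+1,2r+1},X^-_{n,s}]=0$; - $[X^\pm_{i,r},X^\pm_{j,s}]=0$ if $a_{i,j}=0$ and $(i,j)\ne(n-1,n),(n,n-1)$;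 - $[X^\pm_{n-1,r},X^\pm_{n,s}]=0$ if $r+s$ is even; - $[X^\pm_{i,r_1},[X^\pm_{i,r_2},X^\pm_{j,s}]]=0$ if $(i,j)=(n-1,n),(n,n-1)$ and $r_1+s$, $r_2+s$ are odd; - $[X^\pm_{i,r_1},[X^\pm_{i,r_2},X^\pm_{j,s}]]=0$ if $a_{i,j}=-1$ and $1\le i,j\le n$; - $[X^\pm_{n,s},[X^\pm_{n-2,r},X^\pm_{n-1,u}]]=(-1)^{s+u}[X^\pm_{n-1,u},[X^\pm_{n-2,r},X^\pm_{n,s}]]$; - $[[X^\pm_{n,0},X^\pm_{n-2,r}],[X^\pm_{n,0},X^\pm_{n-1,s}]]=0$; - $[[X^+_{n,s},[X^+_{n-2,0},X^+_{n-3,0}]],[[X^+_{n-1,0},X^+_{n-2,0}],X^+_{n,r}]]=0$; - $[[X^+_{n,2r+1},X^+_{n-2,0}],[[X^+_{n-1,0},X^+_{n-2,0}],X^+_{n,s}]]=0$; - $[[X^\pm_{n-1,0},X^\pm_{n-2,0}],[X^\pm_{n-1,s},X^\pm_{n,r}]]=0$; - $[[X^+_{n-1,s},[X^+_{n-2,0},X^+_{n-3,0}]],[[X^+_{n-1,0},X^+_{n-2,0}],X^+_{n,r}]]=0$; - $[[X^+_{n-1,s},X^+_{n-2,0}],[[X^+_{n-1,0},X^+_{n-2,0}],X^+_{n,r}]]=0$. *)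

(* Defs.v *)
From HB Require Import structures.
From mathcomp Require Import all_boot all_order all_algebra.
From mathcomp Require Import boolp reals complex.
From mathcomp Require Import monalg.

Set Implicit Arguments.
Unset Strict Implicit.
Unset Printing Implicit Defensive.

Import GRing.Theory.

Local Open Scope ring_scope.
Local Open Scope quotient_scope.

Reserved Notation "<| x , y |>"
  (at level 0, x at level 99, format "<| x ,  y |>").

Section FreeAlgebra.
Variables (K : fieldType) (X : choiceType).

Definition word_alg : Type := {malg K[{fmonom X}]}.

HB.instance Definition _ := GRing.Lalgebra.on word_alg.

Lemma word_alg_scalerAr (c : K) (x y : word_alg) : c *: (x * y) = x * (c *: y).
Proof.
have malgC_comm z : z * c%:MP = c *: z :> {malg K[{fmonom X}]}.
  rewrite -mul_malgC !malgM_def fgmulUg fgmulgU.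
  by apply: eq_bigr => k _; rewrite mul1m mulm1 mulrC.
by rewrite -(malgC_comm (x * y)) -mulrA malgC_comm.
Qed.

HB.instance Definition _ :=
  GRing.Lalgebra_isAlgebra.Build K word_alg word_alg_scalerAr.

Section Eval.
Variables (A : algType K) (phi : X -> A).

Definition word_eval (m : {fmonom X}) : A := \prod_(x <- m) phi x.

Lemma word_eval_mmorphism : mmorphism word_eval.
Proof.
split=> [m1 m2|]; rewrite /word_eval.
  by rewrite fmM big_cat.
by rewrite fm1 big_nil.
Qed.

HB.instance Definition _ :=
  monalg.isMultiplicative.Build {fmonom X} A word_eval word_eval_mmorphism.

Lemma word_alg_ex :
  exists f : {lrmorphism word_alg -> A}, forall x, f << fmu x >> = phi x.
Proof.
pose f : word_alg -> A := mmap (GRing.in_alg A) word_eval.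
have fD : zmod_morphism f by exact: mmap_is_additive.
have fM : monoid_morphism f.
  have commA c (a : A) : GRing.comm (GRing.in_alg A c) a.
    by rewrite /GRing.comm /= -scalerAl -scalerAr mul1r mulr1.
  case: (@commr_mmap_is_multiplicative {fmonom X} K A
           (GRing.in_alg A) word_eval).
    by move=> *; apply: commA.
  by move=> fM f1; split.
have fZ : scalable f.
  by move=> c x; rewrite /f mmapZ /= -scalerAl mul1r.
pose F : {lrmorphism word_alg -> A} := HB.pack f
  (GRing.isZmodMorphism.Build word_alg A f fD)
  (GRing.isMonoidMorphism.Build word_alg A f fM)
  (GRing.isScalable.Build K word_alg A *:%R f fZ).
exists F => x; rewrite /F /= /f mmapU /= scale1r mul1r /word_eval fmU.
by rewrite big_seq1.
Qed.

End Eval.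

(* The free algebra and its generators are locked together, to prevent        *)
(* unification from unfolding the multiplication of [{malg _[_]}].            *)
Definition free_alg_def : {A : algType K & X -> A} :=
  existT (fun A : algType K => X -> A) word_alg (fun x => << fmu x >>).

Fact free_alg_key : unit. Proof. by []. Qed.
Definition free_alg_locked := locked_with free_alg_key free_alg_def.
Canonical free_alg_unlockable := [unlockable of free_alg_locked].

Definition free_alg : algType K := projT1 free_alg_locked.
Definition fgen : X -> free_alg := projT2 free_alg_locked.

Lemma free_alg_ex (A : algType K) (phi : X -> A) :
  exists f : {lrmorphism free_alg -> A}, forall x, f (fgen x) = phi x.
Proof. by rewrite /fgen /free_alg unlock; exact: word_alg_ex. Qed.

Lemma augm_ex : exists f : {rmorphism free_alg -> K}, forall x, f (fgen x) = 0.
Proof.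
have [f f0] := free_alg_ex (fun _ : X => 0 : K^o).
by exists (GRing.RMorphism.clone _ _ (f : free_alg -> K) _).
Qed.

End FreeAlgebra.

Arguments fgen {K X} x.

(* [ideal_gen Rel] is the two-sided ideal generated by the differences x - y  *)
(* with [Rel x y].                                                            *)
Inductive ideal_gen (A : nzRingType) (Rel : A -> A -> Prop) : A -> Prop :=
| IdealGen0 : ideal_gen Rel 0
| IdealGenD a x y b z : Rel x y -> ideal_gen Rel z ->
    ideal_gen Rel (a * (x - y) * b + z).

Definition ideal_pred (A : nzRingType) (Rel : A -> A -> Prop) : {pred A} :=
  [pred x | `[< ideal_gen Rel x >]].

Section IdealTheory.
Variables (A : nzRingType) (Rel : A -> A -> Prop).

Lemma ideal_predP x : reflect (ideal_gen Rel x) (x \in ideal_pred Rel).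
Proof. by rewrite inE; apply: asboolP. Qed.

Lemma ideal_genMl c x : ideal_gen Rel x -> ideal_gen Rel (c * x).
Proof.
elim=> [|a u v b z uv _ IH]; first by rewrite mulr0; constructor.
by rewrite mulrDr 2!mulrA; constructor.
Qed.

Lemma ideal_genMr c x : ideal_gen Rel x -> ideal_gen Rel (x * c).
Proof.
elim=> [|a u v b z uv _ IH]; first by rewrite mul0r; constructor.
by rewrite mulrDl -mulrA; constructor.
Qed.

Lemma ideal_genD x y :
  ideal_gen Rel x -> ideal_gen Rel y -> ideal_gen Rel (x + y).
Proof.
move=> Ix Iy; elim: Ix => [|a u v b z uv _ IH]; first by rewrite add0r.
by rewrite -addrA; constructor.
Qed.

Lemma ideal_zmod_closed : zmod_closed (ideal_pred Rel).
Proof.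
split=> [|x y /ideal_predP Ix /ideal_predP/(ideal_genMl (-1))].
  by apply/ideal_predP; constructor.
by rewrite mulN1r => Iy; apply/ideal_predP/ideal_genD.
Qed.

HB.instance Definition _ :=
  GRing.isZmodClosed.Build A (ideal_pred Rel) ideal_zmod_closed.

Lemma ideal_gen_morph (B : pzRingType) (f : {rmorphism A -> B}) :
  (forall x y, Rel x y -> f x = f y) -> forall x, ideal_gen Rel x -> f x = 0.
Proof.
move=> fRel x; elim=> [|a u v b z /fRel uv _ IH]; first exact: rmorph0.
by rewrite rmorphD !rmorphM rmorphB uv subrr mulr0 mul0r add0r.
Qed.

End IdealTheory.

(* The quotient of the free algebra by the ideal generated by the relations.  *)
(* It may be the zero ring, hence only a [pzRingType].                        *)
Definition presented (K : fieldType) (X : choiceType)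
    (Rel : free_alg K X -> free_alg K X -> Prop) : Type :=
  {ideal_quot (ideal_pred Rel)}.

Section PresentedZmodule.
Variables (K : fieldType) (X : choiceType).
Variable Rel : free_alg K X -> free_alg K X -> Prop.
Local Notation F := (free_alg K X).
Local Notation P := (presented Rel).

HB.instance Definition _ := GRing.Zmodule.on P.

Definition pproj (x : F) : P := \pi_{ideal_quot (ideal_pred Rel)} x.

Lemma pproj_eq x y : (pproj x = pproj y) <-> ideal_gen Rel (x - y).
Proof.
rewrite /pproj; split=> [/eqP|xy].
  by rewrite -Quotient.idealrBE => /ideal_predP.
by apply/eqP; rewrite -Quotient.idealrBE; apply/ideal_predP.
Qed.

Definition prepr (x : P) : F := repr (x : {ideal_quot (ideal_pred Rel)}).

Lemma preprK x : pproj (prepr x) = x.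
Proof. exact: reprK. Qed.

Lemma pprojD x y : pproj (x + y) = pproj x + pproj y.
Proof. exact: Quotient.pi_add. Qed.

Lemma pproj0 : pproj 0 = 0.
Proof. by apply: (addrI (pproj 0)); rewrite -pprojD !addr0. Qed.

Lemma prepr_proj x : ideal_gen Rel (x - prepr (pproj x)).
Proof. by apply/pproj_eq; rewrite preprK. Qed.

End PresentedZmodule.

HB.lock Definition pone (K : fieldType) (X : choiceType)
  (Rel : free_alg K X -> free_alg K X -> Prop) :
  presented Rel := pproj Rel 1.
HB.lock Definition pmul (K : fieldType) (X : choiceType)
  (Rel : free_alg K X -> free_alg K X -> Prop) (x y : presented Rel) :
  presented Rel := pproj Rel (prepr x * prepr y).
HB.lock Definition pscale (K : fieldType) (X : choiceType)
  (Rel : free_alg K X -> free_alg K X -> Prop) (c : K) (x : presented Rel) :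
  presented Rel := pproj Rel (c *: prepr x).

Section PresentedAlgebra.
Variables (K : fieldType) (X : choiceType).
Variable Rel : free_alg K X -> free_alg K X -> Prop.
Local Notation F := (free_alg K X).
Local Notation P := (presented Rel).
Local Notation pproj := (pproj Rel).
Local Notation pone := (pone Rel).
Local Notation pmul := (@pmul K X Rel).
Local Notation pscale := (@pscale K X Rel).

Lemma pmulE x y : pproj (x * y) = pmul (pproj x) (pproj y).
Proof.
rewrite pmul.unlock; apply/pproj_eq.
have -> : x * y - prepr (pproj x) * prepr (pproj y) =
    (x - prepr (pproj x)) * y + prepr (pproj x) * (y - prepr (pproj y)).
  by rewrite mulrBl mulrBr addrA subrK.
by apply: ideal_genD; [apply: ideal_genMr | apply: ideal_genMl];
  apply: prepr_proj.
Qed.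

Lemma pscaleE c x : pproj (c *: x) = pscale c (pproj x).
Proof.
rewrite pscale.unlock; apply/pproj_eq; rewrite -scalerBr -mulr_algl.
exact/ideal_genMl/prepr_proj.
Qed.

Lemma pmulA : associative pmul.
Proof.
by move=> x y z; rewrite -[x]preprK -[y]preprK -[z]preprK -!pmulE mulrA.
Qed.

Lemma pmul1 : left_id pone pmul.
Proof. by move=> x; rewrite pone.unlock -[x]preprK -pmulE mul1r. Qed.

Lemma pmulr1 : right_id pone pmul.
Proof. by move=> x; rewrite pone.unlock -[x]preprK -pmulE mulr1. Qed.

Lemma pmulDl : left_distributive pmul +%R.
Proof.
move=> x y z; rewrite -[x]preprK -[y]preprK -[z]preprK.
by rewrite -pprojD -!pmulE -pprojD mulrDl.
Qed.

Lemma pmulDr : right_distributive pmul +%R.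
Proof.
move=> x y z; rewrite -[x]preprK -[y]preprK -[z]preprK.
by rewrite -pprojD -!pmulE -pprojD mulrDr.
Qed.

HB.instance Definition _ :=
  GRing.Zmodule_isPzRing.Build P pmulA pmul1 pmulr1 pmulDl pmulDr.

Lemma pscaleA a b x : pscale a (pscale b x) = pscale (a * b) x.
Proof. by rewrite -[x]preprK -!pscaleE scalerA. Qed.

Lemma pscale1 : left_id 1 pscale.
Proof. by move=> x; rewrite -[x]preprK -pscaleE scale1r. Qed.

Lemma pscaleDr : right_distributive pscale +%R.
Proof.
move=> c x y; rewrite -[x]preprK -[y]preprK.
by rewrite -pprojD -!pscaleE -pprojD scalerDr.
Qed.

Lemma pscaleDl x : {morph pscale^~ x : a b / a + b}.
Proof.
by move=> a b; rewrite -[x]preprK -!pscaleE -pprojD scalerDl.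
Qed.

HB.instance Definition _ :=
  GRing.Zmodule_isLmodule.Build K P pscaleA pscale1 pscaleDr pscaleDl.

Lemma pproj1 : pproj 1 = 1.
Proof. by rewrite [RHS]/GRing.one /= pone.unlock. Qed.

Lemma pprojM x y : pproj (x * y) = pproj x * pproj y.
Proof. exact: pmulE. Qed.

Lemma pprojZ c x : pproj (c *: x) = c *: pproj x.
Proof. exact: pscaleE. Qed.

Lemma presented_scalerAl (c : K) (x y : P) : c *: (x * y) = (c *: x) * y.
Proof. by rewrite -[x]preprK -[y]preprK -pprojZ -!pprojM -pprojZ scalerAl. Qed.

Lemma presented_scalerAr (c : K) (x y : P) : c *: (x * y) = x * (c *: y).
Proof. by rewrite -[x]preprK -[y]preprK -pprojZ -!pprojM -pprojZ scalerAr. Qed.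

Lemma presented_neq0 (A : nzRingType) (f : {rmorphism F -> A}) :
  (forall x y, Rel x y -> f x = f y) -> (1 : P) != 0.
Proof.
move=> fRel; apply/eqP; rewrite -pproj0 -pproj1.
move=> /pproj_eq; rewrite subr0 => /(ideal_gen_morph fRel)/eqP.
by rewrite rmorph1 oner_eq0.
Qed.

Lemma presented_ex (A : algType K) (f : {lrmorphism F -> A}) :
  (forall x y, Rel x y -> f x = f y) ->
  exists g : {rmorphism P -> A}, scalable g /\ forall x, g (pproj x) = f x.
Proof.
move=> fRel; pose g (x : P) := f (prepr x).
have gE x : g (pproj x) = f x.
  apply/eqP; rewrite /g eq_sym -subr_eq0 -rmorphB; apply/eqP.
  exact/(ideal_gen_morph fRel)/prepr_proj.
have gD : zmod_morphism g.
  move=> x y; rewrite -[x]preprK -[y]preprK -scaleN1r.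
  by rewrite -pprojZ -pprojD !gE scaleN1r rmorphB.
have gM : monoid_morphism g.
  split=> [|x y]; last by rewrite -[x]preprK -[y]preprK -pprojM !gE rmorphM.
  by rewrite -pproj1 gE rmorph1.
pose G : {rmorphism P -> A} := HB.pack g
  (GRing.isZmodMorphism.Build P A g gD) (GRing.isMonoidMorphism.Build P A g gM).
exists G; split=> // c x; rewrite /G /= -[x]preprK -pprojZ !gE.
exact: linearZ.
Qed.

End PresentedAlgebra.

HB.mixin Record Lmodule_isLie (K : pzRingType) V of GRing.Lmodule K V := {
  lie : V -> V -> V;
  lie_linearl : forall z, linear (lie^~ z);
  lie_linearr : forall z, linear (lie z);
  liexx : forall x, lie x x = 0;
  lie_jacobi : forall x y z,
    lie x (lie y z) + lie y (lie z x) + lie z (lie x y) = 0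
}.

#[short(type="lieAlgType")]
HB.structure Definition LieAlgebra K :=
  {V of GRing.Lmodule K V & Lmodule_isLie K V}.

Definition comm (A : pzRingType) (x y : A) := x * y - y * x.
Notation "<| x , y |>" := (comm x y) : ring_scope.

Lemma rmorph_comm (A B : pzRingType) (f : {rmorphism A -> B}) (x y : A) :
  f <| x, y |> = <| f x, f y |>.
Proof. by rewrite rmorphB !rmorphM. Qed.

Lemma comm0r (A : pzRingType) (x : A) : <| x, 0 |> = 0.
Proof. by rewrite /comm mulr0 mul0r subrr. Qed.

Section EnvelopingAlgebra.
Variables (K : fieldType) (g : lieAlgType K).
Local Notation F := (free_alg K g).

(* The linear relations turn the free algebra on the set g into the tensor    *)
(* algebra of the vector space g.                                             *)
Inductive uea_rel : F -> F -> Prop :=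
| UeaLinear (a : K) (x y : g) :
    uea_rel (fgen (a *: x + y)) (a *: fgen x + fgen y)
| UeaBracket (x y : g) :
    uea_rel <| fgen x, fgen y |> (fgen (lie x y)).

Definition uea : Type := presented uea_rel.

HB.instance Definition _ := GRing.PzRing.on uea.
HB.instance Definition _ := GRing.Lmodule.on uea.

Lemma uea_neq0 : (1 : uea) != 0.
Proof.
have [f f0] := augm_ex K g.
apply: (presented_neq0 (f := f)) => _ _ [a x y | x y].
  by rewrite rmorphD -mulr_algl rmorphM !f0 mulr0 addr0.
by rewrite rmorph_comm !f0 comm0r.
Qed.

HB.instance Definition _ := GRing.PzSemiRing_isNonZero.Build uea uea_neq0.
HB.instance Definition _ := GRing.Lmodule_isLalgebra.Build K uea
  (@presented_scalerAl K g uea_rel).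
HB.instance Definition _ := GRing.Lalgebra_isAlgebra.Build K uea
  (@presented_scalerAr K g uea_rel).

End EnvelopingAlgebra.

(* The index set {1, ..., n, -n, ..., -1} is listed in this order by          *)
(* 'I_(2 * n), so that [rev_ord] is the negation of indices.                  *)
Definition tau (A : pzRingType) n (M : 'M[A]_(2 * n)) : 'M[A]_(2 * n) :=
  \matrix_(i, j) - M (rev_ord j) (rev_ord i).

Lemma tau_delta (A : pzRingType) n (i j : 'I_(2 * n)) :
  tau (delta_mx i j : 'M[A]_(2 * n)) = - delta_mx (rev_ord j) (rev_ord i).
Proof.
apply/matrixP => a b; rewrite !mxE andbC.
have revE (k l : 'I_(2 * n)) : (rev_ord k == l) = (k == rev_ord l).
  by rewrite -{1}[l]rev_ordK (inj_eq rev_ord_inj).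
by rewrite !revE.
Qed.

(* gl(2n)[u] is identified with the matrices over C[u], with the commutator   *)
(* as bracket: [mxu x r] is the tensor product of x and u^r, and [ttau] is    *)
(* the involution determined by [ttau_mxu], i.e., tau followed by u |-> -u.   *)
Definition mxu (K : fieldType) n (x : 'M[K]_n) (r : nat) : 'M[{poly K}]_n :=
  map_mx (fun c => c *: 'X^r) x.

Definition ttau (K : fieldType) n (M : 'M[{poly K}]_(2 * n)) :
    'M[{poly K}]_(2 * n) :=
  map_mx (fun p => p \Po (- 'X)) (tau M).

Lemma mxu_decomp (K : fieldType) n (M : 'M[{poly K}]_n) d :
  (forall i j, (size (M i j) <= d)%N) ->
  M = \sum_(r < d) mxu (map_mx (coefp r) M) r.
Proof.
move=> leMd; apply/matrixP => i j; rewrite summxE.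
under [RHS]eq_bigr do rewrite !mxE /=.
rewrite -(poly_def d (fun r => (M i j)`_r)); apply/polyP => k.
by rewrite coef_poly; case: ltnP => // /(leq_trans (leMd i j))/leq_sizeP->.
Qed.

Lemma mxu_comm (K : fieldType) n (x y : 'M[K]_n) r s :
  mxu x r *m mxu y s - mxu y s *m mxu x r = mxu (x *m y - y *m x) (r + s).
Proof.
have mxuM u v a b : mxu u a *m mxu v b = mxu (u *m v) (a + b) :> 'M_n.
  apply/matrixP => i j; rewrite !mxE scaler_suml; apply: eq_bigr => k _.
  by rewrite !mxE -scalerAl -scalerAr scalerA exprD.
rewrite !mxuM (addnC s r); apply/matrixP => i j.
by rewrite !mxE scalerBl.
Qed.

Lemma ttau_mxu (K : fieldType) n (x : 'M[K]_(2 * n)) r :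
  ttau (mxu x r) = (-1) ^+ r *: mxu (tau x) r.
Proof.
apply/matrixP => i j; rewrite !mxE rmorphN /= comp_polyZ rmorphXn /=.
by rewrite comp_polyX [in LHS]exprNn scaleNr mulrN -scalerAr.
Qed.

Section TwistedCurrent.
Variables (K : fieldType) (n : nat).
Local Notation M := 'M[{poly K}]_(2 * n).

Definition twcur_pred : {pred M} :=
  [pred x : M | (\tr x == 0) && (ttau x == x)].

Record twcur : predArgType :=
  TwCur { twcur_val :> M; _ : twcur_val \in twcur_pred }.

HB.instance Definition _ := [isSub for twcur_val].
HB.instance Definition _ := [Choice of twcur by <:].

Lemma twcur_predP (x : M) :
  reflect (\tr x = 0 /\ ttau x = x) (x \in twcur_pred).
Proof.
by rewrite inE; apply: (iffP andP) => -[/eqP ? /eqP ?].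
Qed.

Lemma ttauZB (c : K) (x y : M) :
  ttau (c%:P *: x - y) = c%:P *: ttau x - ttau y.
Proof.
apply/matrixP => i j; rewrite !mxE opprB !rmorphB !rmorphN !rmorphM /=.
by rewrite comp_polyC mulrN opprK addrC.
Qed.

Lemma ttau0 : ttau (0 : M) = 0.
Proof. by apply/matrixP => i j; rewrite !mxE oppr0 comp_poly0. Qed.

Lemma ttauM (x y : M) : ttau (x *m y) = - (ttau y *m ttau x).
Proof.
apply/matrixP => i j; rewrite !mxE rmorphN rmorph_sum; congr (- _).
rewrite [RHS](reindex_inj rev_ord_inj); apply: eq_bigr => k _.
by rewrite !mxE !rev_ordK rmorphM !rmorphN mulrNN mulrC.
Qed.

Lemma twcur_zmod_closed : zmod_closed twcur_pred.
Proof.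
split=> [|x y /twcur_predP[tx ttx] /twcur_predP[ty tty]]; apply/twcur_predP.
  by rewrite raddf0 ttau0.
rewrite raddfB /= tx ty subr0; split=> //.
by have := ttauZB 1 x y; rewrite !scale1r ttx tty.
Qed.

HB.instance Definition _ :=
  GRing.isZmodClosed.Build M twcur_pred twcur_zmod_closed.
HB.instance Definition _ := [SubChoice_isSubZmodule of twcur by <:].

Lemma twcur_scale_subproof (c : K) (x : twcur) :
  c%:P *: (x : M) \in twcur_pred.
Proof.
case: x => x /= /twcur_predP[tx ttx]; apply/twcur_predP.
rewrite mxtraceZ tx mulr0; split=> //.
by have := ttauZB c x 0; rewrite ttau0 !subr0 ttx.
Qed.

Definition twcur_scale (c : K) (x : twcur) := TwCur (twcur_scale_subproof c x).

Fact twcur_scaleA a b x :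
  twcur_scale a (twcur_scale b x) = twcur_scale (a * b) x.
Proof. by apply: val_inj; rewrite /= scalerA polyCM. Qed.

Fact twcur_scale1 : left_id 1 twcur_scale.
Proof. by move=> x; apply: val_inj; rewrite /= scale1r. Qed.

Fact twcur_scaleDr : right_distributive twcur_scale +%R.
Proof. by move=> c x y; apply: val_inj; rewrite /= scalerDr. Qed.

Fact twcur_scaleDl x : {morph twcur_scale^~ x : a b / a + b}.
Proof. by move=> a b; apply: val_inj; rewrite /= polyCD scalerDl. Qed.

HB.instance Definition _ := GRing.Zmodule_isLmodule.Build K twcur
  twcur_scaleA twcur_scale1 twcur_scaleDr twcur_scaleDl.

Lemma twcur_lie_subproof (x y : twcur) :
  (x : M) *m y - (y : M) *m x \in twcur_pred.
Proof.
case: x y => x /= /twcur_predP[tx ttx] [y /= /twcur_predP[ty tty]].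
apply/twcur_predP; rewrite raddfB /= mxtrace_mulC subrr; split=> //.
have := ttauZB 1 (x *m y) (y *m x); rewrite !scale1r !ttauM ttx tty => ->.
by rewrite opprK addrC.
Qed.

Definition twcur_lie (x y : twcur) := TwCur (twcur_lie_subproof x y).

Fact twcur_lie_linearl z : linear (twcur_lie^~ z).
Proof.
move=> c x y; apply: val_inj => /=.
rewrite mulmxDl mulmxDr -scalemxAl -scalemxAr scalerBr opprD.
by rewrite addrACA.
Qed.

Fact twcur_lie_linearr z : linear (twcur_lie z).
Proof.
move=> c x y; apply: val_inj => /=.
rewrite mulmxDl mulmxDr -scalemxAl -scalemxAr scalerBr opprD.
by rewrite addrACA.
Qed.

Fact twcur_liexx x : twcur_lie x x = 0.
Proof. by apply: val_inj; rewrite /= subrr. Qed.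

Fact twcur_lie_jacobi x y z :
  twcur_lie x (twcur_lie y z) + twcur_lie y (twcur_lie z x)
    + twcur_lie z (twcur_lie x y) = 0.
Proof.
apply: val_inj; rewrite /= !mulmxBl !mulmxBr !mulmxA.
rewrite !opprB !addrA !subrK (ACl (1*8*2*5*3*6*4*7)) /=.
by rewrite subrr add0r addNr add0r subrr add0r addNr.
Qed.

HB.instance Definition _ := Lmodule_isLie.Build K twcur
  twcur_lie_linearl twcur_lie_linearr twcur_liexx twcur_lie_jacobi.

End TwistedCurrent.

(* [SymH i r] stands for H_{i,r}; [SymX true i r] and [SymX false i r] stand  *)
(* for X^+_{i,r} and X^-_{i,r}.  Indices start at 1.                          *)
Inductive sym := SymH of nat & nat | SymX of bool & nat & nat.

Definition sym_code (x : sym) : (nat * nat) + (bool * nat * nat) :=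
  match x with SymH i r => inl (i, r) | SymX e i r => inr (e, i, r) end.
Definition sym_decode (x : (nat * nat) + (bool * nat * nat)) : sym :=
  match x with inl (i, r) => SymH i r | inr (e, i, r) => SymX e i r end.
Lemma sym_codeK : cancel sym_code sym_decode. Proof. by case. Qed.

HB.instance Definition _ := Choice.copy sym (can_type sym_codeK).

Definition Hdef n i r := (1 <= i <= if odd r then n - 1 else n)%N.
Definition Xdef n i r := (1 <= i <= if odd r then n + 1 else n)%N.

Definition sym_def n : pred sym := fun x =>
  match x with SymH i r => Hdef n i r | SymX _ i r => Xdef n i r end.

Definition Lgen n : choiceType := {x : sym | sym_def n x}.

Definition delta (i j : nat) : int := (i == j)%:R.

Definition cartan (n i j : nat) : int :=
  if (i == n) || (j == n) then
    2 * delta i j - delta i (n - 2) - delta j (n - 2)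
  else 2 * delta i j - delta i (j + 1) - delta (i + 1) j.

Definition cartan_tw (n r i j : nat) : int :=
  cartan n i j + (if odd r then 2 * delta i (n - 1) * delta j n else 0).

Definition fork (n i j : nat) : bool :=
  ((i, j) == (n - 1, n)%N) || ((i, j) == (n, n - 1)%N).

Section AlgebraL.
Variables (K : fieldType) (n : nat).
Local Notation F := (free_alg K (Lgen n)).

(* The junk value 0 outside the index range is never used in [Lrel] below.    *)
Definition Lsym (x : sym) : F :=
  if (insub x : option (Lgen n)) is Some g then fgen g else 0.

Definition LH (i r : nat) : F := Lsym (SymH i r).
Definition LX (e : bool) (i r : nat) : F := Lsym (SymX e i r).

Local Notation H := LH.
Local Notation X := LX.
Local Notation Xp := (LX true).
Local Notation Xm := (LX false).
Local Notation "c *~: x" := (c%:~R *: x) (at level 40).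

Definition pm (e : bool) : int := if e then 1 else -1.

Inductive Lrel : F -> F -> Prop :=
| Lrel_HH i r j s : Hdef n i r -> Hdef n j s ->
    Lrel <| H i r, H j s |> 0
| Lrel_HX e i r j s : Hdef n i r -> Xdef n j s -> j != (n + 1)%N ->
    Lrel <| H i r, X e j s |> ((pm e * cartan_tw n r i j) *~: X e j (r + s))
| Lrel_HX_last_odd e i r s : Hdef n i r -> Xdef n (n + 1) s -> odd r ->
    Lrel <| H i r, X e (n + 1) s |> 0
| Lrel_HX_last_even e i r s : Hdef n i r -> Xdef n (n + 1) s -> ~~ odd r ->
    Lrel <| H i r, X e (n + 1) s |>
      ((pm e * (2 * delta i n - 2 * delta i (n - 1))) *~: X e (n + 1) (r + s))
| Lrel_XpXm i r j s : (1 <= i <= n - 1)%N -> (1 <= j <= n - 1)%N ->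
    Lrel <| Xp i r, Xm j s |> (delta i j *~: H i (r + s))
| Lrel_XpnXm_even r j s : Xdef n j s -> j != (n - 1)%N -> j != (n + 1)%N ->
    ~~ odd (r + s) ->
    Lrel <| Xp n r, Xm j s |> (delta n j *~: H n (r + s))
| Lrel_XpnXm_odd r j s : Xdef n j s -> j != (n - 1)%N -> j != (n + 1)%N ->
    odd (r + s) ->
    Lrel <| Xp n r, Xm j s |> (delta n j *~: H (n - 1) (r + s))
| Lrel_XpnXmn1_even r s : ~~ odd (r + s) ->
    Lrel <| Xp n r, Xm (n - 1) s |> 0
| Lrel_XpnXmn1_odd r s : odd (r + s) ->
    Lrel <| Xp n r, Xm (n - 1) s |> (- Xp (n + 1) (r + s))
| Lrel_XpXmn_even j r s : Xdef n j r -> j != (n - 1)%N -> j != (n + 1)%N ->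
    ~~ odd (r + s) ->
    Lrel <| Xp j r, Xm n s |> (delta n j *~: H n (r + s))
| Lrel_XpXmn_odd j r s : Xdef n j r -> j != (n - 1)%N -> j != (n + 1)%N ->
    odd (r + s) ->
    Lrel <| Xp j r, Xm n s |> (delta n j *~: H (n - 1) (r + s))
| Lrel_Xpn1Xmn_even r s : ~~ odd (r + s) ->
    Lrel <| Xp (n - 1) r, Xm n s |> 0
| Lrel_Xpn1Xmn_odd r s : odd (r + s) ->
    Lrel <| Xp (n - 1) r, Xm n s |> (- Xm (n + 1) (r + s))
| Lrel_XpXm_last r s :
    Lrel <| Xp (n + 1) (2 * r + 1), Xm (n + 1) (2 * s + 1) |>
      (2%:R *: (H n (2 * r + 2 * s + 2) - H (n - 1) (2 * r + 2 * s + 2)))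
| Lrel_shift e i r j s : (1 <= i <= n)%N -> (1 <= j <= n)%N -> ~~ fork n i j ->
    Lrel <| X e i (r + 1), X e j s |> <| X e i r, X e j (s + 1) |>
| Lrel_shift_fork e r s :
    Lrel <| X e n (r + 1), X e (n - 1) s |>
      (- <| X e n r, X e (n - 1) (s + 1) |>)
| Lrel_last_last e r s :
    Lrel <| X e (n + 1) (2 * r + 1), X e (n + 1) (2 * s + 1) |> 0
| Lrel_XiXi e i r s : (1 <= i <= n)%N ->
    Lrel <| X e i r, X e i s |> 0
| Lrel_last_X e e' r j s : Xdef n j s -> (j < n - 1)%N ->
    Lrel <| X e (n + 1) (2 * r + 1), X e' j s |> 0
| Lrel_Xplast_Xpn1 r s :
    Lrel <| Xp (n + 1) (2 * r + 1), Xp (n - 1) s |>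
      ((-2) *~: Xp n (2 * r + s + 1))
| Lrel_Xplast_Xmn1 r s :
    Lrel <| Xp (n + 1) (2 * r + 1), Xm (n - 1) s |> 0
| Lrel_Xplast_Xmn r s :
    Lrel <| Xp (n + 1) (2 * r + 1), Xm n s |>
      (2 *~: Xm (n - 1) (2 * r + s + 1))
| Lrel_Xplast_Xpn r s :
    Lrel <| Xp (n + 1) (2 * r + 1), Xp n s |> 0
| Lrel_Xmlast_Xmn1 r s :
    Lrel <| Xm (n + 1) (2 * r + 1), Xm (n - 1) s |>
      (2 *~: Xm n (2 * r + s + 1))
| Lrel_Xmlast_Xpn1 r s :
    Lrel <| Xm (n + 1) (2 * r + 1), Xp (n - 1) s |> 0
| Lrel_Xmlast_Xpn r s :
    Lrel <| Xm (n + 1) (2 * r + 1), Xp n s |>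
      ((-2) *~: Xp (n - 1) (2 * r + s + 1))
| Lrel_Xmlast_Xmn r s :
    Lrel <| Xm (n + 1) (2 * r + 1), Xm n s |> 0
| Lrel_commute e i r j s : (1 <= i <= n)%N -> (1 <= j <= n)%N ->
    cartan n i j = 0 -> ~~ fork n i j ->
    Lrel <| X e i r, X e j s |> 0
| Lrel_commute_fork e r s : ~~ odd (r + s) ->
    Lrel <| X e (n - 1) r, X e n s |> 0
| Lrel_serre_fork e i r1 r2 j s : fork n i j -> odd (r1 + s) -> odd (r2 + s) ->
    Lrel <| X e i r1, <| X e i r2, X e j s |> |> 0
| Lrel_serre e i r1 r2 j s : (1 <= i <= n)%N -> (1 <= j <= n)%N ->
    cartan n i j = -1 ->
    Lrel <| X e i r1, <| X e i r2, X e j s |> |> 0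
| Lrel_triple e r s u :
    Lrel <| X e n s, <| X e (n - 2) r, X e (n - 1) u |> |>
      ((-1) ^+ (s + u) *: <| X e (n - 1) u, <| X e (n - 2) r, X e n s |> |>)
| Lrel_quad1 e r s :
    Lrel <| <| X e n 0, X e (n - 2) r |>, <| X e n 0, X e (n - 1) s |> |> 0
| Lrel_six1 r s :
    Lrel <| <| Xp n s, <| Xp (n - 2) 0, Xp (n - 3) 0 |> |>,
            <| <| Xp (n - 1) 0, Xp (n - 2) 0 |>, Xp n r |> |> 0
| Lrel_five1 r s :
    Lrel <| <| Xp n (2 * r + 1), Xp (n - 2) 0 |>,
            <| <| Xp (n - 1) 0, Xp (n - 2) 0 |>, Xp n s |> |> 0
| Lrel_quad2 e r s :
    Lrel <| <| X e (n - 1) 0, X e (n - 2) 0 |>,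
            <| X e (n - 1) s, X e n r |> |> 0
| Lrel_six2 r s :
    Lrel <| <| Xp (n - 1) s, <| Xp (n - 2) 0, Xp (n - 3) 0 |> |>,
            <| <| Xp (n - 1) 0, Xp (n - 2) 0 |>, Xp n r |> |> 0
| Lrel_five2 r s :
    Lrel <| <| Xp (n - 1) s, Xp (n - 2) 0 |>,
            <| <| Xp (n - 1) 0, Xp (n - 2) 0 |>, Xp n r |> |> 0.

Definition Lalg : Type := presented Lrel.

HB.instance Definition _ := GRing.PzRing.on Lalg.
HB.instance Definition _ := GRing.Lmodule.on Lalg.

Lemma Lalg_neq0 : (1 : Lalg) != 0.
Proof.
have [f f0] := augm_ex K (Lgen n).
have fsym x : f (Lsym x) = 0.
  by rewrite /Lsym; case: insubP => *; rewrite ?f0 ?rmorph0.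
have [k fZ] : exists k, forall c x, f (c *: x) = k c * f x.
  by exists (fun c => f c%:A) => c x; rewrite -(mulr_algl c x) rmorphM.
apply: (presented_neq0 (f := f)) => _ _ []; intros.
all: by rewrite ?(rmorph_comm, fZ, rmorphN, rmorphB, fsym, rmorph0,
  mulr0, subr0, oppr0, comm0r).
Qed.

HB.instance Definition _ := GRing.PzSemiRing_isNonZero.Build Lalg Lalg_neq0.
HB.instance Definition _ := GRing.Lmodule_isLalgebra.Build K Lalg
  (@presented_scalerAl K _ Lrel).
HB.instance Definition _ := GRing.Lalgebra_isAlgebra.Build K Lalg
  (@presented_scalerAr K _ Lrel).

End AlgebraL.

(* Main.v *)
Require Import Defs.
From HB Require Import structures.
From mathcomp Require Import all_boot all_order all_algebra.
From mathcomp Require Import boolp reals complex.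
From mathcomp Require Import monalg zify.

(* Write F_ij u^r, with i, j in {1, ..., n, -n, ..., -1}, for the projection  *)
(* of E_ij u^r to the fixed points of the twisted involution.  Sending        *)
(* X^+_i, X^-_i to F_{i,i+1}, F_{i+1,i} (i < n), to F_{n-1,-n}, F_{-n,n-1}    *)
(* (i = n) and to F_{n,-n}, F_{-n,n} (i = n + 1) respects the relations, so   *)
(* it gives rho : L -> gl(2n)[u] and Psi : L -> U.                            *)
(* Conversely, iterated brackets of generators define elements f_ij^r of L    *)
(* with rho(f_ij^r) = F_ij u^r.  Since the F_ij u^r are independent, it is    *)
(* enough to show that the span of the f_ij^r is stable under ad X^+-_{i,r}:  *)
(* then rho is injective on this span, which is a Lie algebra, and the        *)
(* inverse is a Lie morphism into L that extends to U and inverts Psi; no     *)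
(* structure constant has to be computed in L.                                *)
(* Stability: removing one of the last two nodes of the diagram D_n leaves    *)
(* two chains of type A_{n-1}, whose relations present sl(n)[u]; the two      *)
(* copies share sl(n-1)[u] and differ by vectors p_i, p'_i and covectors q_i, *)
(* q'_i.  The remaining roots are the brackets [p_i, p'_j]; the triple        *)
(* relation makes them symmetric up to sign in i, j and dependent only on     *)
(* the total degree, and then [p_k, [p_i, p'_j]] = 0 since it is symmetric    *)
(* in (k, i) and antisymmetric in (i, j).                                     *)

Set Implicit Arguments.
Unset Strict Implicit.
Unset Printing Implicit Defensive.

Import GRing.Theory.
Local Open Scope ring_scope.

(** Write g for the twisted current algebra. No basis of [L] is computed. The morphism [Psi] from
    [L] to the enveloping algebra exists because the defining relations hold for explicit matrices
    ([presentation_rel]), and the same computation gives [rho] from [L] to matrices. An inverse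
    amounts to a Lie morphism from g to [L] that sends the matrix of each generator to that
    generator.

    As a linear map the candidate is forced. Each F_ij u^r (corrected on the diagonal in odd degree)
    is obtained from generator matrices by brackets and linear combinations; [entry] performs the
    same operations in [L], and [section_map] extends them linearly. By [entry_antisym] the elements
    of [L] obey the symmetry of the F_ij, so [section_map] sends F_ij u^r to the entry
    ([section_map_fmx]), and [section_mapK] shows that [rho] undoes [section_map] on g. Let V be the
    space of fixed points of [section_map] after [rho]. If V is closed under brackets, then a
    bracket of two elements of V is determined by its image under [rho], where it is a commutator of
    matrices; hence [section_map] is a Lie morphism on g.

    For closure, [ad_entry] gives stability of V under ad of the generators X_l with l at most n.
    The elements that normalize V form a Lie algebra, which then contains all generators
    ([lie_genX], [lie_genH]) and all entries ([entry_tracks]). The proof of [ad_entry] uses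
    [chain_sl_system] for brackets inside one of the two chains of type A. Across the chains, a
    vector and a covector pair to a multiple of X_{n+1} ([pq_pairing]), and two vectors give the
    brackets governed by [fork_normal], [fork_sym] and [fork_comm0]. *)

Section Commutator.

(** * Commutator calculus *)

Variable A : pzRingType.
Implicit Types x y z : A.

Lemma commC x y : <| x, y |> = - <| y, x |>.
Proof. by rewrite /comm opprB. Qed.

Lemma comm0l x : <| 0, x |> = 0.
Proof. by rewrite commC comm0r oppr0. Qed.

Lemma commDl x y z : <| x + y, z |> = <| x, z |> + <| y, z |>.
Proof. by rewrite /comm mulrDl mulrDr opprD addrACA. Qed.

Lemma commDr x y z : <| z, x + y |> = <| z, x |> + <| z, y |>.
Proof. by rewrite /comm mulrDl mulrDr opprD addrACA. Qed.

Lemma commNl x y : <| - x, y |> = - <| x, y |>.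
Proof. by rewrite /comm mulNr mulrN opprB opprK addrC. Qed.

Lemma commNr x y : <| x, - y |> = - <| x, y |>.
Proof. by rewrite commC commNl -commC. Qed.

Lemma commNN x y : <| - x, - y |> = <| x, y |>.
Proof. by rewrite commNl commNr opprK. Qed.

Lemma comm_suml (I : Type) (s : seq I) (P : pred I) (F : I -> A) y :
  <| \sum_(i <- s | P i) F i, y |> = \sum_(i <- s | P i) <| F i, y |>.
Proof.
by apply: (big_morph (fun x => <| x, y |>)) => [a b|];
  [exact: commDl | exact: comm0l].
Qed.

Lemma comm_sumr (I : Type) (s : seq I) (P : pred I) (F : I -> A) y :
  <| y, \sum_(i <- s | P i) F i |> = \sum_(i <- s | P i) <| y, F i |>.
Proof.
by apply: (big_morph (fun x => <| y, x |>)) => [a b|];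
  [exact: commDr | exact: comm0r].
Qed.

Lemma comm_jacobi x y z :
  <| x, <| y, z |> |> = <| <| x, y |>, z |> + <| y, <| x, z |> |>.
Proof.
rewrite /comm !mulrBl !mulrBr !mulrA !opprB !addrA.
rewrite [RHS](ACl (1*8*3*6*(2*5)*(4*7))) /=.
by rewrite !addNr !addr0.
Qed.

End Commutator.

Section CommutatorScale.
Variables (K : fieldType) (A : algType K).
Implicit Types x y z : A.

Lemma commZl c x y : <| c *: x, y |> = c *: <| x, y |>.
Proof. by rewrite /comm -scalerAl -scalerAr scalerBr. Qed.

Lemma commZr c x y : <| x, c *: y |> = c *: <| x, y |>.
Proof. by rewrite commC commZl -scalerN -commC. Qed.

End CommutatorScale.

(** * Loop generators of type A and the root vectors built from them *)

Section Systems.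
Variables (K : fieldType) (A : algType K).
Implicit Types (x : nat -> nat -> nat -> A) (X Xp Xm H : nat -> nat -> A).

(* [x i j r] stands for the matrix unit E_ij u^r of sl(k+1)[u].               *)
Record sl_system (k : nat) x H : Prop := SlSystem {
  sl_chain i j l r s : (i <= k)%N -> (j <= k)%N -> (l <= k)%N ->
    i != j -> j != l -> i != l -> <| x i j r, x j l s |> = x i l (r + s)%N;
  sl_zero i j a b r s : (i <= k)%N -> (j <= k)%N -> (a <= k)%N -> (b <= k)%N ->
    i != j -> a != b -> j != a -> i != b -> <| x i j r, x a b s |> = 0;
  sl_diag i j r s : (i < j)%N -> (j <= k)%N ->
    <| x i j r, x j i s |> = \sum_(i <= l < j) H l (r + s)%N
}.

(* The Chevalley involution E_ij |-> - E_ji; it turns every statement about   *)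
(* raising elements into one about lowering elements.                         *)
Definition dual_units x i j r : A := - x j i r.

Lemma sl_system_dual k x H :
  sl_system k x H -> sl_system k (dual_units x) (fun l r => - H l r).
Proof.
case=> chain zero diag; split; rewrite /dual_units.
- move=> i j l r s ik jk lk ij jl il; rewrite commNN commC chain 1?addnC //;
    by rewrite eq_sym.
- move=> i j a b r s ik jk ak bk ij ab ja ib.
  rewrite commNN commC zero ?oppr0 //;
    by rewrite eq_sym.
- move=> i j r s ij jk; rewrite commNN commC diag // addnC.
  by rewrite sumrN.
Qed.

(** The Chevalley involution carries the lowering relations to the raising ones, so a single record
    serves both halves: [chain] applies it to [- Xm] and [- H] for the lowering half. *)
Record half_chain (N : nat) X H : Prop := HalfChain {
  hc_weight l r s : (l.+1 < N)%N ->
    <| H l r, X l.+1 s |> = - X l.+1 (r + s)%N /\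
    <| H l.+1 r, X l s |> = - X l (r + s)%N;
  hc_weight0 l l' r s : (l < N)%N -> (l' < N)%N ->
    (l.+1 < l')%N || (l'.+1 < l)%N -> <| H l r, X l' s |> = 0;
  hc_shift l r s : (l.+1 < N)%N ->
    <| X l r.+1, X l.+1 s |> = <| X l r, X l.+1 s.+1 |>;
  hc_self l r s : (l < N)%N -> <| X l r, X l s |> = 0;
  hc_far l l' r s : (l < N)%N -> (l' < N)%N ->
    (l.+1 < l')%N || (l'.+1 < l)%N -> <| X l r, X l' s |> = 0;
  hc_serre l r s t : (l.+1 < N)%N ->
    <| X l r, <| X l s, X l.+1 t |> |> = 0 /\
    <| X l.+1 r, <| X l.+1 s, X l t |> |> = 0
}.

Record chain (N : nat) Xp Xm H : Prop := Chain {
  ch_pos : half_chain N Xp H;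
  ch_neg : half_chain N (fun l r => - Xm l r) (fun l r => - H l r);
  ch_pm l l' r s : (l < N)%N -> (l' < N)%N ->
    <| Xp l r, Xm l' s |> = if l == l' then H l (r + s)%N else 0
}.

Lemma chain_dual N Xp Xm H : chain N Xp Xm H ->
  chain N (fun l r => - Xm l r) (fun l r => - Xp l r) (fun l r => - H l r).
Proof.
case=> pos neg pm; split=> //.
  by case: pos => h1 h2 h3 h4 h5 h6; split=> *;
    rewrite ?opprK ?(commNl, commNr, opprK);
    have [] := (h1, h2, h3, h4, h5, h6); auto.
move=> l l' r s lN l'N; rewrite commNN commC pm // eq_sym addnC.
by case: eqP => [->|] //; rewrite oppr0.
Qed.

(** The whole degree sits on the last generator; [unit_shift] shows that other splittings of the
    degree give the same element. *)
Fixpoint raise X (i j : nat) (r : nat) : A :=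
  if j is j'.+1 then
    if i == j' then X j' r else <| raise X i j' 0, X j' r |>
  else 0.

Fixpoint lower X (i j : nat) (r : nat) : A :=
  if i is i'.+1 then
    if j == i' then X i' r else <| X i' r, lower X i' j 0 |>
  else 0.

Definition unit_of Xp Xm i j r : A :=
  if (i < j)%N then raise Xp i j r else lower Xm i j r.

Lemma raiseN X i j r : (i < j)%N ->
  raise (fun l s => - X l s) i j r = - lower X j i r.
Proof.
elim: j r => // j IH r; rewrite ltnS leq_eqVlt /=.
case: eqVneq => //= ij lt_ij.
by rewrite IH // commNN commC.
Qed.

Lemma lowerN X i j r : (j < i)%N ->
  lower (fun l s => - X l s) i j r = - raise X j i r.
Proof.
elim: i r => // i IH r; rewrite ltnS leq_eqVlt /=.
case: eqVneq => //= ij lt_ij.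
by rewrite IH // commNN commC.
Qed.

Lemma lower0 X i j r : (i <= j)%N -> lower X i j r = 0.
Proof.
elim: i r => //= i IH r ij; rewrite gtn_eqF //.
by rewrite IH ?comm0r // ltnW.
Qed.

Lemma unit_of_dual Xp Xm i j r :
  unit_of (fun l s => - Xm l s) (fun l s => - Xp l s) i j r =
  dual_units (unit_of Xp Xm) i j r.
Proof.
rewrite /unit_of /dual_units; case: (ltngtP i j) => [ij|ji|->].
- by rewrite raiseN.
- by rewrite lowerN.
- by rewrite !lower0 ?oppr0.
Qed.

Lemma sl_system_ext k x y H : (forall i j r, x i j r = y i j r) ->
  sl_system k x H -> sl_system k y H.
Proof. by move=> e [h1 h2 h3]; split=> *; rewrite -?e; auto. Qed.

Lemma sl_system_unit_dual k Xp Xm H : sl_system k (unit_of Xp Xm) H ->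
  sl_system k (unit_of (fun l s => - Xm l s) (fun l s => - Xp l s))
    (fun l r => - H l r).
Proof.
move/sl_system_dual; apply: sl_system_ext => i j r.
by rewrite unit_of_dual.
Qed.

Lemma raiseS X i j r : (i < j)%N ->
  raise X i j.+1 r = <| raise X i j 0, X j r |>.
Proof. by move=> /=; case: eqVneq => // ->; rewrite ltnn. Qed.

Lemma raise1 X i r : raise X i i.+1 r = X i r.
Proof. by rewrite /= eqxx. Qed.

Lemma raise_ind X (P : A -> Prop) i j r : (i < j)%N ->
  (forall a b, P a -> P b -> P <| a, b |>) ->
  (forall l s, (i <= l < j)%N -> P (X l s)) -> P (raise X i j r).
Proof.
move=> ij Pc; elim: j r ij => // j IH r; rewrite ltnS leq_eqVlt /=.
case: eqVneq => [<- _ PX|_ /= ij PX]; first by apply: PX; rewrite leqnn ltnSn.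
apply: Pc; last by apply: PX; rewrite ltnSn ltnW.
by apply: IH => // l s /andP[il lj]; apply: PX; rewrite il ltnS ltnW.
Qed.

Lemma lower_ind X (P : A -> Prop) i j r : (j < i)%N ->
  (forall a b, P a -> P b -> P <| a, b |>) ->
  (forall l s, (j <= l < i)%N -> P (X l s)) -> P (lower X i j r).
Proof.
move=> ij Pc; elim: i r ij => // i IH r; rewrite ltnS leq_eqVlt /=.
case: eqVneq => [<- _ PX|_ /= ij PX]; first by apply: PX; rewrite leqnn ltnSn.
apply: Pc; first by apply: PX; rewrite ltnSn ltnW.
by apply: IH => // l s /andP[il lj]; apply: PX; rewrite il ltnS ltnW.
Qed.

Lemma comm_centralizer (y a b : A) :
  <| a, y |> = 0 -> <| b, y |> = 0 -> <| <| a, b |>, y |> = 0.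
Proof.
move=> ay by0; rewrite commC comm_jacobi (commC y a) (commC y b) ay by0.
by rewrite !oppr0 comm0l comm0r addr0 oppr0.
Qed.

Lemma comm_swap (a b c : A) :
  <| a, b |> = 0 -> <| a, <| b, c |> |> = <| b, <| a, c |> |>.
Proof. by move=> ab; rewrite comm_jacobi ab comm0l add0r. Qed.

Lemma comm_pull (a b c : A) :
  <| a, c |> = 0 -> <| <| a, b |>, c |> = <| a, <| b, c |> |>.
Proof. by move=> ac; rewrite [RHS]comm_jacobi ac comm0r addr0. Qed.

End Systems.

(** * Adjoining one node to a chain: the new column and the new row *)

Section NodeStep.
Variables (K : fieldType) (A : algType K).
Hypothesis torsion2 : forall a : A, a = - a -> a = 0.
Variables (Xp Xm H : nat -> nat -> A) (N k : nat).
Hypotheses (chX : chain N Xp Xm H) (kN : (k < N)%N).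
Local Notation x := (unit_of Xp Xm).
Hypothesis slx : sl_system k x H.

Let posX := ch_pos chX.

Lemma unit_raise i j r : (i < j)%N -> x i j r = raise Xp i j r.
Proof. by rewrite /unit_of => ->. Qed.

Lemma unit_lower i j r : (j < i)%N -> x i j r = lower Xm i j r.
Proof. by move=> ji; rewrite /unit_of ltnNge ltnW. Qed.

Lemma unit_node r : x k k.+1 r = Xp k r.
Proof. by rewrite unit_raise // raise1. Qed.

Lemma unit_nodeS i r : (i < k)%N -> x i k.+1 r = <| x i k 0, Xp k r |>.
Proof. by move=> ik; rewrite (unit_raise _ (leqW ik)) unit_raise // raiseS. Qed.

(** A raising unit with [j < k] involves only nodes not adjacent to [k]; a lowering unit involves
    only [Xm l] with [l < k], which commute with [Xp k]. *)
Lemma unit_far_commute i j t r : (i <= k)%N -> (j < k)%N -> i != j ->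
  <| x i j t, Xp k r |> = 0.
Proof.
move=> ik jk; rewrite neq_ltn => /orP[ij|ji].
  rewrite unit_raise //.
  apply: (raise_ind (P := fun a => <| a, Xp k r |> = 0)) => //
    [|l s /andP[_ lj]].
    by move=> a b; exact: comm_centralizer.
  by apply: (hc_far posX); rewrite ?kN // ?(leq_trans lj jk); lia.
rewrite unit_lower //.
apply: (lower_ind (P := fun a => <| a, Xp k r |> = 0)) => //
  [|l s /andP[_ lj]].
  by move=> a b; exact: comm_centralizer.
have lk : (l < k)%N by lia.
rewrite commC (ch_pm chX) //; last exact: ltn_trans kN.
by rewrite gtn_eqF // oppr0.
Qed.

(** The shift relation moves degree from node [k - 1] to node [k]; the initial part of the unit
    commutes with [Xp k] and is carried along. *)
Lemma unit_shift i t r : (i < k)%N ->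
  <| x i k t, Xp k r |> = x i k.+1 (t + r)%N.
Proof.
move=> ik; rewrite unit_nodeS //; case: k kN ik slx unit_far_commute => // m mN.
have shift a b : <| Xp m a, Xp m.+1 b |> = <| Xp m 0, Xp m.+1 (a + b)%N |>.
  by elim: a b => // a IH b; rewrite (hc_shift posX) // IH addnS.
rewrite ltnS leq_eqVlt => /orP[/eqP-> _ _|im _ far].
  by rewrite !unit_raise // !raise1 shift.
have imS a : x i m.+1 a = <| x i m 0, Xp m a |>.
  by rewrite (unit_raise _ (leqW im)) raiseS // -unit_raise.
have far0 a : <| x i m 0, Xp m.+1 a |> = 0 by apply: far; lia.
by rewrite !imS (comm_pull _ (far0 r)) (comm_pull _ (far0 _)) shift.
Qed.

(** The case [i = l = k - 1] is a Serre relation; the other cases follow from it by the action of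
    smaller units. *)
Lemma unit_serre i l t r : (i < k)%N -> (l < k)%N ->
  <| x i k t, x l k.+1 r |> = 0.
Proof.
case: k kN slx unit_far_commute unit_shift unit_nodeS => // m mN sl far shift
  nodeS.
have pE j r' : (j < m)%N -> x j m.+2 r' = <| x j m 0, x m m.+2 r' |>.
  move=> jm; rewrite !nodeS //; last lia.
  have far0 : <| x j m 0, Xp m.+1 r' |> = 0 by apply: far; lia.
  rewrite [RHS]comm_jacobi far0.
  by rewrite comm0r addr0 (sl_chain sl) //; lia.
have mm t' r' : <| x m m.+1 t', x m m.+2 r' |> = 0.
  rewrite nodeS // !unit_raise // !raise1.
  by case: (hc_serre posX (l := m) t' 0 r') => //; lia.
have swap i' t' s' r' : (i' < m)%N ->
    <| x i' m.+1 t', x m m.+2 (s' + r')%N |> =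
    <| x m m.+1 s', x i' m.+2 (t' + r')%N |>.
  move=> im; rewrite -!shift //; try lia; apply: comm_swap.
  by apply: (sl_zero sl); lia.
have im0 i' t' r' : (i' < m)%N -> <| x i' m.+1 t', x m m.+2 r' |> = 0.
  move=> im.
  have e1 t1 r1 : <| x i' m.+1 t1, x m m.+2 r1 |> =
      <| x m m.+1 0, x i' m.+2 (t1 + r1)%N |> by rewrite -swap.
  have e2 : <| x m m.+1 t', x i' m.+2 r' |> =
      <| x m m.+1 0, x i' m.+2 (t' + r')%N |>.
    by have := swap i' r' t' 0 im; rewrite !addn0 e1 addnC => <-.
  (* Applied to the Serre identity, ad gives a sum of two brackets. By [e1] and [e2] both equal the
     same element, so it vanishes for lack of 2-torsion. *)
  have := congr1 (fun v => <| x i' m 0, v |>) (mm t' r').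
  rewrite /= comm0r comm_jacobi -pE // (sl_chain sl) // ?add0n; try lia.
  by rewrite e1 e2 => /eqP; rewrite addr_eq0 => /eqP/torsion2.
rewrite !ltnS leq_eqVlt => /orP[/eqP-> | im].
  rewrite leq_eqVlt => /orP[/eqP-> // | lm].
  have := swap l r t 0 lm; rewrite !addn0 => <-; exact: im0.
rewrite leq_eqVlt => /orP[/eqP-> | lm]; first exact: im0.
rewrite pE // comm_swap ?im0 ?comm0r //.
by apply: (sl_zero sl); lia.
Qed.

(** The new column is a natural representation of the units already built. Only [i = k] leaves the
    raising part; there the bracket with a lowering unit produces elements of the Cartan part. *)
Lemma raise_action i j l t r : (i <= k)%N -> (j <= k)%N -> (l <= k)%N ->
  i != j ->
  <| x i j t, x l k.+1 r |> = if j == l then x i k.+1 (t + r)%N else 0.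
Proof.
move=> ik jk lk ij; have [jltk|kj] := ltnP j k; last first.
  have ej : j = k by lia.
  rewrite ej; have ltik : (i < k)%N by lia.
  have [lltk|kl] := ltnP l k; first by rewrite gtn_eqF // unit_serre.
  have -> : l = k by lia.
  by rewrite eqxx unit_node unit_shift.
have far a b := unit_far_commute a b ik jltk ij.
have [lltk|kl] := ltnP l k; last first.
  have -> : l = k by lia.
  by rewrite ltn_eqF // unit_node far.
rewrite unit_nodeS // comm_jacobi far comm0r addr0.
have [iltk|ki] := ltnP i k.
  case: eqVneq => [<-|jl].
    by rewrite (sl_chain slx) ?addn0 ?unit_shift //; lia.
  by rewrite (sl_zero slx) ?comm0l //; lia.
have -> : i = k by lia.
case: eqVneq => [<-|jl].
  rewrite [<| x k j t, _ |>]commC (sl_diag slx) // add0n unit_node.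
  have [m km] : exists m, k = m.+1 by exists k.-1; lia.
  have mN : (m.+1 < N)%N by rewrite -km.
  (* Only the last summand, at node [k - 1], has a nonzero weight on [Xp k]. *)
  rewrite [in LHS]km big_nat_recr /=; last by lia.
  have [w _] := hc_weight posX t r mN.
  rewrite commNl commDl w comm_suml big_nat_cond big1 ?add0r ?opprK -?km //.
  by move=> l' /andP[l'm _]; rewrite (hc_weight0 posX) //; lia.
rewrite [<| x k j t, _ |>]commC (sl_chain slx) //; try lia.
by rewrite commNl unit_far_commute ?oppr0 //; lia.
Qed.

(** The relation of node [k] with itself and the Serre relation that is quadratic in node [k] give
    the cases next to the corner; [raise_action] spreads them over the column. *)
Lemma raise_commute i j r s : (i <= k)%N -> (j <= k)%N ->
  <| x i k.+1 r, x j k.+1 s |> = 0.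
Proof.
have kk i' r' s' : (i' <= k)%N -> <| x i' k.+1 r', x k k.+1 s' |> = 0.
  move=> ik; rewrite unit_node; have [iltk|ki] := ltnP i' k; last first.
    have -> : i' = k by lia.
    by rewrite unit_node (hc_self posX).
  have [m km] : exists m, k = m.+1 by exists k.-1; lia.
  have mN : (m.+1 < N)%N by rewrite -km.
  have mk0 : <| x m k.+1 r', Xp k s' |> = 0.
    rewrite unit_nodeS; last by lia.
    have -> : x m k 0 = Xp m 0 by rewrite km unit_raise // raise1.
    have [_ serre] := hc_serre posX s' r' 0 mN.
    by rewrite commC [<| Xp m 0, _ |>]commC commNr opprK km.
  case: (eqVneq i' m) => [-> // | im].
  have -> : x i' k.+1 r' = <| x i' m 0, x m k.+1 r' |>.
    by rewrite raise_action ?eqxx //; lia.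
  by apply: comm_centralizer => //; apply: unit_far_commute; lia.
move=> ik jk; have [jltk|kj] := ltnP j k; last first.
  have -> : j = k by lia.
  exact: kk.
have [iltk|ki] := ltnP i k; last first.
  have -> : i = k by lia.
  by rewrite commC kk ?oppr0.
have -> : x j k.+1 s = <| x j k 0, x k k.+1 s |>.
  by rewrite raise_action ?eqxx //; lia.
rewrite commC comm_centralizer ?oppr0 //; last by rewrite commC kk ?oppr0.
have jk' : j != k by lia.
by rewrite raise_action // gtn_eqF.
Qed.

Lemma raise_weight i t s : (i < k)%N ->
  <| H k t, x i k s |> = - x i k (t + s)%N.
Proof.
move=> ik; have [m km] : exists m, k = m.+1 by exists k.-1; lia.
have mN : (m.+1 < N)%N by rewrite -km.
have [_ w] := hc_weight posX t s mN.
have [im|im] := eqVneq i m; first by rewrite im km !unit_raise // !raise1 w.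
have ltim : (i < m)%N by lia.
have imS a : x i k a = <| x i m 0, Xp m a |>.
  by rewrite km (unit_raise _ (leqW ltim)) raiseS // -unit_raise.
have H0 : <| H k t, x i m 0 |> = 0.
  rewrite commC (unit_raise _ ltim).
  have -> : <| raise Xp i m 0, H k t |> = 0; last by rewrite oppr0.
  apply: (raise_ind (P := fun a => <| a, H k t |> = 0)) => // [a b|l u lm].
    exact: comm_centralizer.
  by rewrite commC (hc_weight0 posX) ?oppr0 //; lia.
by rewrite !imS (comm_swap _ H0) {1}km w commNr.
Qed.

End NodeStep.

Section NodeExtension.
Variables (K : fieldType) (A : algType K).
Hypothesis torsion2 : forall a : A, a = - a -> a = 0.
Variables (Xp Xm H : nat -> nat -> A) (N k : nat).
Hypotheses (chX : chain N Xp Xm H) (kN : (k < N)%N).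
Local Notation x := (unit_of Xp Xm).
Hypothesis slx : sl_system k x H.

Let chX' := chain_dual chX.
Let slx' := sl_system_unit_dual slx.

(** Like the two lemmas that follow, this is the corresponding statement on raising elements, read
    in the Chevalley dual chain. *)
Lemma lower_action i j l t r : (i <= k)%N -> (j <= k)%N -> (l <= k)%N ->
  i != j ->
  <| x i j t, x k.+1 l r |> = if i == l then - x k.+1 j (t + r)%N else 0.
Proof.
move=> ik jk lk; rewrite eq_sym => ji.
have := raise_action torsion2 chX' kN slx' t r jk ik lk ji.
by rewrite !unit_of_dual commNN.
Qed.

Lemma lower_commute i j r s : (i <= k)%N -> (j <= k)%N ->
  <| x k.+1 i r, x k.+1 j s |> = 0.
Proof.
move=> ik jk; have := raise_commute torsion2 chX' kN slx' r s ik jk.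
by rewrite !unit_of_dual commNN.
Qed.

Lemma lower_weight i t s : (i < k)%N ->
  <| H k t, x k i s |> = x k i (t + s)%N.
Proof.
move=> ik; have := raise_weight chX' kN t s ik.
by rewrite !unit_of_dual commNN opprK.
Qed.

Let act := raise_action torsion2 chX kN slx.

Lemma raise_lower_node r s : <| x k k.+1 r, x k.+1 k s |> = H k (r + s)%N.
Proof.
rewrite unit_node unit_lower // /= eqxx.
by rewrite (ch_pm chX) // eqxx.
Qed.

Lemma raise_lower i j r s : (i <= k)%N -> (j <= k)%N -> i != j ->
  <| x i k.+1 r, x k.+1 j s |> = x i j (r + s)%N.
Proof.
have base i' r' s' : (i' < k)%N ->
    <| x i' k.+1 r', x k.+1 k s' |> = x i' k (r' + s')%N.
  move=> ik; have -> : x i' k.+1 r' = <| x i' k 0, x k k.+1 r' |>.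
    by rewrite act ?eqxx //; lia.
  rewrite comm_pull; last by rewrite lower_action ?ltn_eqF //; lia.
  by rewrite raise_lower_node commC (raise_weight chX) // opprK addn0.
move=> ik jk ij; have [jltk|kj] := ltnP j k; last first.
  have ek : j = k by lia.
  by rewrite ek base //; lia.
have -> : x k.+1 j s = - <| x k j 0, x k.+1 k s |>.
  by rewrite lower_action ?eqxx ?opprK //; lia.
rewrite commNr comm_jacobi.
have [iltk|ki] := ltnP i k.
  rewrite [<| x i k.+1 r, x k j 0 |>]commC act //; try lia.
  rewrite (negbTE (_ : j != i)) 1?eq_sym // oppr0 comm0l add0r base //.
  by rewrite commC opprK (sl_chain slx) ?addn0 //; lia.
have -> : i = k by lia.
rewrite [<| x k k.+1 r, x k j 0 |>]commC act //; try lia.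
rewrite ltn_eqF // oppr0 comm0l add0r raise_lower_node.
by rewrite commC opprK lower_weight // addn0.
Qed.

Lemma raise_lower_diag i r s : (i <= k)%N ->
  <| x i k.+1 r, x k.+1 i s |> = \sum_(i <= l < k.+1) H l (r + s)%N.
Proof.
move=> ik; rewrite big_nat_recr //=; have [iltk|ki] := ltnP i k; last first.
  have -> : i = k by lia.
  by rewrite raise_lower_node big_geq ?add0r.
have -> : x k.+1 i s = - <| x k i 0, x k.+1 k s |>.
  by rewrite lower_action ?eqxx ?opprK //; lia.
rewrite commNr comm_jacobi [<| x i k.+1 r, x k i 0 |>]commC act //; try lia.
rewrite eqxx commNl raise_lower_node raise_lower //; try lia.
by rewrite [<| x k i 0, _ |>]commC (sl_diag slx) // addn0 -opprD opprK addrC.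
Qed.

Lemma sl_system_step : sl_system k.+1 x H.
Proof.
have top i : (i <= k.+1)%N -> i = k.+1 \/ (i <= k)%N by lia.
split.
- move=> i j l r s /top[->|ik] /top[->|jk] /top[->|lk]; rewrite ?eqxx //
    => ij jl il.
  + by rewrite commC lower_action // eqxx opprK addnC.
  + by rewrite raise_lower.
  + by rewrite act // eqxx.
  + exact: (sl_chain slx).
- move=> i j a b r s /top[->|ik] /top[->|jk] /top[->|ak] /top[->|bk];
    rewrite ?eqxx // => ij ab ja ib.
  + exact: lower_commute.
  + by rewrite commC lower_action // eq_sym (negbTE ja) oppr0.
  + exact: (raise_commute torsion2 chX kN slx).
  + by rewrite commC act // eq_sym (negbTE ib) oppr0.
  + by rewrite lower_action // (negbTE ib).
  + by rewrite act // (negbTE ja).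
  + exact: (sl_zero slx).
- move=> i j r s ij /top[ej|jk].
    by rewrite ej raise_lower_diag // -ltnS -ej.
  exact: (sl_diag slx).
Qed.

End NodeExtension.

(** By induction on the number of nodes, the loop relations of type A imply all brackets of
    off-diagonal matrix units of sl(k+1)[u]; the arithmetic input is the absence of 2-torsion. *)
Theorem chain_sl_system (K : fieldType) (A : algType K)
    (Xp Xm H : nat -> nat -> A) (N k : nat) :
  (forall a : A, a = - a -> a = 0) -> chain N Xp Xm H -> (k <= N)%N ->
  sl_system k (unit_of Xp Xm) H.
Proof.
move=> torsion2 chX; elim: k => [_|k IH kN].
  by split=> [[] // [] //|[] // [] // |i j r s ij /(leq_trans ij)].
by apply: (sl_system_step torsion2 chX kN); apply: IH; exact: ltnW.
Qed.

(** * Brackets between the columns of the two chains *)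

Section Fork.
Variables (K : fieldType) (A : algType K).
Hypothesis torsion2 : forall a : A, a = - a -> a = 0.

(* [p i r] behaves like the vector e_i u^r of the natural representation.     *)
Definition vector_family (m : nat) (x : nat -> nat -> nat -> A)
    (p : nat -> nat -> A) :=
  forall i j l t r, (i <= m)%N -> (j <= m)%N -> (l <= m)%N -> i != j ->
  <| x i j t, p l r |> = if j == l then p i (t + r)%N else 0.

Definition commuting_family (m : nat) (p : nat -> nat -> A) :=
  forall i j r s, (i <= m)%N -> (j <= m)%N -> <| p i r, p j s |> = 0.

(** The relations joining nodes n-1 and n: [p m] and [p' m] will be the generators at these nodes.
    [fp_triple] is the triple relation, with the brackets by X_{n-2} read as the vectors of index
    [m.-1]. *)
Record fork_pair (m : nat) (p p' : nat -> nat -> A) : Prop := ForkPair {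
  fp_shift r s : <| p m r.+1, p' m s |> = - <| p m r, p' m s.+1 |>;
  fp_even r s : ~~ odd (r + s) -> <| p m r, p' m s |> = 0;
  fp_triple r s u : <| p m.-1 (r + u)%N, p' m s |> =
    - (-1) ^+ (s + u) *: <| p m u, p' m.-1 (r + s)%N |>
}.

Section Normal.
Variables (m : nat) (x : nat -> nat -> nat -> A) (p p' : nat -> nat -> A).
Hypotheses (m_gt0 : (0 < m)%N).
Hypotheses (xp : vector_family m x p) (xp' : vector_family m x p').
Hypothesis (pp' : fork_pair m p p').

Local Notation fork i j a b := (<| p i a, p' j b |>).

(** The form of [fp_triple] for an arbitrary pair of indices. Units carry it from the pair
    [(m.-1, m)] to all other pairs except [(m, m)]. *)
Let twist i j := forall r s u,
  fork i j (r + u)%N s = - (-1) ^+ (s + u) *: fork j i u (r + s)%N.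

Let twist_im i : (i < m)%N -> twist i m.
Proof.
move=> im r s u; have [->|i'] := eqVneq i m.-1; first exact: fp_triple.
have := congr1 (fun v => <| x i m.-1 0, v |>) (fp_triple pp' r s u).
rewrite commZr (comm_jacobi _ (p m.-1 _)) (comm_jacobi _ (p m _)).
rewrite !xp ?xp' //; try lia.
rewrite eqxx (ltn_eqF (_ : m.-1 < m)%N); last by lia.
by rewrite comm0l comm0r add0r addr0 !add0n.
Qed.

(** On this pair the sign rule comes from the shift relation, which makes the bracket depend on the
    total degree up to sign, and from its vanishing in even degree. *)
Let twist_mm : twist m m.
Proof.
have norm a b : fork m m a b = (-1) ^+ b *: fork m m (a + b)%N 0.
  elim: b a => [|b IH] a; first by rewrite expr0 scale1r addn0.
  by rewrite -[LHS]opprK -(fp_shift pp') IH -scaleNr addSnnS exprS mulN1r.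
move=> r s u; rewrite norm [in RHS]norm scalerA.
have -> : (u + (r + s) = r + u + s)%N by lia.
have [ev|od] := boolP (~~ odd (r + u + s)).
  by rewrite (fp_even pp') ?addn0 // !scaler0.
congr (_ *: _); rewrite mulNr.
have -> : (-1) ^+ (s + u) * (-1) ^+ (r + s) = - (-1) ^+ s :> K.
  rewrite -exprD; have -> : (s + u + (r + s) = r + u + s + s)%N by lia.
  by rewrite exprD -signr_odd (negbNE od) expr1 mulN1r.
by rewrite opprK.
Qed.

Let twist_ij i j : (i < m)%N -> (j < m)%N -> twist i j.
Proof.
move=> im jm r s u; have jm' : j != m by lia.
have := congr1 (fun v => <| x j m 0, v |>) (twist_im im r s u).
rewrite commZr (comm_jacobi _ (p i _)) (comm_jacobi _ (p m _)).
rewrite !xp ?xp' //; try lia.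
by rewrite eqxx !(gtn_eqF im) comm0l comm0r add0r addr0 !add0n.
Qed.

(** These are the cases [u = 0] and [s = 0] of [twist], combined. *)
Let twist_normal i j : twist i j ->
  (forall a b, fork i j a b = (-1) ^+ b *: fork i j (a + b)%N 0) /\
  (forall N, fork j i N 0 = - (-1) ^+ N *: fork i j N 0).
Proof.
move=> tw.
have n1 a b : fork i j a b = - (-1) ^+ b *: fork j i 0 (a + b)%N.
  by have := tw a b 0%N; rewrite !addn0.
have n2 a b : fork j i a b = - (-1) ^+ a *: fork i j (a + b)%N 0.
  rewrite addnC (tw b 0%N a) add0n addn0 scalerA mulrNN -exprMn mulrNN.
  by rewrite mulr1 expr1n scale1r.
split=> [a b|N]; last by rewrite n2 addn0.
by rewrite n1 [in RHS]n1 expr0 addn0 scalerA mulrN1.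
Qed.

Let normal_sym i j :
  (forall a b, fork i j a b = (-1) ^+ b *: fork i j (a + b)%N 0) ->
  twist i j ->
  (forall a b, fork j i a b = (-1) ^+ b *: fork j i (a + b)%N 0).
Proof.
move=> nij tw a b; have [_ sy] := twist_normal tw.
have n2 : fork j i a b = - (-1) ^+ a *: fork i j (a + b)%N 0.
  rewrite addnC (tw b 0%N a) add0n addn0 scalerA mulrNN -exprMn mulrNN.
  by rewrite mulr1 expr1n scale1r.
have bb : (-1) ^+ (b + b) = 1 :> K by rewrite -signr_odd oddD addbb.
by rewrite n2 sy scalerA mulrN -exprD addnCA exprD bb mulr1.
Qed.

Lemma fork_normal i j a b : (i <= m)%N -> (j <= m)%N ->
  fork i j a b = (-1) ^+ b *: fork i j (a + b)%N 0.
Proof.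
rewrite leq_eqVlt => /orP[/eqP->|im]; rewrite leq_eqVlt => /orP[/eqP->|jm].
- exact: (twist_normal twist_mm).1.
- have tw := twist_im jm; apply: (normal_sym _ tw).
  exact: (twist_normal tw).1.
- exact: (twist_normal (twist_im im)).1.
- exact: (twist_normal (twist_ij im jm)).1.
Qed.

Lemma fork_sym i j N : (i <= m)%N -> (j <= m)%N ->
  fork j i N 0 = - (-1) ^+ N *: fork i j N 0.
Proof.
rewrite leq_eqVlt => /orP[/eqP->|im]; rewrite leq_eqVlt => /orP[/eqP->|jm].
- exact: (twist_normal twist_mm).2.
- have [_ e] := twist_normal (twist_im jm).
  rewrite (e N) scalerA mulrNN -exprMn mulrNN mulr1 expr1n scale1r //.
- exact: (twist_normal (twist_im im)).2.
- exact: (twist_normal (twist_ij im jm)).2.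
Qed.

End Normal.

(* The triple bracket is symmetric in (k, i) and antisymmetric in (i, j).     *)
Lemma fork_comm0 (m : nat) (p p' : nat -> nat -> A) :
  commuting_family m p ->
  (forall i j a b, (i <= m)%N -> (j <= m)%N ->
    <| p i a, p' j b |> = (-1) ^+ b *: <| p i (a + b)%N, p' j 0 |>) ->
  (forall i j N, (i <= m)%N -> (j <= m)%N ->
    <| p j N, p' i 0 |> = - (-1) ^+ N *: <| p i N, p' j 0 |>) ->
  forall k i j t r s, (k <= m)%N -> (i <= m)%N -> (j <= m)%N ->
  <| p k t, <| p i r, p' j s |> |> = 0.
Proof.
move=> pp norm sym.
have swap k i j t r s : (k <= m)%N -> (i <= m)%N ->
    <| p k t, <| p i r, p' j s |> |> = <| p i r, <| p k t, p' j s |> |>.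
  by move=> km im; apply: comm_swap; exact: pp.
(* Degree passes from one vector to the other through [p']: entering and leaving [p'] cost the same
   sign, so the signs cancel. *)
have move_deg k i j t r s : (k <= m)%N -> (i <= m)%N -> (j <= m)%N ->
    <| p k t, <| p i (r + s)%N, p' j 0 |> |> =
    <| p k (t + s)%N, <| p i r, p' j 0 |> |>.
  move=> km im jm; have := swap k i j t r s km im.
  rewrite norm // (norm k) // !commZr => /(congr1 ( *:%R ((-1) ^+ s))).
  rewrite !scalerA -exprMn mulrNN mulr1 expr1n !scale1r => ->.
  exact: swap.
move=> k i j t r s km im jm; rewrite norm // commZr.
suff -> : <| p k t, <| p i (r + s)%N, p' j 0 |> |> = 0 by rewrite scaler0.
rewrite -[(r + s)%N]add0n move_deg //; move: (t + (r + s))%N => N {t r s}.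
have anti a b c : (a <= m)%N -> (b <= m)%N -> (c <= m)%N ->
    <| p a N, <| p b 0, p' c 0 |> |> = - <| p a N, <| p c 0, p' b 0 |> |>.
  by move=> am bm cm; rewrite (sym c b) // expr0 scaleN1r commNr.
have swap0 a b c : (a <= m)%N -> (b <= m)%N -> (c <= m)%N ->
    <| p a N, <| p b 0, p' c 0 |> |> = <| p b N, <| p a 0, p' c 0 |> |>.
  by move=> am bm cm; rewrite swap // -[N]add0n move_deg.
(* Three exchanges and three sign changes lead from [(k, i, j)] back to itself, so the bracket
   equals its own negative. *)
apply: torsion2; rewrite {1}(swap0 k i j) // (anti i k j) // (swap0 i j k) //.
by rewrite (anti j i k) // opprK (swap0 j k i) // (anti k j i).
Qed.

End Fork.

(** * Invariant pairing of vectors with covectors *)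

Section Pairing.
Variables (K : fieldType) (A : algType K).

Definition covector_family (m : nat) (x : nat -> nat -> nat -> A)
    (q : nat -> nat -> A) :=
  forall i j l t r, (i <= m)%N -> (j <= m)%N -> (l <= m)%N -> i != j ->
  <| x i j t, q l r |> = if i == l then - q j (t + r)%N else 0.

(** As in Schur's lemma, invariance leaves only a scalar: the units commute with [z], so their
    action propagates the value at [(m, m)] to all pairs of indices. *)
Lemma pairing (m : nat) (x : nat -> nat -> nat -> A) (p q : nat -> nat -> A)
    (z : nat -> A) :
  vector_family m x p -> covector_family m x q ->
  (forall i j t r, (i <= m)%N -> (j <= m)%N -> i != j ->
    <| x i j t, z r |> = 0) ->
  (forall r s, <| p m r, q m s |> = z (r + s)%N) ->
  forall i j r s, (i <= m)%N -> (j <= m)%N ->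
  <| p i r, q j s |> = if i == j then z (r + s)%N else 0.
Proof.
move=> xp xq xz pq.
have ad a b i j r s : (a <= m)%N -> (b <= m)%N -> a != b ->
    <| p i r, q j s |> = z (r + s)%N \/ <| p i r, q j s |> = 0 ->
    <| <| x a b 0, p i r |>, q j s |> = - <| p i r, <| x a b 0, q j s |> |>.
  move=> am bm ab e; apply/eqP; rewrite -addr_eq0 -comm_jacobi; apply/eqP.
  by case: e => ->; rewrite ?comm0r ?xz.
have im i r s : (i <= m)%N -> i != m -> <| p i r, q m s |> = 0.
  move=> ile im; have := ad i m m m r s ile (leqnn m) im (or_introl (pq r s)).
  by rewrite xp // eqxx add0n xq // (negbTE im) comm0r oppr0.
have mj j r s : (j <= m)%N -> j != m -> <| p m r, q j s |> = 0.
  move=> jle jm; have mj : m != j by rewrite eq_sym.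
  have := ad m j m m r s (leqnn m) jle mj (or_introl (pq r s)).
  rewrite xp // (negbTE jm) comm0l xq // eqxx add0n commNr opprK.
  by move->.
move=> i j r s ile jle.
have [->|inm] := eqVneq i m.
  have [<-|] := eqVneq m j; first exact: pq.
  by rewrite eq_sym => jm; exact: mj.
have [ej|jnm] := eqVneq j m; first by rewrite ej (negbTE inm) im.
have [<-|ij] := eqVneq i j.
  have mi : m != i by rewrite eq_sym.
  have := ad m i i m r s (leqnn m) ile mi (or_intror (im _ _ _ ile inm)).
  rewrite xp // eqxx add0n xq // eqxx add0n pq commNr opprK.
  by move->.
have mj' : m != j by rewrite eq_sym.
have := ad m j i m r s (leqnn m) jle mj' (or_intror (im _ _ _ ile inm)).
rewrite xp // eq_sym (negbTE ij) comm0l xq // eqxx add0n commNr opprK.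
by move->.
Qed.

End Pairing.

(** * The two chains of type A inside the presentation of L *)

Section Units.
Variables (K : fieldType) (A : algType K) (n : nat).
Variables (H : nat -> nat -> A) (X : bool -> nat -> nat -> A).

(* The nodes of the two subdiagrams of type A obtained by removing one of the *)
(* last two nodes of the diagram of type D, numbered from 0.                  *)
Definition node (c : bool) (l : nat) : nat :=
  if l.+2 == n then if c then n.-1 else n else l.+1.

Definition chainX c e l r := X e (node c l) r.

(** The symbol H_{n,r} exists only for even [r]; in odd degree the bracket of X^+_n with X^-_n is
    H_{n-1,r}, so this element takes its place. *)
Definition chainH c l r :=
  H (if (l.+2 == n) && (c || odd r) then n.-1 else node c l) r.

Definition chain_unit c := unit_of (chainX c true) (chainX c false).

End Units.

Section Generators.
Variables (K : fieldType) (A : algType K) (n : nat).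
Variable phi : free_alg K (Lgen n) -> A.

Definition genH i r := phi (LH K n i r).
Definition genX e i r := phi (LX K n e i r).

End Generators.

Section Presentation.
Variables (K : fieldType) (A : algType K) (n : nat).
Hypotheses (two_neq0 : 2%:R != 0 :> K) (n_gt3 : (3 < n)%N).
Variable phi : {lrmorphism free_alg K (Lgen n) -> A}.
Hypothesis phi_rel : forall x y, Lrel x y -> phi x = phi y.

Local Notation H := (genH phi).
Local Notation X := (genX phi).

Lemma torsion2 (a : A) : a = - a -> a = 0.
Proof.
move=> aN; have : 2%:R *: a = 0 by rewrite scaler_nat mulr2n {2}aN subrr.
by move/eqP; rewrite scaler_eq0 (negbTE two_neq0) => /eqP.
Qed.

Lemma phi_comm x y : phi <| x, y |> = <| phi x, phi y |>.
Proof. by rewrite /comm rmorphB !rmorphM. Qed.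

(** The Cartan matrix of type A. *)
Definition weight (l l' : nat) : int :=
  if l == l' then 2 else if (l' == l.+1) || (l == l'.+1) then -1 else 0.

(** The correction 2 at (n-1, n) in odd degree makes H_{n-1,r} act on X_n with weight 2, as the
    coroot of node n should. *)
Lemma cartan_tw_node c r l l' : (l < n.-1)%N -> (l' < n.-1)%N ->
  cartan_tw n r (if (l.+2 == n) && (c || odd r) then n.-1 else node n c l)
    (node n c l') = weight l l'.
Proof.
move=> ln l'n; rewrite /cartan_tw /cartan /delta /weight /node.
by case: (eqVneq l.+2 n) => el; case: (eqVneq l'.+2 n) => el'; case: c => /=;
    case: (odd r); do 30? (case: eqP => ? //=; try lia).
Qed.

Lemma weightS l : weight l l.+1 = -1.
Proof. by rewrite /weight ltn_eqF ?eqxx. Qed.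

Lemma weightSr l : weight l.+1 l = -1.
Proof. by rewrite /weight gtn_eqF ?eqxx ?orbT. Qed.

Lemma HX_rel e i r j s : Hdef n i r -> Xdef n j s -> j != (n + 1)%N ->
  <| H i r, X e j s |> = (pm e * cartan_tw n r i j)%:~R *: X e j (r + s)%N.
Proof.
move=> Hi Xj jn; have := phi_rel (Lrel_HX K e Hi Xj jn).
by rewrite phi_comm linearZ.
Qed.

Lemma chain_weight c e l l' r s : (l < n.-1)%N -> (l' < n.-1)%N ->
  <| chainH n H c l r, chainX n X c e l' s |> =
  (pm e * weight l l')%:~R *: chainX n X c e l' (r + s)%N.
Proof.
move=> ln l'n; rewrite /chainH /chainX HX_rel.
- congr (_%:~R *: _); congr (_ * _); exact: cartan_tw_node.
- rewrite /Hdef /node; case: (eqVneq l.+2 n); case: c; case: (odd r) => /=; lia.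
- rewrite /Xdef /node.
  by case: (eqVneq l'.+2 n); case: c; case: (odd s) => /=; lia.
- rewrite /node; case: (eqVneq l'.+2 n); case: c => /=; lia.
Qed.

Lemma serre_rel e i r1 r2 j s : (1 <= i <= n)%N -> (1 <= j <= n)%N ->
  cartan n i j = -1 -> <| X e i r1, <| X e i r2, X e j s |> |> = 0.
Proof.
move=> ir jr w; have := phi_rel (Lrel_serre K e r1 r2 s ir jr w).
by rewrite !phi_comm rmorph0.
Qed.

Lemma cartan_node c l l' : (l < n.-1)%N -> (l' < n.-1)%N ->
  cartan n (node n c l) (node n c l') = weight l l'.
Proof.
move=> ln l'n; rewrite /cartan /delta /weight /node.
by case: (eqVneq l.+2 n) => el; case: (eqVneq l'.+2 n) => el'; case: c => /=;
  do 30? (case: eqP => ? //=; try lia).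
Qed.

Lemma node_range c l : (l < n.-1)%N -> (1 <= node n c l <= n)%N.
Proof. by rewrite /node; case: eqVneq; case: c => /=; lia. Qed.

Lemma node_last c l : (l < n.-1)%N -> node n c l = n -> c = false /\ l.+2 = n.
Proof.
rewrite /node => ln; case: eqVneq => [->|_ e]; last by exfalso; lia.
by case: c => e; split=> //; exfalso; lia.
Qed.

Lemma node_Xdef c l r : (l < n.-1)%N -> Xdef n (node n c l) r.
Proof. by move/(node_range c); rewrite /Xdef; case: (odd r) => /=; lia. Qed.

Lemma node_fork c l l' : (l < n.-1)%N -> (l' < n.-1)%N ->
  ~~ fork n (node n c l) (node n c l').
Proof.
move=> ln l'n; rewrite /fork !xpair_eqE /node.
by case: (eqVneq l.+2 n) => el; case: (eqVneq l'.+2 n) => el'; case: c => /=;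
  lia.
Qed.

Let sg (e : bool) (v : A) := if e then v else - v.

Let sg_comm e u v : <| sg e u, sg e v |> = <| u, v |>.
Proof. by case: e; rewrite /= ?commNN. Qed.

Let sg_comml e u v : <| sg e u, v |> = sg e <| u, v |>.
Proof. by case: e; rewrite /= ?commNl. Qed.

Lemma half_chainX c e : half_chain n.-1 (fun l r => sg e (chainX n X c e l r))
  (fun l r => sg e (chainH n H c l r)).
Proof.
have sgN a : - sg e a = (pm e * -1)%:~R *: a.
  by case: e => /=; rewrite ?scaleN1r ?scale1r ?opprK.
split.
- move=> l r s ln; rewrite !sg_comm !chain_weight; try lia.
  by rewrite !sgN weightS weightSr.
- move=> l l' r s ln l'n ll'; rewrite sg_comm chain_weight //.
  have -> : weight l l' = 0 by rewrite /weight; repeat case: eqP => ? //=; lia.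
  by rewrite mulr0 scale0r.
- move=> l r s ln; rewrite !sg_comm /chainX.
  have := phi_rel (Lrel_shift K e r s (node_range c _) (node_range c _)
    (node_fork c (l := l) (l' := l.+1) _ _)).
  by rewrite !phi_comm !addn1; apply; lia.
- move=> l r s ln; rewrite sg_comm /chainX -phi_comm.
  by rewrite (phi_rel (Lrel_XiXi K e r s (node_range c ln))) rmorph0.
- move=> l l' r s ln l'n ll'; rewrite sg_comm /chainX -phi_comm.
  have w0 : cartan n (node n c l) (node n c l') = 0.
    by rewrite cartan_node // /weight; repeat case: eqP => ? //=; lia.
  by rewrite (phi_rel (Lrel_commute K e r s (node_range c ln)
    (node_range c l'n) w0 (node_fork c ln l'n))) rmorph0.
- move=> l r s t ln; have ln' : (l < n.-1)%N by lia.
  rewrite !sg_comm !sg_comml /chainX.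
  have w1 : cartan n (node n c l) (node n c l.+1) = -1.
    by rewrite cartan_node // weightS.
  have w2 : cartan n (node n c l.+1) (node n c l) = -1.
    by rewrite cartan_node // weightSr.
  rewrite (serre_rel e r s t (node_range c ln') (node_range c ln) w1).
  rewrite (serre_rel e r s t (node_range c ln) (node_range c ln') w2).
  by case: e sgN; rewrite /= ?oppr0.
Qed.

Lemma chain_pm c l l' r s : (l < n.-1)%N -> (l' < n.-1)%N ->
  <| chainX n X c true l r, chainX n X c false l' s |> =
  if l == l' then chainH n H c l (r + s)%N else 0.
Proof.
move=> ln l'n; rewrite /chainX -phi_comm.
have fin i j a : i = j -> phi ((delta i j)%:~R *: LH K n a (r + s)) =
    H a (r + s)%N.
  by move=> ->; rewrite /delta eqxx linearZ /= scale1r.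
have fin0 i j a : i != j -> phi ((delta i j)%:~R *: LH K n a (r + s)) = 0.
  by move=> /negbTE ij; rewrite /delta ij scale0r rmorph0.
have [eln|nln] := eqVneq (node n c l) n.
  have [ec el] := node_last ln eln; rewrite ec.
  have nd : node n false l = n by rewrite /node el eqxx.
  have Xj := node_Xdef false s l'n.
  have j1 : node n false l' != (n - 1)%N.
    by rewrite /node; case: (eqVneq l'.+2 n) => /=; lia.
  have j2 : node n false l' != (n + 1)%N.
    by rewrite /node; case: (eqVneq l'.+2 n) => /=; lia.
  rewrite /chainH el eqxx nd /=; have [od|ev] := boolP (odd (r + s)).
    rewrite (phi_rel (Lrel_XpnXm_odd K Xj j1 j2 od)); case: eqVneq => [e|ne].
      by rewrite fin -?e ?nd ?subn1.
    by rewrite fin0 // /node; case: (eqVneq l'.+2 n) => /=; lia.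
  rewrite (phi_rel (Lrel_XpnXm_even K Xj j1 j2 ev)); case: eqVneq => [e|ne].
    by rewrite fin -?e ?nd.
  by rewrite fin0 // /node; case: (eqVneq l'.+2 n) => /=; lia.
have [el'n|nl'n] := eqVneq (node n c l') n.
  have [ec el'] := node_last l'n el'n.
  have nll' : l != l' by apply: contra nln => /eqP->; rewrite el'n.
  rewrite (negbTE nll') el'n.
  have Xj := node_Xdef c r ln.
  have j1 : node n c l != (n - 1)%N.
    by rewrite ec /node; case: (eqVneq l.+2 n) => /=; lia.
  have j2 : node n c l != (n + 1)%N.
    by have := node_range c ln; lia.
  rewrite eq_sym in nln.
  have [od|ev] := boolP (odd (r + s)).
    by rewrite (phi_rel (Lrel_XpXmn_odd K Xj j1 j2 od)) fin0.
  by rewrite (phi_rel (Lrel_XpXmn_even K Xj j1 j2 ev)) fin0.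
have r1 := node_range c ln; have r2 := node_range c l'n.
have lt1 : (1 <= node n c l <= n - 1)%N by lia.
have lt2 : (1 <= node n c l' <= n - 1)%N by lia.
rewrite (phi_rel (Lrel_XpXm K r s lt1 lt2)).
case: eqVneq => [e|ne].
  rewrite e fin //; congr H; move: nl'n {nln r1 r2 lt1 lt2}.
  by rewrite /node; case: (eqVneq l'.+2 n); case: c => //= _; rewrite eqxx.
rewrite fin0 //; move: nln nl'n ne {r1 r2 lt1 lt2}; rewrite /node.
by case: (eqVneq l.+2 n); case: (eqVneq l'.+2 n); case: c => /=; lia.
Qed.

Lemma chainP c : chain n.-1 (chainX n X c true) (chainX n X c false)
  (chainH n H c).
Proof.
split; first exact: (half_chainX c true).
  exact: (half_chainX c false).
by move=> *; exact: chain_pm.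
Qed.

Lemma chain_unitP c k : (k < n)%N ->
  sl_system k (chain_unit n X c) (chainH n H c).
Proof.
move=> kn; apply: (chain_sl_system torsion2 (chainP c)); lia.
Qed.

End Presentation.

(** * Closure criteria for a subspace *)

Section ForkSymmetry.
Variables (K : fieldType) (A : algType K).

Lemma fork_pairC (m : nat) (p p' : nat -> nat -> A) :
  fork_pair m p p' -> fork_pair m p' p.
Proof.
case=> shift even triple; split=> [r s|r s ev|r s u].
- by rewrite commC [in RHS]commC opprK shift.
- by rewrite commC even ?oppr0 // addnC.
- rewrite commC [in RHS]commC triple [(u + s)%N]addnC scalerN; congr (- _).
  by rewrite scalerA mulrNN -exprMn mulrNN mulr1 expr1n scale1r.
Qed.

Lemma vector_family_ext (m : nat) (x y : nat -> nat -> nat -> A) p :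
  (forall i j r, (i <= m)%N -> (j <= m)%N -> x i j r = y i j r) ->
  vector_family m x p -> vector_family m y p.
Proof. by move=> e xp i j l t r im jm lm ij; rewrite -e ?xp. Qed.

Lemma covector_dual (m : nat) (x : nat -> nat -> nat -> A) q :
  covector_family m x q -> vector_family m (dual_units x) q.
Proof.
move=> xq i j l t r im jm lm ij; rewrite /dual_units commNl xq //.
  by case: eqP; rewrite ?opprK ?oppr0.
by rewrite eq_sym.
Qed.

Lemma sl_vector (m : nat) (x : nat -> nat -> nat -> A) H :
  sl_system m.+1 x H -> vector_family m x (fun i r => x i m.+1 r).
Proof.
move=> sl i j l t r im jm lm ij; case: eqVneq => [<-|jl].
  by rewrite (sl_chain sl) //; lia.
by rewrite (sl_zero sl) //; lia.
Qed.

Lemma sl_covector (m : nat) (x : nat -> nat -> nat -> A) H :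
  sl_system m.+1 x H -> covector_family m x (fun i r => x m.+1 i r).
Proof.
move=> sl i j l t r im jm lm ij; case: eqVneq => [<-|il].
  by rewrite commC (sl_chain sl) ?[(r + t)%N]addnC //; lia.
by rewrite (sl_zero sl) //; lia.
Qed.

Variable V : A -> Prop.
Hypotheses (V0 : V 0) (VD : forall a b, V a -> V b -> V (a + b)).
Hypothesis VZ : forall c a, V a -> V (c *: a).

Lemma closedN a : V a -> V (- a).
Proof. by rewrite -scaleN1r; exact: VZ. Qed.

Lemma closed_sum (I : Type) (s : seq I) (P : pred I) (F : I -> A) :
  (forall i, P i -> V (F i)) -> V (\sum_(i <- s | P i) F i).
Proof. by move=> VF; apply: big_ind. Qed.

Lemma sl_closed (m : nat) (x : nat -> nat -> nat -> A) H :
  sl_system m x H ->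
  (forall i j r, (i <= m)%N -> (j <= m)%N -> i != j -> V (x i j r)) ->
  (forall l r, (l < m)%N -> V (H l r)) ->
  forall a b i j t r, (a <= m)%N -> (b <= m)%N -> (i <= m)%N -> (j <= m)%N ->
  a != b -> i != j -> V <| x a b t, x i j r |>.
Proof.
move=> sl Vx VH a b i j t r am bm im jm ab ij.
have Vdiag i' j' u v : (i' < j')%N -> (j' <= m)%N ->
    V <| x i' j' u, x j' i' v |>.
  move=> ij' jm'; rewrite (sl_diag sl) // big_nat_cond.
  by apply: closed_sum => l /andP[/andP[_ lj] _]; apply: VH; lia.
have [bi|bi] := eqVneq b i; have [aj|aj] := eqVneq a j.
- rewrite -bi -aj; case: (ltngtP a b) ab => // [lt|gt] _; first exact: Vdiag.
  by rewrite commC; apply/closedN/Vdiag.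
- by rewrite -bi (sl_chain sl) //; [apply: Vx|rewrite bi].
- rewrite -aj commC (sl_chain sl) //; try lia.
  by apply/closedN/Vx; lia.
- by rewrite (sl_zero sl).
Qed.

(** For [i < m], Jacobi reduces to a unit acting on [p']. The symmetry of the fork exchanges [i = m]
    with a lower [j], and at [i = j = m] the bracket of [q m] with [p m] is covered by [qpm]. *)
Lemma fork_closed (m : nat) (x : nat -> nat -> nat -> A)
    (p p' q : nat -> nat -> A) :
  vector_family m x p' ->
  (forall i j r s, (i <= m)%N -> (j <= m)%N -> V <| p i r, p' j s |>) ->
  (forall i r, (i <= m)%N -> V (p' i r)) ->
  (forall i t r, (i < m)%N -> <| q m t, p i r |> = - x i m (r + t)%N) ->
  (forall t r s, V <| <| q m t, p m r |>, p' m s |>) ->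
  (forall i j r t s, (i <= m)%N -> (j <= m)%N ->
     V <| p i r, <| q m t, p' j s |> |>) ->
  (forall j r s, (j <= m)%N -> exists c a b,
     <| p m r, p' j s |> = c *: <| p j a, p' m b |>) ->
  forall i j t r s, (i <= m)%N -> (j <= m)%N ->
  V <| q m t, <| p i r, p' j s |> |>.
Proof.
move=> xp' Vfork Vp' qp qpm pqp sym i j t r s im jm.
have low i' j' r' s' : (i' < m)%N -> (j' <= m)%N ->
    V <| q m t, <| p i' r', p' j' s' |> |>.
  move=> im' jm'; rewrite comm_jacobi; apply: VD; last by apply: pqp; lia.
  rewrite qp // commNl xp' //; try lia.
  by apply: closedN; case: eqP => // _; apply: Vp'; lia.
have [|mi] := ltnP i m; first by move=> ?; exact: low.
have -> : i = m by lia.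
have [jltm|mj] := ltnP j m.
  have [c [a [b ->]]] := sym j r s jm.
  by rewrite commZr; apply: VZ; apply: low.
have -> : j = m by lia.
by rewrite comm_jacobi; apply: VD; [exact: qpm|exact: pqp].
Qed.

End ForkSymmetry.

Section Raise.
Variables (K : fieldType) (A : algType K).

Lemma raise_ext (X Y : nat -> nat -> A) i j r :
  (forall l s, (l < j)%N -> X l s = Y l s) -> raise X i j r = raise Y i j r.
Proof.
elim: j r => //= j IH r e; rewrite e //; case: eqP => // _.
by rewrite IH // => l s lj; apply: e; exact: ltnW.
Qed.

Lemma lower_ext (X Y : nat -> nat -> A) i j r :
  (forall l s, (l < i)%N -> X l s = Y l s) -> lower X i j r = lower Y i j r.
Proof.
elim: i r => //= i IH r e; rewrite e //; case: eqP => // _.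
by rewrite IH // => l s lj; apply: e; exact: ltnW.
Qed.

End Raise.

Definition last_node (m : nat) (c : bool) := if c then m.+1 else m.+2.

Lemma node_low m c l : (l < m)%N -> node m.+2 c l = l.+1.
Proof. by rewrite /node; case: eqP => //; lia. Qed.

Lemma node_m m c : node m.+2 c m = last_node m c.
Proof. by rewrite /node eqxx. Qed.

(** * Vectors and covectors of the two chains *)

Section Families.
Variables (K : fieldType) (A : algType K) (m : nat).
Local Notation n := m.+2.
Local Notation last_node := (last_node m).

Section Units.
Variable X : bool -> nat -> nat -> A.
Local Notation x := (chain_unit n X).

Definition pfam c i r := x c i m.+1 r.
Definition qfam c i r := x c m.+1 i r.

(** These units use only the nodes 1, ..., n-2, so the two chains share a copy of sl(n-1)[u]. *)
Lemma unit_agree c i j r : (i <= m)%N -> (j <= m)%N -> x c i j r = x true i j r.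
Proof.
move=> im jm; rewrite /chain_unit /unit_of; case: ltnP => ij.
  by apply: raise_ext => l s lj; rewrite /chainX !node_low //; lia.
by apply: lower_ext => l s lj; rewrite /chainX !node_low //; lia.
Qed.

Lemma unit_up c l r : x c l l.+1 r = X true (node n c l) r.
Proof. by rewrite /chain_unit /unit_of ltnSn raise1. Qed.

Lemma unit_down c l r : x c l.+1 l r = X false (node n c l) r.
Proof. by rewrite /chain_unit /unit_of ltnNge leqnSn /= eqxx. Qed.

Lemma pfam_m c r : pfam c m r = X true (last_node c) r.
Proof. by rewrite /pfam unit_up node_m. Qed.

Lemma qfam_m c r : qfam c m r = X false (last_node c) r.
Proof. by rewrite /qfam unit_down node_m. Qed.

End Units.

Hypotheses (two_neq0 : 2%:R != 0 :> K) (m_gt1 : (1 < m)%N).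
Variable phi : {lrmorphism free_alg K (Lgen n) -> A}.
Hypothesis phi_rel : forall x y, Lrel x y -> phi x = phi y.

Local Notation H := (genH phi).
Local Notation X := (genX phi).
Local Notation x := (chain_unit n X).
Local Notation p := (pfam X).
Local Notation q := (qfam X).

Let sl c : sl_system m.+1 (x c) (chainH n H c).
Proof. exact: chain_unitP. Qed.

Lemma pfam_vector c : vector_family m (x true) (p c).
Proof.
apply: vector_family_ext (sl_vector (sl c)) => i j r im jm.
exact: unit_agree.
Qed.

Lemma qfam_covector c : covector_family m (x true) (q c).
Proof.
move=> i j l t r im jm lm ij; rewrite -(unit_agree X c) //.
exact: (sl_covector (sl c)).
Qed.

Lemma pfam_commute c : commuting_family m (p c).
Proof. by move=> i j r s im jm; rewrite (sl_zero (sl c)) //; lia. Qed.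

Lemma qfam_commute c : commuting_family m (q c).
Proof. by move=> i j r s im jm; rewrite (sl_zero (sl c)) //; lia. Qed.

(** Turns the inner brackets of the triple relation into vectors: the node labelled [m], that is
    n-2, is the unit from [m] to [m.-1]. *)
Lemma pfam_pred c t r :
  p c m.-1 (t + r)%N = <| X true m t, X true (last_node c) r |>.
Proof.
have := pfam_vector c (i := m.-1) (j := m) (l := m) t r.
rewrite eqxx pfam_m => <- //; try lia.
have m_gt0 : (0 < m)%N by lia.
have := unit_up X true m.-1 t.
by rewrite node_low prednK // => ->.
Qed.

Lemma qfam_pred c t r :
  q c m.-1 (t + r)%N = - <| X false m t, X false (last_node c) r |>.
Proof.
have := qfam_covector c (i := m) (j := m.-1) (l := m) t r.
have m_gt0 : (0 < m)%N by lia.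
have := unit_down X true m.-1 t.
rewrite node_low prednK // => ->; rewrite eqxx qfam_m => -> //; try lia.
by rewrite opprK.
Qed.

Let n1 : (n - 1)%N = m.+1. Proof. by lia. Qed.
Let n2 : (n - 2)%N = m. Proof. by lia. Qed.

Let fork_shift e r s :
  <| X e m.+1 r.+1, X e m.+2 s |> = - <| X e m.+1 r, X e m.+2 s.+1 |>.
Proof.
have := phi_rel (Lrel_shift_fork K n e s r).
rewrite n1 !addn1 linearN /= !(phi_comm phi) -!/(X _ _ _) => E.
by rewrite commC [in RHS]commC E opprK.
Qed.

Let fork_even e r s : ~~ odd (r + s) -> <| X e m.+1 r, X e m.+2 s |> = 0.
Proof.
move=> ev; have := phi_rel (Lrel_commute_fork K n e ev).
by rewrite n1 rmorph0 !(phi_comm phi).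
Qed.

Let fork_triple e r s u :
  <| X e m.+2 s, <| X e m r, X e m.+1 u |> |> =
  (-1) ^+ (s + u) *: <| X e m.+1 u, <| X e m r, X e m.+2 s |> |>.
Proof.
have := phi_rel (Lrel_triple K n e r s u).
by rewrite n1 n2 linearZ /= !(phi_comm phi).
Qed.

Lemma pfam_fork c : fork_pair m (p c) (p (~~ c)).
Proof.
suff fk : fork_pair m (p true) (p false).
  by case: c => //; exact: fork_pairC.
split=> [r s|r s ev|r s u]; rewrite ?pfam_m /=.
- exact: fork_shift.
- exact: fork_even.
- by rewrite !pfam_pred commC fork_triple scaleNr.
Qed.

Lemma qfam_fork c : fork_pair m (q c) (q (~~ c)).
Proof.
suff fk : fork_pair m (q true) (q false).
  by case: c => //; exact: fork_pairC.
split=> [r s|r s ev|r s u]; rewrite ?qfam_m /=.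
- exact: fork_shift.
- exact: fork_even.
- by rewrite !qfam_pred commC !commNr opprK fork_triple scaleNr scalerN opprK.
Qed.

End Families.

(** * The generators X_{n+1} and their action on the two families *)

Section Closure.
Variables (K : fieldType) (A : algType K) (m : nat).
Hypotheses (two_neq0 : 2%:R != 0 :> K) (m_gt1 : (1 < m)%N).
Local Notation n := m.+2.
Variable phi : {lrmorphism free_alg K (Lgen n) -> A}.
Hypothesis phi_rel : forall x y, Lrel x y -> phi x = phi y.

Local Notation H := (genH phi).
Local Notation X := (genX phi).
Local Notation x := (chain_unit n X).
Local Notation p := (pfam m X).
Local Notation q := (qfam m X).

Let n1 : (n - 1)%N = m.+1. Proof. by lia. Qed.
Let n2 : (n - 2)%N = m. Proof. by lia. Qed.
Let np1 : (n + 1)%N = m.+3. Proof. by rewrite addn1. Qed.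

Let px c := pfam_vector two_neq0 m_gt1 phi_rel c.
Let qx c := qfam_covector two_neq0 m_gt1 phi_rel c.
Let sl c : sl_system m.+1 (x c) (chainH n H c).
Proof. exact: chain_unitP. Qed.

(** The common value of the diagonal pairings between vectors of one chain and covectors of the
    other. *)
Definition zfam c r := if odd r then - X (~~ c) m.+3 r else 0.

Let oddE r : odd r -> r = (2 * r./2 + 1)%N.
Proof. by move=> od; rewrite -{1}(odd_double_half r) od -mul2n addnC. Qed.

Let Y_low e e' l r s : odd r -> (l < m)%N -> <| X e m.+3 r, X e' l.+1 s |> = 0.
Proof.
move=> od lm; have Xl : Xdef n l.+1 s by rewrite /Xdef; case: odd; lia.
have ln : (l.+1 < n - 1)%N by lia.
have := phi_rel (Lrel_last_X K e e' r./2 Xl ln).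
by rewrite rmorph0 !(phi_comm phi) np1 -oddE.
Qed.

Lemma Y_unit e i j r s : odd r -> (i <= m)%N -> (j <= m)%N -> i != j ->
  <| x true i j s, X e m.+3 r |> = 0.
Proof.
move=> od im jm; rewrite neq_ltn => /orP[ij|ji].
  rewrite /chain_unit unit_raise //.
  apply: (raise_ind (P := fun a => <| a, X e m.+3 r |> = 0)) => // [a b|l t lj].
    exact: comm_centralizer.
  by rewrite /chainX commC node_low ?Y_low ?oppr0 //; lia.
rewrite /chain_unit unit_lower //.
apply: (lower_ind (P := fun a => <| a, X e m.+3 r |> = 0)) => // [a b|l t lj].
  exact: comm_centralizer.
by rewrite /chainX commC node_low ?Y_low ?oppr0 //; lia.
Qed.

Lemma pq_pairing c i j r s : (i <= m)%N -> (j <= m)%N ->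
  <| p c i r, q (~~ c) j s |> = if i == j then zfam c (r + s)%N else 0.
Proof.
move=> im jm; apply: (pairing (z := zfam c) (px c) (qx (~~ c))) => //.
  move=> a b t u am bm ab; rewrite /zfam; case: ifP => od.
    by rewrite commNr Y_unit ?oppr0.
  exact: comm0r.
move=> t u; rewrite pfam_m // qfam_m // /zfam.
case: ifP => [od|/negbT ev]; case: c => /=.
- have := phi_rel (Lrel_Xpn1Xmn_odd K n od).
  by rewrite linearN /= !(phi_comm phi) np1 n1.
- have := phi_rel (Lrel_XpnXmn1_odd K n od).
  by rewrite linearN /= !(phi_comm phi) np1 n1.
- have := phi_rel (Lrel_Xpn1Xmn_even K n ev).
  by rewrite rmorph0 !(phi_comm phi) n1.
- have := phi_rel (Lrel_XpnXmn1_even K n ev).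
  by rewrite rmorph0 !(phi_comm phi) n1.
Qed.

(** X_{n+1} commutes with the shared units, so its effect on a vector family is determined at the
    top index, where it is a defining relation. *)
Let Y_scalar (k : int) e r (v w : nat -> nat -> A) :
  odd r -> vector_family m (x true) v -> vector_family m (x true) w ->
  (forall s, <| X e m.+3 r, v m s |> = k%:~R *: w m (r + s)%N) ->
  forall i s, (i <= m)%N -> <| X e m.+3 r, v i s |> = k%:~R *: w i (r + s)%N.
Proof.
move=> od xv xw base i s im; have [->|ne] := eqVneq i m; first exact: base.
have vE : v i s = <| x true i m 0, v m s |> by rewrite xv // eqxx.
rewrite vE comm_swap; last by rewrite commC Y_unit ?oppr0.
by rewrite base commZr xw // eqxx.
Qed.

Let Y_coscalar (k : int) e r (v w : nat -> nat -> A) :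
  odd r -> covector_family m (x true) v -> covector_family m (x true) w ->
  (forall s, <| X e m.+3 r, v m s |> = k%:~R *: w m (r + s)%N) ->
  forall i s, (i <= m)%N -> <| X e m.+3 r, v i s |> = k%:~R *: w i (r + s)%N.
Proof.
move=> od xv xw base i s im; have [->|ne] := eqVneq i m; first exact: base.
have vE : v i s = - <| x true m i 0, v m s |>.
  by rewrite xv // 1?eq_sym // eqxx opprK.
rewrite vE commNr comm_swap; last by rewrite commC Y_unit ?oppr0 // eq_sym.
by rewrite base commZr xw // 1?eq_sym // eqxx scalerN opprK.
Qed.

Let dblE r s : odd r -> (2 * r./2 + s + 1 = r + s)%N.
Proof. by move=> od; rewrite addnAC -oddE. Qed.

Lemma Y_p c i r s : odd r -> (i <= m)%N ->
  <| X (~~ c) m.+3 r, p (~~ c) i s |> = (-2)%:~R *: p c i (r + s)%N.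
Proof.
move=> od; apply: (Y_scalar od (px _) (px _)) => {}s.
rewrite !pfam_m //; case: c => /=.
  have := phi_rel (Lrel_Xmlast_Xpn K n r./2 s).
  by rewrite linearZ !(phi_comm phi) np1 n1 -oddE ?dblE.
have := phi_rel (Lrel_Xplast_Xpn1 K n r./2 s).
by rewrite linearZ !(phi_comm phi) np1 n1 -oddE ?dblE.
Qed.

Lemma Y_p0 c i r s : odd r -> (i <= m)%N ->
  <| X (~~ c) m.+3 r, p c i s |> = 0.
Proof.
move=> od im; have -> : 0 = 0%:~R *: p c i (r + s)%N by rewrite scale0r.
apply: (Y_scalar od (px _) (px _)) => // {}s.
rewrite scale0r !pfam_m //; case: c => /=.
  have := phi_rel (Lrel_Xmlast_Xpn1 K n r./2 s).
  by rewrite rmorph0 !(phi_comm phi) np1 n1 -oddE.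
have := phi_rel (Lrel_Xplast_Xpn K n r./2 s).
by rewrite rmorph0 !(phi_comm phi) np1 -oddE.
Qed.

Lemma Y_q c i r s : odd r -> (i <= m)%N ->
  <| X (~~ c) m.+3 r, q c i s |> = 2%:~R *: q (~~ c) i (r + s)%N.
Proof.
move=> od; apply: (Y_coscalar od (qx _) (qx _)) => {}s.
rewrite !qfam_m //; case: c => /=.
  have := phi_rel (Lrel_Xmlast_Xmn1 K n r./2 s).
  by rewrite linearZ !(phi_comm phi) np1 n1 -oddE ?dblE.
have := phi_rel (Lrel_Xplast_Xmn K n r./2 s).
by rewrite linearZ !(phi_comm phi) np1 n1 -oddE ?dblE.
Qed.

Lemma Y_q0 c i r s : odd r -> (i <= m)%N ->
  <| X (~~ c) m.+3 r, q (~~ c) i s |> = 0.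
Proof.
move=> od im; have -> : 0 = 0%:~R *: q (~~ c) i (r + s)%N by rewrite scale0r.
apply: (Y_coscalar od (qx _) (qx _)) => // {}s.
rewrite scale0r !qfam_m //; case: c => /=.
  have := phi_rel (Lrel_Xmlast_Xmn K n r./2 s).
  by rewrite rmorph0 !(phi_comm phi) np1 -oddE.
have := phi_rel (Lrel_Xplast_Xmn1 K n r./2 s).
by rewrite rmorph0 !(phi_comm phi) np1 n1 -oddE.
Qed.

(** * Stability of a subspace under the adjoint action of the generators *)

Section Subspace.
Variable V : A -> Prop.
Hypotheses (V0 : V 0) (VD : forall a b, V a -> V b -> V (a + b)).
Hypothesis VZ : forall c a, V a -> V (c *: a).
Hypothesis Vx : forall i j r, (i <= m)%N -> (j <= m)%N -> i != j ->
  V (x true i j r).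
Hypotheses (Vp : forall c i r, (i <= m)%N -> V (p c i r))
  (Vq : forall c i r, (i <= m)%N -> V (q c i r)).
Hypotheses
  (VP : forall i j r, (i <= m)%N -> (j <= m)%N ->
     V <| p true i r, p false j 0 |>)
  (VQ : forall i j r, (i <= m)%N -> (j <= m)%N ->
     V <| q true i r, q false j 0 |>).
Hypothesis VY : forall e r, odd r -> V (X e m.+3 r).
Hypothesis VH : forall i r, Hdef n i r -> V (H i r).

Let VN := closedN VZ.

Lemma unit_closed c i j r : (i <= m.+1)%N -> (j <= m.+1)%N -> i != j ->
  V (x c i j r).
Proof.
move=> im jm; have [lt_i|ge_i] := ltnP i m.+1; last first.
  have -> : i = m.+1 by lia.
  by move=> ne; apply: Vq; lia.
have [lt_j|ge_j] := ltnP j m.+1; last first.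
  have -> : j = m.+1 by lia.
  by move=> ne; apply: Vp; lia.
by rewrite (unit_agree X) //; exact: Vx.
Qed.

Let chainH_closed c l r : (l < m.+1)%N -> V (chainH n H c l r).
Proof.
move=> lm; apply: VH; rewrite /Hdef /node.
by case: (eqVneq l.+2 n); case: c; case: (odd r) => /=; lia.
Qed.

Let same_closed c a b i j t r : (a <= m.+1)%N -> (b <= m.+1)%N ->
  (i <= m.+1)%N -> (j <= m.+1)%N -> a != b -> i != j ->
  V <| x c a b t, x c i j r |>.
Proof.
apply: (sl_closed V0 VD VZ (sl c)) => // [*|*].
  exact: unit_closed.
exact: chainH_closed.
Qed.

Let P_norm c := fork_normal (ltnW m_gt1) (px c) (px (~~ c))
  (pfam_fork two_neq0 m_gt1 phi_rel c).
Let P_sym c := fork_sym (ltnW m_gt1) (px c) (px (~~ c))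
  (pfam_fork two_neq0 m_gt1 phi_rel c).
Let qx' c := covector_dual (qx c).
Let Q_norm c := fork_normal (ltnW m_gt1) (qx' c) (qx' (~~ c))
  (qfam_fork two_neq0 m_gt1 phi_rel c).
Let Q_sym c := fork_sym (ltnW m_gt1) (qx' c) (qx' (~~ c))
  (qfam_fork two_neq0 m_gt1 phi_rel c).

Let P_closed c i j r s : (i <= m)%N -> (j <= m)%N ->
  V <| p c i r, p (~~ c) j s |>.
Proof.
move=> im jm; case: c => /=; last (rewrite commC; apply: VN).
  by rewrite (P_norm true) //; apply/VZ/VP.
by rewrite (P_norm true) //; apply/VZ/VP.
Qed.

Let Q_closed c i j r s : (i <= m)%N -> (j <= m)%N ->
  V <| q c i r, q (~~ c) j s |>.
Proof.
move=> im jm; case: c => /=; last (rewrite commC; apply: VN).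
  by rewrite (Q_norm true) //; apply/VZ/VQ.
by rewrite (Q_norm true) //; apply/VZ/VQ.
Qed.

Let z_closed c r : V (zfam c r).
Proof. by rewrite /zfam; case: ifP => // od; apply/VN/VY. Qed.

Let pq_closed c i j r s : (i <= m)%N -> (j <= m)%N ->
  V <| p c i r, q (~~ c) j s |>.
Proof.
by move=> im jm; rewrite pq_pairing //; case: eqP => // _; exact: z_closed.
Qed.

Lemma node_cases l : (1 <= l <= n)%N ->
  (exists2 l', l = l'.+1 & (l' < m)%N) \/ exists c, l = last_node m c.
Proof.
move=> ln; have [lm|ml] := leqP l m.
  by left; exists l.-1; lia.
right; have [e|ne] := eqVneq l m.+1; [exists true|exists false] => //=.
by lia.
Qed.

Lemma genX_low e l t c : (l < m)%N -> exists a b,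
  [/\ (a <= m)%N, (b <= m)%N, a != b & X e l.+1 t = x c a b t].
Proof.
move=> lm; case: e; [exists l, l.+1|exists l.+1, l]; split; try lia.
  by rewrite unit_up node_low.
by rewrite unit_down node_low.
Qed.

Lemma genX_last e c t : X e (last_node m c) t = if e then p c m t else q c m t.
Proof. by case: e; rewrite ?pfam_m ?qfam_m. Qed.

Lemma genX_closed e l t : (1 <= l <= n)%N -> V (X e l t).
Proof.
case/node_cases => [[l' -> lm]|[c ->]].
  by have [a [b [am bm ab ->]]] := genX_low e t true lm; exact: Vx.
by rewrite genX_last; case: e; [exact: Vp|exact: Vq].
Qed.

(** Within one chain the sl relations apply. For the last node of one chain and a unit of the other,
    the bracket is a pairing, a fork bracket, or again a bracket in one chain because the unit is
    shared. *)
Lemma ad_unit e l t c i j r : (1 <= l <= n)%N ->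
  (i <= m.+1)%N -> (j <= m.+1)%N -> i != j -> V <| X e l t, x c i j r |>.
Proof.
move=> ln im jm ij; case/node_cases: ln => [[l' -> lm]|[d ->]].
  have [a [b [am bm ab ->]]] := genX_low e t c lm.
  by apply: same_closed => //; lia.
rewrite genX_last.
have same : V <| if e then p d m t else q d m t, x d i j r |>.
  by case: e; apply: same_closed => //; lia.
have [<-//|dc] := eqVneq d c; have ec : c = ~~ d by case: (d) (c) dc => [] [].
rewrite {}ec {c dc}.
have [lt_i|ge_i] := ltnP i m.+1; last first.
  have -> : i = m.+1 by lia.
  by case: e {same}; [apply: pq_closed|apply: Q_closed]; lia.
have [lt_j|ge_j] := ltnP j m.+1; last first.
  have -> : j = m.+1 by lia.
  case: e {same}; first by apply: P_closed; lia.
  by rewrite commC; apply: VN; rewrite -{2}[d]negbK; apply: pq_closed; lia.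
by rewrite (unit_agree X) // -(unit_agree X d).
Qed.

Let chainH_ad c e j r s : (1 <= j <= n)%N -> V <| chainH n H c m r, X e j s |>.
Proof.
move=> jn; rewrite /chainH; set i := if _ then _ else _.
have Hi : Hdef n i r.
  by rewrite /Hdef /i /node !eqxx; case: (c); case: (odd r) => /=; lia.
have Xj : Xdef n j s by rewrite /Xdef; case: (odd s); lia.
have jl : j != (n + 1)%N by lia.
rewrite (HX_rel phi_rel e Hi Xj jl); exact/VZ/genX_closed.
Qed.

Let qp_low c i t r : (i < m)%N ->
  <| q c m t, p c i r |> = - x true i m (r + t)%N.
Proof.
move=> im; rewrite commC (sl_chain (sl c)) //; try lia.
by rewrite (unit_agree X) //; lia.
Qed.

Let pq_low c i t r : (i < m)%N ->
  <| p c m t, q c i r |> = - dual_units (x true) i m (r + t)%N.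
Proof.
move=> im; rewrite (sl_chain (sl c)) //; try lia.
by rewrite (unit_agree X) ?opprK 1?addnC //; lia.
Qed.

Let pq_top c t r : <| p c m t, q c m r |> = chainH n H c m (t + r)%N.
Proof. by rewrite (sl_diag (sl c)) // big_nat1. Qed.

(** A raising generator kills the bracket by [fork_comm0]. For a lowering one [fork_closed] applies:
    the pairing with its own chain gives a Cartan element, that with the other chain gives X_{n+1},
    and both act inside V. *)
Lemma ad_fork_last e c t i j r s : (i <= m)%N -> (j <= m)%N ->
  V <| X e (last_node m c) t, <| p c i r, p (~~ c) j s |> |>.
Proof.
move=> im jm; rewrite genX_last; case: e.
  rewrite (fork_comm0 (torsion2 two_neq0 (A := A)) (m := m)) //.
  - exact: pfam_commute.
  - by move=> a b u v am bm; exact: P_norm.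
  - by move=> a b N am bm; exact: P_sym.
apply: (fork_closed V0 VD VZ (px (~~ c)) (m := m) (p := p c) (q := q c)) => //.
- by move=> a b u v am bm; exact: P_closed.
- by move=> a u am; exact: Vp.
- by move=> a u v; exact: qp_low.
- move=> u v w; rewrite (commC (q c m u)) pq_top commNl pfam_m; apply: VN.
  by apply: chainH_ad; case: (c) => /=; lia.
- move=> a b u v w am bm; rewrite (commC (q c m v)) commNr; apply: VN.
  have := pq_pairing (~~ c) (i := b) (j := m) w v bm (leqnn m).
  rewrite negbK => ->; case: eqP => _; last by rewrite comm0r.
  rewrite /zfam negbK; case: ifP => od; last by rewrite comm0r.
  rewrite commNr -commC; have := Y_p (~~ c) u od am.
  by rewrite negbK => ->; apply/VZ/Vp.
- move=> b u v bm; rewrite P_norm // (P_sym c _ bm (leqnn m)) scalerA.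
  by eexists _, _, _.
Qed.

Lemma ad_cofork_last e c t i j r s : (i <= m)%N -> (j <= m)%N ->
  V <| X e (last_node m c) t, <| q c i r, q (~~ c) j s |> |>.
Proof.
move=> im jm; rewrite genX_last; case: e; last first.
  rewrite (fork_comm0 (torsion2 two_neq0 (A := A)) (m := m)) //.
  - exact: qfam_commute.
  - by move=> a b u v am bm; exact: Q_norm.
  - by move=> a b N am bm; exact: Q_sym.
apply: (fork_closed V0 VD VZ (qx' (~~ c)) (m := m) (p := q c) (q := p c)) => //.
- by move=> a b u v am bm; exact: Q_closed.
- by move=> a u am; exact: Vq.
- by move=> a u v; exact: pq_low.
- move=> u v w; rewrite pq_top qfam_m.
  by apply: chainH_ad; case: (c) => /=; lia.
- move=> a b u v w am bm; rewrite pq_pairing //.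
  case: eqP => _; last by rewrite comm0r.
  rewrite /zfam; case: ifP => od; last by rewrite comm0r.
  by rewrite commNr -commC Y_q //; apply/VZ/Vq.
- move=> b u v bm; rewrite Q_norm // (Q_sym c _ bm (leqnn m)) scalerA.
  by eexists _, _, _.
Qed.

Lemma ad_fork e l c t i j r s : (1 <= l <= n)%N -> (i <= m)%N -> (j <= m)%N ->
  V <| X e l t, <| p c i r, p (~~ c) j s |> |>.
Proof.
move=> ln im jm; case/node_cases: ln => [[l' -> lm]|[d ->]].
  have [a [b [am bm ab ->]]] := genX_low e t true lm.
  rewrite comm_jacobi !px //; apply: VD; case: eqP => _;
    rewrite ?comm0l ?comm0r //; exact: P_closed.
have [<-|dc] := eqVneq d c; first exact: ad_fork_last.
have ec : c = ~~ d by case: (d) (c) dc => [] [].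
rewrite ec negbK [<| p (~~ d) i r, _ |>]commC commNr; apply: VN.
exact: ad_fork_last.
Qed.

Lemma ad_cofork e l c t i j r s : (1 <= l <= n)%N -> (i <= m)%N -> (j <= m)%N ->
  V <| X e l t, <| q c i r, q (~~ c) j s |> |>.
Proof.
move=> ln im jm; case/node_cases: ln => [[l' -> lm]|[d ->]].
  have [a [b [am bm ab ->]]] := genX_low e t true lm.
  have ba : b != a by rewrite eq_sym.
  rewrite comm_jacobi !qx //; apply: VD; case: eqP => _;
    rewrite ?comm0l ?comm0r ?commNl ?commNr //; apply: VN; exact: Q_closed.
have [<-|dc] := eqVneq d c; first exact: ad_cofork_last.
have ec : c = ~~ d by case: (d) (c) dc => [] [].
rewrite ec negbK [<| q (~~ d) i r, _ |>]commC commNr; apply: VN.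
exact: ad_cofork_last.
Qed.

Lemma ad_Y e e' l t r : (1 <= l <= n)%N -> odd r ->
  V <| X e' l t, X e m.+3 r |>.
Proof.
move=> ln od; rewrite commC; apply: VN.
case/node_cases: ln => [[l' -> lm]|[d ->]]; first by rewrite Y_low.
rewrite genX_last; have [->|ne] := eqVneq e d.
  rewrite -[d]negbK; case: e'; rewrite ?Y_p ?Y_q0 ?negbK //.
    by apply/VZ/Vp.
have -> : e = ~~ d by case: (e) (d) ne => [] [].
case: e'; rewrite ?Y_p0 ?Y_q //; exact/VZ/Vq.
Qed.

Lemma ad_H e l t i r : (1 <= l <= n)%N -> Hdef n i r ->
  V <| X e l t, H i r |>.
Proof.
move=> ln Hi; rewrite commC HX_rel //; last by lia.
  exact/VN/VZ/genX_closed.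
by rewrite /Xdef; case: (odd t); lia.
Qed.

End Subspace.

End Closure.

(** * Signs, matrix units and the matrices F_ij u^r *)

Definition alternate (V : zmodType) (r : nat) (a : V) : V :=
  if odd r then - a else a.

Lemma alternateE (K : pzRingType) (V : lmodType K) r (a : V) :
  alternate r a = (-1) ^+ r *: a.
Proof.
by rewrite /alternate -signr_odd; case: odd; rewrite ?scaleN1r ?scale1r.
Qed.

Lemma alternate_mull (R : pzRingType) r (x y : R) :
  alternate r (x * y) = alternate r x * y.
Proof. by rewrite /alternate; case: odd; rewrite ?mulNr. Qed.

Lemma alternate_mulr (R : pzRingType) r (x y : R) :
  alternate r (x * y) = x * alternate r y.
Proof. by rewrite /alternate; case: odd; rewrite ?mulrN. Qed.

Lemma alternateN (V : zmodType) r (a : V) : alternate r (- a) = - alternate r a.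
Proof. by rewrite /alternate; case: odd. Qed.

Lemma alternateD (V : zmodType) r (a b : V) :
  alternate r (a + b) = alternate r a + alternate r b.
Proof. by rewrite /alternate; case: odd; rewrite ?opprD. Qed.

Lemma alternateM (V : zmodType) r s (a : V) :
  alternate r (alternate s a) = alternate (r + s) a.
Proof. by rewrite /alternate oddD; do 2 case: odd; rewrite /= ?opprK. Qed.

Lemma alternateK (V : zmodType) r (a : V) : alternate r (alternate r a) = a.
Proof. by rewrite alternateM /alternate oddD addbb. Qed.

Lemma alternate0 (V : zmodType) r : alternate r (0 : V) = 0.
Proof. by rewrite /alternate oppr0 if_same. Qed.

Lemma alternate_mulrn (V : zmodType) r (a : V) k :
  alternate r a *+ k = alternate r (a *+ k).
Proof. by rewrite /alternate; case: odd; rewrite ?mulNrn. Qed.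

Lemma alternate_regroup (V : zmodType) r s (a b c d e f g h : V) :
  a - alternate s b - alternate r c + alternate (r + s) d
    - (e - alternate r f - alternate s g + alternate (r + s) h) =
  a - alternate (r + s) h - (e - alternate (r + s) d)
    - alternate s (b - alternate (r + s) f)
    + alternate s (g - alternate (r + s) c).
Proof.
rewrite !alternateD !alternateN !alternateM addnCA.
have e0 v : alternate (r + (s + s)) v = alternate r v.
  by rewrite /alternate !oddD addbb addbF.
by rewrite !e0 !opprD !opprK !addrA [RHS](ACl (1*5*8*4*3*6*7*2)).
Qed.

Section MatrixUnits.
Variables (K : fieldType) (n : nat).
Local Notation M := 'M[{poly K}]_(2 * n).

(* Indices start at 0: [i] and [negi i] stand for the paper's i + 1, -(i + 1). *)
Definition negi (i : nat) : nat := (2 * n - i.+1)%N.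

Definition emx (i j r : nat) : M :=
  \matrix_(a, b) (if (a == i :> nat) && (b == j :> nat) then 'X^r else 0).

(** By [emx_ttau] this is the matrix unit plus its image under [ttau], so twice its projection to
    the fixed points; the doubling keeps the structure constants integral. *)
Definition fmx (i j r : nat) : M :=
  emx i j r - alternate r (emx (negi j) (negi i) r).

Lemma negiK i : (i < 2 * n)%N -> negi (negi i) = i.
Proof. by rewrite /negi; lia. Qed.

Lemma emxM i j k l r s : (j < 2 * n)%N ->
  emx i j r *m emx k l s = emx i l (r + s) *+ (j == k).
Proof.
move=> jn; apply/matrixP => a b; rewrite mulmxnE !mxE (bigD1 (Ordinal jn)) //=.
rewrite !mxE /= eqxx andbT big1 ?addr0.
  by case: (a == i :> nat); case: (j == k); case: (b == l :> nat);
    rewrite /= ?mulr0 ?mul0r ?mulr0n // exprD.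
move=> c /negbTE; rewrite -val_eqE /= => cj.
by rewrite !mxE cj andbF mul0r.
Qed.

Lemma fmx_negi i j r : (i < 2 * n)%N -> (j < 2 * n)%N ->
  fmx (negi j) (negi i) r = - alternate r (fmx i j r).
Proof.
move=> iN jN; rewrite /fmx !negiK // alternateD alternateN alternateK.
by rewrite opprD opprK addrC.
Qed.

(** The commutator expands into eight products of matrix units; terms exchanged by the involution
    pair up into four matrices [fmx]. *)
Lemma fmx_comm i j k l r s :
  (i < 2 * n)%N -> (j < 2 * n)%N -> (k < 2 * n)%N -> (l < 2 * n)%N ->
  <| fmx i j r, fmx k l s |> =
    fmx i l (r + s) *+ (j == k) - fmx k j (r + s) *+ (i == l)
    - alternate s (fmx i (negi k) (r + s) *+ (j == negi l))
    + alternate s (fmx (negi l) j (r + s) *+ (i == negi k)).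
Proof.
move=> iN jN kN lN.
have nl : (negi l < 2 * n)%N by rewrite /negi; lia.
have nk : (negi k < 2 * n)%N by rewrite /negi; lia.
have ni : (negi i < 2 * n)%N by rewrite /negi; lia.
have nj : (negi j < 2 * n)%N by rewrite /negi; lia.
have inj a b : (a < 2 * n)%N -> (b < 2 * n)%N -> (negi a == b) = (negi b == a).
  by rewrite /negi; lia.
have inj2 a b : (a < 2 * n)%N -> (b < 2 * n)%N ->
    (negi a == negi b) = (a == b).
  by rewrite /negi; lia.
have mulE a b c d a' b' c' d' u v : (b < 2 * n)%N -> (b' < 2 * n)%N ->
  (emx a b u - alternate u (emx a' b' u)) *
    (emx c d v - alternate v (emx c' d' v))
  = emx a d (u + v) *+ (b == c) - alternate v (emx a d' (u + v) *+ (b == c'))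
    - alternate u (emx a' d (u + v) *+ (b' == c))
    + alternate (u + v) (emx a' d' (u + v) *+ (b' == c')).
  move=> bN b'N.
  have eM i1 j1 k1 l1 r1 s1 : (j1 < 2 * n)%N -> emx i1 j1 r1 * emx k1 l1 s1 =
      emx i1 l1 (r1 + s1) *+ (j1 == k1) by exact: emxM.
  rewrite -!(eM _ _ _ _ u v) // -alternateM.
  rewrite !(alternate_mulr v) !(alternate_mull u).
  by rewrite mulrBl !mulrBr opprB addrA addrAC.
rewrite /comm /fmx !mulE // {mulE} !inj2 // !negiK // !mulrnBl.
rewrite (addnC s r) (eq_sym l i) (eq_sym k j) (inj i k) // (eq_sym l (negi j)).
rewrite (inj j l) // !(eq_sym (negi _)).
by rewrite !alternate_mulrn; exact: alternate_regroup.
Qed.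

Lemma emx_ttau i j r : (i < 2 * n)%N -> (j < 2 * n)%N ->
  ttau (emx i j r) = - alternate r (emx (negi j) (negi i) r).
Proof.
move=> iN jN; apply/matrixP => a b; rewrite alternateE !mxE rmorphN /=.
congr (- _).
have revE (c : 'I_(2 * n)) d : (d < 2 * n)%N ->
    (rev_ord c == d :> nat) = (c == negi d :> nat).
  by move=> dN; rewrite /= /negi; have := ltn_ord c; lia.
rewrite !revE // andbC; case: ifP => _; last by rewrite comp_poly0 mulr0.
by rewrite rmorphXn /= comp_polyX [in LHS]exprNn.
Qed.

Lemma ttauB (x y : M) : ttau (x - y) = ttau x - ttau y.
Proof. by have := ttauZB 1 x y; rewrite !scale1r. Qed.

Lemma ttauN (x : M) : ttau (- x) = - ttau x.
Proof. by rewrite -(sub0r x) ttauB ttau0 sub0r. Qed.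

Lemma ttauD (x y : M) : ttau (x + y) = ttau x + ttau y.
Proof.
by rewrite -[y in LHS]opprK ttauB ttauN opprK.
Qed.

Lemma ttau_alternate r (x : M) : ttau (alternate r x) = alternate r (ttau x).
Proof.
by rewrite /alternate; case: odd => //; exact: ttauN.
Qed.

Lemma negi_lt i : (i < 2 * n)%N -> (negi i < 2 * n)%N.
Proof. by rewrite /negi; lia. Qed.

Lemma fmx_ttau i j r : (i < 2 * n)%N -> (j < 2 * n)%N ->
  ttau (fmx i j r) = fmx i j r.
Proof.
move=> iN jN; rewrite /fmx ttauB ttau_alternate !emx_ttau ?negi_lt //.
by rewrite !negiK // alternateN alternateK opprK addrC.
Qed.

Lemma emx_trace0 i j r : i != j -> \tr (emx i j r) = 0.
Proof.
move=> ij; rewrite /mxtrace big1 // => a _; rewrite !mxE.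
by case: eqP => [->|//]; rewrite (negbTE ij).
Qed.

Lemma emx_trace i r : (i < 2 * n)%N -> \tr (emx i i r) = 'X^r.
Proof.
move=> iN; rewrite /mxtrace (bigD1 (Ordinal iN)) //= big1 ?addr0.
  by rewrite mxE eqxx.
by move=> a /negbTE; rewrite -val_eqE /= mxE => ->.
Qed.

Lemma trace_alternate r (x : M) : \tr (alternate r x) = alternate r (\tr x).
Proof. by rewrite /alternate; case: odd; rewrite ?raddfN. Qed.

Lemma fmx_trace0 i j r : (i < 2 * n)%N -> (j < 2 * n)%N -> i != j ->
  \tr (fmx i j r) = 0.
Proof.
move=> iN jN ij; rewrite raddfB /= trace_alternate !emx_trace0 //.
  by rewrite alternate0 subr0.
by rewrite /negi; lia.
Qed.

(** Hence in odd degree only differences of diagonal F_ii u^r can lie in sl(2n)[u], which is the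
    source of the F_00 corrections below. *)
Lemma fmx_trace i r : (i < 2 * n)%N ->
  \tr (fmx i i r) = if odd r then 'X^r *+ 2 else 0.
Proof.
move=> iN; rewrite raddfB /= trace_alternate !emx_trace ?negi_lt //.
by rewrite /alternate; case: odd; rewrite ?opprK ?subrr // mulr2n.
Qed.

(** With [colp], the position of the root vector X^+_i when indices start at 0; position [n] stands
    for the index -n. *)
Definition rowp (i : nat) : nat :=
  if (i < n)%N then i.-1 else if i == n then (n - 2)%N else n.-1.
Definition colp (i : nat) : nat := if (i < n)%N then i else n.

Definition Xmx (e : bool) i r : M :=
  if e then fmx (rowp i) (colp i) r else fmx (colp i) (rowp i) r.

Definition Hmx i r : M :=
  if (i < n)%N then fmx i.-1 i.-1 r - fmx i i r
  else fmx (n - 2) (n - 2) r + fmx n.-1 n.-1 r.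

Definition symmx (g : sym) : M :=
  match g with SymH i r => Hmx i r | SymX e i r => Xmx e i r end.

Hypothesis n_gt1 : (1 < n)%N.

Lemma rowp_lt i : (0 < i)%N -> (rowp i < n)%N.
Proof.
by rewrite /rowp; case: (ltnP i n) => iN; [|case: (i =P n) => ?]; lia.
Qed.

Lemma rowp_colp i : (0 < i)%N -> (rowp i < colp i <= n)%N.
Proof.
by rewrite /rowp /colp; case: (ltnP i n) => iN; [|case: (i =P n) => ?]; lia.
Qed.

Lemma symmx_twcur g : sym_def n g -> symmx g \in @twcur_pred K n.
Proof.
case: g => [i r|e i r] /=.
  rewrite /Hdef => ir; apply/twcur_predP; rewrite /Hmx; case: ltnP => iN.
    rewrite raddfB /= ttauB !fmx_trace ?fmx_ttau ?subrr //; lia.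
  have ev : odd r = false by move: ir; case: (odd r) => //; lia.
  rewrite raddfD ttauD /=.
  by rewrite !fmx_trace ?fmx_ttau ?ev ?addr0 //; lia.
rewrite /Xdef => ir; apply/twcur_predP; rewrite /Xmx.
have := @rowp_colp i; case: e => rc; rewrite fmx_trace0 ?fmx_ttau //; lia.
Qed.

Definition symtw (g : sym) : twcur K n := insubd 0 (symmx g).

Lemma symtwE g : sym_def n g -> val (symtw g) = symmx g.
Proof. by move=> /symmx_twcur gM; rewrite /symtw insubdK. Qed.

End MatrixUnits.

(** * Weights of the matrices and the twisted Cartan entries *)

Section MatrixRelations.
Variables (K : fieldType) (n : nat).
Local Notation F := (fmx K n).
Local Notation negi := (negi n).
Local Notation rowp := (rowp n).
Local Notation colp := (colp n).

(** The eigenvalue of F_ii u^r on F_kl: the diagonal positions i and -i contribute one difference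
    each, the second with the sign of the degree. *)
Definition wt (r i k l : nat) : int :=
  (i == k)%:R - (i == l)%:R
  + alternate r ((i == negi l)%:R - (i == negi k)%:R).

Lemma fmx_weight i k l r s :
  (i < 2 * n)%N -> (k < 2 * n)%N -> (l < 2 * n)%N ->
  <| F i i r, F k l s |> = F k l (r + s) *~ wt r i k l.
Proof.
move=> iN kN lN; rewrite fmx_comm // /wt.
have e1 : F i l (r + s) *+ (i == k) = F k l (r + s) *~ (i == k)%:R.
  by case: eqVneq => [->|]; rewrite ?mulr1z ?mulr0z.
have e2 : F k i (r + s) *+ (i == l) = F k l (r + s) *~ (i == l)%:R.
  by case: eqVneq => [->|]; rewrite ?mulr1z ?mulr0z.
have altE (a b : nat) : alternate s (alternate (r + s) (F a b (r + s))) =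
    alternate r (F a b (r + s)).
  by rewrite alternateM /alternate !oddD addbCA addbb addbF.
have e3 : alternate s (F i (negi k) (r + s) *+ (i == negi l)) =
    - alternate r (F k l (r + s) *~ (i == negi l)%:R).
  case: eqVneq => [->|_]; last by rewrite mulr0z !alternate0 oppr0.
  by rewrite fmx_negi // mulr1n mulr1z alternateN altE.
have e4 : alternate s (F (negi l) i (r + s) *+ (i == negi k)) =
    - alternate r (F k l (r + s) *~ (i == negi k)%:R).
  case: eqVneq => [->|_]; last by rewrite mulr0z !alternate0 oppr0.
  by rewrite fmx_negi // mulr1n mulr1z alternateN altE.
rewrite e1 e2 e3 e4 opprK.
by rewrite /alternate; case: (odd r); rewrite ?mulrzDr ?mulrzBr ?mulrNz ?mulrzBr
  ?opprB ?opprK ?addrA // -!addrA; do 2!congr (_ + _); rewrite addrC.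
Qed.

Lemma wt_swap r i k l : wt r i l k = - wt r i k l.
Proof.
by rewrite /wt opprD opprB /alternate; case: odd; rewrite !opprB.
Qed.

Hypothesis n_gt3 : (3 < n)%N.

Definition wtH r i k l : int :=
  if (i < n)%N then wt r i.-1 k l - wt r i k l
  else wt r (n - 2) k l + wt r n.-1 k l.

Lemma Hmx_comm i k l r s : (0 < i <= n)%N -> (k < 2 * n)%N -> (l < 2 * n)%N ->
  <| Hmx K n i r, F k l s |> = F k l (r + s) *~ wtH r i k l.
Proof.
move=> ir kN lN; rewrite /Hmx /wtH; case: (ltnP i n) => iN.
  by rewrite commDl commNl !fmx_weight ?mulrzBr //; lia.
by rewrite commDl !fmx_weight ?mulrzDr //; lia.
Qed.

Lemma Hmx_Xmx e i j r s (k : int) : (0 < i <= n)%N -> (0 < j)%N ->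
  wtH r i (rowp j) (colp j) = k ->
  <| Hmx K n i r, Xmx K n e j s |> = Xmx K n e j (r + s) *~ (pm e * k).
Proof.
have n_gt1 : (1 < n)%N by lia.
move=> ir jr <-; have rc := rowp_colp n_gt1 jr; have rn := rowp_lt n_gt1 jr.
rewrite /Xmx; case: e; rewrite Hmx_comm; try lia.
 by rewrite /= mul1r.
congr (_ *~ _); rewrite /= mulN1r.
by rewrite /wtH; case: ifP => _; rewrite !(wt_swap _ _ (rowp j)) ?opprD.
Qed.

Lemma wt_low r i k l : (i < n)%N -> (k < n)%N -> (l < n)%N ->
  wt r i k l = (i == k)%:R - (i == l)%:R.
Proof.
move=> iN kN lN; rewrite /wt.
have -> : (i == negi l) = false by rewrite /negi; lia.
have -> : (i == negi k) = false by rewrite /negi; lia.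
by rewrite subrr alternate0 addr0.
Qed.

Lemma wt_last r i k : (i < n)%N -> (k < n)%N ->
  wt r i k n = (i == k)%:R + alternate r (i == n.-1)%:R.
Proof.
move=> iN kN; rewrite /wt (ltn_eqF iN) subr0.
have -> : (i == negi n) = (i == n.-1) by rewrite /negi; lia.
have -> : (i == negi k) = false by rewrite /negi; lia.
by rewrite subr0.
Qed.

Lemma wtH_cartan r i j : Hdef n i r -> (0 < j <= n)%N ->
  wtH r i (rowp j) (colp j) = cartan_tw n r i j.
Proof.
move=> ir jr; have i_gt0 : (0 < i)%N by case/andP: ir.
rewrite /wtH /rowp /colp; case: (ltnP j n) => jN; last first.
  have -> : j = n by lia.
  rewrite eqxx; case: (ltnP i n) => iN.
    rewrite !wt_last; try lia.
    rewrite /cartan_tw /cartan /delta /alternate (ltn_eqF iN) eqxx /= subn1.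
    case: (odd r); do 30? (case: eqP => ? //=; try lia).
  have ei : i = n by move: ir; rewrite /Hdef; case: odd; lia.
  have ev : odd r = false.
    by apply/negP => od; move: ir; rewrite /Hdef od ei; lia.
  rewrite !wt_last; try lia.
  rewrite /cartan_tw /cartan /delta /alternate ev ei eqxx /=.
  do 30? (case: eqP => ? //=; try lia).
case: (ltnP i n) => iN.
  rewrite !wt_low; try lia.
  rewrite /cartan_tw /cartan /delta (ltn_eqF iN) (ltn_eqF jN) /=.
  case: (odd r); do 30? (case: eqP => ? //=; try lia).
have ei : i = n by move: ir; rewrite /Hdef; case: odd; lia.
have ev : odd r = false.
  by apply/negP => od; move: ir; rewrite /Hdef od ei; lia.
rewrite !wt_low; try lia.
rewrite /cartan_tw /cartan /delta /alternate ev ei eqxx /= (gtn_eqF jN).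
do 30? (case: eqP => ? //=; try lia).
Qed.

Lemma wtH_last r i : Hdef n i r ->
  wtH r i (rowp (n + 1)) (colp (n + 1)) =
  if odd r then 0 else 2 * delta i n - 2 * delta i (n - 1).
Proof.
move=> ir; have i_gt0 : (0 < i)%N by case/andP: ir.
have e1 : (n + 1 < n)%N = false by lia.
have e2 : (n + 1 == n)%N = false by lia.
rewrite /wtH /rowp /colp e1 e2 /=.
rewrite /delta; case: (ltnP i n) => iN.
  rewrite !wt_last; try lia.
  rewrite /alternate (ltn_eqF iN) subn1.
  case: (odd r); do 30? (case: eqP => ? //=; try lia).
have ei : i = n by move: ir; rewrite /Hdef; case: odd; lia.
have ev : odd r = false.
  by apply/negP => od; move: ir; rewrite /Hdef od ei; lia.
rewrite !wt_last; try lia.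
rewrite /alternate ev ei eqxx.
do 30? (case: eqP => ? //=; try lia).
Qed.

End MatrixRelations.

(** * Transfer of matrix identities to an arbitrary target *)

Section Lifting.
Variables (K : fieldType) (n : nat) (B : algType K).
Variable iota : twcur K n -> B.
Hypotheses (iota_lin : linear iota)
  (iota_lie : forall x y, iota (lie x y) = <| iota x, iota y |>).
Variable psi : {lrmorphism free_alg K (Lgen n) -> B}.
Hypothesis psi_gen : forall g : Lgen n, psi (fgen g) = iota (symtw K n (val g)).
Hypothesis n_gt3 : (3 < n)%N.

Local Notation M := 'M[{poly K}]_(2 * n).

(** With [iota] an arbitrary Lie morphism, one verification of the relations in matrices serves both
    the inclusion of g into matrices and the canonical map of g to its enveloping algebra. *)
Definition lifts (u : free_alg K (Lgen n)) (x : M) :=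
  exists2 y : twcur K n, psi u = iota y & val y = x.

Let iotaD x y : iota (x + y) = iota x + iota y.
Proof. by have := iota_lin 1 x y; rewrite !scale1r. Qed.

Let iota0 : iota 0 = 0.
Proof. by apply: (addrI (iota 0)); rewrite -iotaD !addr0. Qed.

Let iotaZ c x : iota (c *: x) = c *: iota x.
Proof. by have := iota_lin c x 0; rewrite iota0 !addr0. Qed.

Lemma lifts_eq u v x y : lifts u x -> lifts v y -> x = y -> psi u = psi v.
Proof. by case=> a -> <- [b -> <-] /val_inj->. Qed.

Lemma lifts_conv u x y : lifts u x -> x = y -> lifts u y.
Proof. by move=> ux <-. Qed.

Lemma lifts0 : lifts 0 0.
Proof. by exists 0; [rewrite rmorph0 iota0|rewrite raddf0]. Qed.

Lemma liftsD u v x y : lifts u x -> lifts v y -> lifts (u + v) (x + y).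
Proof.
case=> a ua <- [b vb <-].
by exists (a + b); [rewrite rmorphD /= ua vb iotaD|rewrite raddfD].
Qed.

Lemma liftsZ c u x : lifts u x -> lifts (c *: u) (c%:P *: x).
Proof. by case=> a ua <-; exists (c *: a); rewrite // linearZ /= ua iotaZ. Qed.

Lemma liftsN u x : lifts u x -> lifts (- u) (- x).
Proof.
move=> ux; rewrite -scaleN1r; apply: lifts_conv (liftsZ (-1) ux) _.
by rewrite polyCN scaleN1r.
Qed.

Lemma liftsMz k u x : lifts u x -> lifts (k%:~R *: u) (x *~ k).
Proof.
move=> ux; apply: lifts_conv (liftsZ k%:~R ux) _.
by rewrite rmorph_int scaler_int.
Qed.

Lemma lifts_alt k u x : lifts u x -> lifts ((-1) ^+ k *: u) (alternate k x).
Proof.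
move=> ux; apply: lifts_conv (liftsZ _ ux) _.
by rewrite alternateE rmorphXn /= polyCN.
Qed.

Lemma lifts_comm u v x y : lifts u x -> lifts v y ->
  lifts <| u, v |> <| x, y |>.
Proof.
case=> a ua <- [b vb <-]; exists (lie a b) => //.
by rewrite /comm rmorphB !rmorphM /= ua vb iota_lie.
Qed.

Lemma lifts_sym g : sym_def n g -> lifts (Lsym K n g) (symmx K n g).
Proof.
move=> gdef; exists (symtw K n g); last by rewrite symtwE //; lia.
by rewrite /Lsym insubT psi_gen.
Qed.

Lemma lifts_H i r : Hdef n i r -> lifts (LH K n i r) (Hmx K n i r).
Proof. exact: (@lifts_sym (SymH i r)). Qed.

Lemma lifts_X e i r : Xdef n i r -> lifts (LX K n e i r) (Xmx K n e i r).
Proof. exact: (@lifts_sym (SymX e i r)). Qed.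

End Lifting.

Section Positions.
Variable n : nat.
Hypothesis n_gt3 : (3 < n)%N.

Lemma posE : (rowp n n = n - 2)%N * (colp n n = n)%N *
  (rowp n (n - 1) = n - 2)%N * (colp n (n - 1) = n.-1)%N *
  (rowp n (n - 2) = n - 3)%N * (colp n (n - 2) = n - 2)%N *
  (rowp n (n - 3) = n - 4)%N * (colp n (n - 3) = n - 3)%N *
  (rowp n (n + 1) = n.-1) * (colp n (n + 1) = n).
Proof. by rewrite /rowp /colp; do !split; repeat case: ifP; lia. Qed.

End Positions.

Ltac decide_indices :=
  repeat match goal with
  | |- context [?x *+ nat_of_bool (@eq_op ?T ?a ?b)] =>
    first [ have -> : (@eq_op T a b) = false by rewrite /negi; lia
          | have -> : (@eq_op T a b) = true by rewrite /negi; lia ]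
  end; rewrite ?mulr0n ?mulr1n.

Section CommAlternate.
Variable A : pzRingType.
Implicit Types x y : A.

Lemma comm_alternatel r x y : <| alternate r x, y |> = alternate r <| x, y |>.
Proof. by rewrite /alternate; case: odd; rewrite ?commNl. Qed.

Lemma comm_alternater r x y : <| x, alternate r y |> = alternate r <| x, y |>.
Proof. by rewrite /alternate; case: odd; rewrite ?commNr. Qed.

End CommAlternate.

(** Evaluates nested brackets by [fmx_comm], deciding each index comparison by arithmetic, until
    only signed F_ij remain. *)
Ltac expand_comm :=
  repeat (rewrite ?(commNl, commNr, comm_alternatel, comm_alternater, comm0l,
    comm0r, alternate0, alternateN, alternateM, subr0, addr0, sub0r, add0r,
    oppr0, opprK);
    rewrite fmx_comm; [decide_indices | rewrite /negi; lia ..]);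
  rewrite ?(commNl, commNr, comm_alternatel, comm_alternater, comm0l,
    comm0r, alternate0, alternateN, alternateM, subr0, addr0, sub0r, add0r,
    oppr0, opprK).

(** * The defining relations, checked on matrices *)

Section GenericBrackets.
Variables (K : fieldType) (n : nat).
Hypothesis n_gt3 : (3 < n)%N.
Local Notation F := (fmx K n).
Local Notation Xm := (Xmx K n).
Local Notation Hm := (Hmx K n).
Local Notation row := (rowp n).
Local Notation col := (colp n).

Lemma pos_range i : (0 < i <= n)%N ->
  [/\ (row i < n.-1)%N, (col i <= n)%N & (row i < col i)%N].
Proof.
rewrite /rowp /colp => ir; case: (ltnP i n) => iN; last case: (i =P n) => ?;
  split; lia.
Qed.

Lemma fork_col i j : (0 < i <= n)%N -> (0 < j <= n)%N -> ~~ fork n i j ->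
  (col i == negi n (col j)) = false.
Proof.
move=> ir jr; rewrite /fork !xpair_eqE /colp /negi.
by case: (ltnP i n) => iN; case: (ltnP j n) => jN; lia.
Qed.

Lemma Xmx_same e i j r s : (0 < i <= n)%N -> (0 < j <= n)%N -> ~~ fork n i j ->
  <| Xm e i r, Xm e j s |> =
  if e then F (row i) (col j) (r + s) *+ (col i == row j)
    - F (row j) (col i) (r + s) *+ (row i == col j)
  else F (col i) (row j) (r + s) *+ (row i == col j)
    - F (col j) (row i) (r + s) *+ (col i == row j).
Proof.
move=> ir jr fk; have cc := fork_col ir jr fk.
have [ri ci _] := pos_range ir; have [rj cj _] := pos_range jr.
have rr : (row i == negi n (row j)) = false by rewrite /negi; lia.
rewrite /Xmx; case: e;
  rewrite fmx_comm ?cc ?rr ?mulr0n ?alternate0 ?subr0 ?addr0 //; lia.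
Qed.

Lemma Xmx_pm i j r s : (0 < i <= n)%N -> (0 < j <= n)%N ->
  <| Xm true i r, Xm false j s |> =
  F (row i) (row j) (r + s) *+ (col i == col j)
  - F (col j) (col i) (r + s) *+ (row i == row j).
Proof.
move=> ir jr.
have [ri ci _] := pos_range ir; have [rj cj _] := pos_range jr.
have cr : (col i == negi n (row j)) = false by rewrite /negi; lia.
have rc : (row i == negi n (col j)) = false by rewrite /negi; lia.
rewrite /Xmx fmx_comm ?cr ?rc ?mulr0n ?alternate0 ?subr0 ?addr0 //; lia.
Qed.

Lemma Xmx_self e i r s : (0 < i <= n)%N -> <| Xm e i r, Xm e i s |> = 0.
Proof.
move=> ir; rewrite Xmx_same //; last by rewrite /fork !xpair_eqE; lia.
have [_ _ rc] := pos_range ir.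
by rewrite (ltn_eqF rc) (gtn_eqF rc) !mulr0n subrr if_same.
Qed.

Lemma Xmx_shift e i r j s : (0 < i <= n)%N -> (0 < j <= n)%N -> ~~ fork n i j ->
  <| Xm e i (r + 1), Xm e j s |> = <| Xm e i r, Xm e j (s + 1) |>.
Proof.
move=> ir jr fk; rewrite !Xmx_same //.
by have -> : (r + 1 + s = r + (s + 1))%N by lia.
Qed.

(** For [i] different from [j] the Cartan entry counts, with a minus sign, how often the two
    positions fit end to end: value 0 makes the matrices commute, value -1 leaves exactly one
    product. *)
Lemma cartan_pos i j : (0 < i <= n)%N -> (0 < j <= n)%N -> ~~ fork n i j ->
  cartan n i j = - ((col i == row j)%:R + (row i == col j)%:R)
    + 2 * (i == j)%:R.
Proof.
move=> ir jr; rewrite /fork !xpair_eqE /cartan /delta /rowp /colp.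
case: (ltnP i n) => iN; case: (ltnP j n) => jN.
- rewrite (ltn_eqF iN) (ltn_eqF jN) /=; do 30? (case: eqP => ? //=; try lia).
- have -> : j = n by lia.
  rewrite (ltn_eqF iN) eqxx /=; do 30? (case: eqP => ? //=; try lia).
- have -> : i = n by lia.
  rewrite (ltn_eqF jN) eqxx /=; do 30? (case: eqP => ? //=; try lia).
- have -> : i = n by lia.
  have -> : j = n by lia.
  rewrite eqxx /=; do 30? (case: eqP => ? //=; try lia).
Qed.

Lemma Xmx_commute e i r j s : (0 < i <= n)%N -> (0 < j <= n)%N ->
  cartan n i j = 0 -> ~~ fork n i j -> <| Xm e i r, Xm e j s |> = 0.
Proof.
move=> ir jr c0 fk; rewrite Xmx_same //.
have [ij|ij] := eqVneq i j.
  have [_ _ rc] := pos_range ir; rewrite -ij.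
  by rewrite (ltn_eqF rc) (gtn_eqF rc) !mulr0n subrr if_same.
have := cartan_pos ir jr fk; rewrite c0 (negbTE ij).
by case: (col i == row j); case: (row i == col j) => //= _;
  rewrite !mulr0n subrr if_same.
Qed.

Lemma Xmx_serre e i r1 r2 j s : (0 < i <= n)%N -> (0 < j <= n)%N ->
  cartan n i j = -1 -> <| Xm e i r1, <| Xm e i r2, Xm e j s |> |> = 0.
Proof.
move=> ir jr c1.
have fk : ~~ fork n i j.
  apply/negP; rewrite /fork !xpair_eqE => /orP[] /andP[/eqP ei /eqP ej];
    move: c1; rewrite /cartan /delta ei ej;
    do 30? (case: eqP => ? //=; try lia).
have ij : i != j.
  apply/negP => /eqP ij; move: c1; rewrite -ij cartan_pos //.
    have [_ _ rc] := pos_range ir.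
    by rewrite (ltn_eqF rc) (gtn_eqF rc) eqxx.
  by rewrite /fork !xpair_eqE; lia.
have [ri ci rci] := pos_range ir; have [rj cj rcj] := pos_range jr.
have cc := fork_col ir jr fk.
have := cartan_pos ir jr fk; rewrite c1 (negbTE ij) Xmx_same //.
have cc' : col i != negi n (col j) by rewrite cc.
by case: eqVneq => [e1|_]; case: eqVneq => [e2|_] //= _; try (exfalso; lia);
  rewrite ?mulr1n ?mulr0n ?subr0 ?sub0r; case: e; rewrite /Xmx ?commNr fmx_comm;
  try (rewrite /negi; lia); decide_indices;
  rewrite !(alternate0, subr0, addr0, oppr0).
Qed.

End GenericBrackets.

Section SpecialBrackets.
Variables (K : fieldType) (n : nat).
Hypothesis n_gt3 : (3 < n)%N.
Local Notation F := (fmx K n).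
Local Notation Xm := (Xmx K n).
Local Notation Hm := (Hmx K n).

Let pE := posE n_gt3.

(** The involution negates antidiagonal units in even degree; this is why X_{n+1,r} occurs only for
    odd [r]. *)
Lemma fmx_even0 i r : (i < 2 * n)%N -> ~~ odd r -> F i (negi n i) r = 0.
Proof.
by move=> iN ev; rewrite /fmx negiK // /alternate (negbTE ev) subrr.
Qed.

Let nE : negi n n = n.-1. Proof. by rewrite /negi; lia. Qed.
Let n1E : negi n n.-1 = n. Proof. by rewrite /negi; lia. Qed.

Let flip_nn r : F n n r = - alternate r (F n.-1 n.-1 r).
Proof. by rewrite -fmx_negi ?n1E //; lia. Qed.

Let flip_row r : F n.-1 (negi n (n - 2)) r = - alternate r (F (n - 2) n r).
Proof. by rewrite -fmx_negi ?nE //; lia. Qed.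

Let flip_col r : F (negi n (n - 2)) n.-1 r = - alternate r (F n (n - 2) r).
Proof. by rewrite -fmx_negi ?nE //; lia. Qed.

Let flip_row' r : F n (negi n (n - 2)) r = - alternate r (F (n - 2) n.-1 r).
Proof. by rewrite -fmx_negi ?n1E //; lia. Qed.

Let flip_col' r : F (negi n (n - 2)) n r = - alternate r (F n.-1 (n - 2) r).
Proof. by rewrite -fmx_negi ?n1E //; lia. Qed.

Let even_last r : ~~ odd r -> F n.-1 n r = 0.
Proof.
by move=> ev; have := @fmx_even0 n.-1 r _ ev; rewrite n1E; apply; lia.
Qed.

Let even_last' r : ~~ odd r -> F n n.-1 r = 0.
Proof. by move=> ev; have := @fmx_even0 n r _ ev; rewrite nE; apply; lia. Qed.

Let alternate_odd (V : zmodType) r (a : V) : alternate (2 * r + 1) a = - a.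
Proof. by rewrite /alternate addn1 /= mul2n odd_double. Qed.

Let alternate_even (V : zmodType) r (a : V) : ~~ odd r -> alternate r a = a.
Proof. by rewrite /alternate => /negbTE->. Qed.

Let two_flip r s (V : zmodType) (a : V) :
  alternate s (- alternate (2 * r + s + 1) a) = a.
Proof.
rewrite alternateN alternateM.
rewrite (_ : (s + (2 * r + s + 1) = 2 * (r + s) + 1)%N); last by lia.
by rewrite alternate_odd opprK.
Qed.

Lemma XpnXmn1_mx r s : <| Xm true n r, Xm false (n - 1) s |> =
  - Xm true (n + 1) (r + s).
Proof. by rewrite /Xmx !pE; expand_comm. Qed.

Lemma XpnXmn1_even_mx r s : ~~ odd (r + s) ->
  <| Xm true n r, Xm false (n - 1) s |> = 0.
Proof. by move=> ev; rewrite XpnXmn1_mx /Xmx !pE even_last ?oppr0. Qed.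

Lemma Xpn1Xmn_mx r s : <| Xm true (n - 1) r, Xm false n s |> =
  - Xm false (n + 1) (r + s).
Proof. by rewrite /Xmx !pE; expand_comm. Qed.

Lemma Xpn1Xmn_even_mx r s : ~~ odd (r + s) ->
  <| Xm true (n - 1) r, Xm false n s |> = 0.
Proof. by move=> ev; rewrite Xpn1Xmn_mx /Xmx !pE even_last' ?oppr0. Qed.

Lemma XpXm_mx i r j s : (0 < i <= n - 1)%N -> (0 < j <= n - 1)%N ->
  <| Xm true i r, Xm false j s |> = Hm i (r + s) *~ delta i j.
Proof.
move=> ir jr; rewrite Xmx_pm //; try lia.
have iN : (i < n)%N by lia.
have jN : (j < n)%N by lia.
rewrite /delta /Hmx /rowp /colp iN jN.
case: (eqVneq i j) => [->|ij]; first by rewrite !eqxx mulr1n mulr1z.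
rewrite mulr0z.
have -> : (i.-1 == j.-1) = false by lia.
by rewrite !mulr0n subrr.
Qed.

Lemma XpnXm_mx r j s : (0 < j <= n)%N -> j != (n - 1)%N ->
  <| Xm true n r, Xm false j s |> =
  Hm (if odd (r + s) then (n - 1)%N else n) (r + s) *~ delta n j.
Proof.
move=> jr j1; rewrite Xmx_pm //; try lia; rewrite !pE /delta.
have [<-|nj] := eqVneq n j.
  rewrite !pE !eqxx !mulr1n mulr1z flip_nn /alternate /Hmx.
  case: (odd _); rewrite ?ltnn ?opprK //.
  have -> : (n - 1 < n)%N by lia.
  by rewrite subn1 -subn2.
have jN : (j < n)%N by lia.
rewrite mulr0z /rowp /colp jN.
have -> : (n == j) = false by lia.
have -> : (n - 2 == j.-1)%N = false by lia.
by rewrite !mulr0n subrr.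
Qed.

Lemma XpXmn_mx j r s : (0 < j <= n)%N -> j != (n - 1)%N ->
  <| Xm true j r, Xm false n s |> =
  Hm (if odd (r + s) then (n - 1)%N else n) (r + s) *~ delta n j.
Proof.
move=> jr j1; rewrite Xmx_pm //; try lia; rewrite !pE /delta.
have [<-|nj] := eqVneq n j.
  rewrite !pE !eqxx !mulr1n mulr1z flip_nn /alternate /Hmx.
  case: (odd _); rewrite ?ltnn ?opprK //.
  have -> : (n - 1 < n)%N by lia.
  by rewrite subn1 -subn2.
have jN : (j < n)%N by lia.
rewrite mulr0z /rowp /colp jN.
have -> : (j == n) = false by lia.
have -> : (j.-1 == n - 2)%N = false by lia.
by rewrite !mulr0n subrr.
Qed.

Lemma XpXm_last_mx r s :
  <| Xm true (n + 1) (2 * r + 1), Xm false (n + 1) (2 * s + 1) |> =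
  2%:P *: (Hm n (2 * r + 2 * s + 2) - Hm (n - 1) (2 * r + 2 * s + 2)).
Proof.
rewrite /Xmx !pE; expand_comm.
have -> : (2 * r + 1 + (2 * s + 1) = 2 * r + 2 * s + 2)%N by lia.
have ev : ~~ odd (2 * r + 2 * s + 2) by lia.
rewrite !alternate_odd n1E nE flip_nn alternate_even // !opprK.
have -> : 2%:P = 2%:R :> {poly K} by rewrite rmorph_nat.
have n1 : (n - 1 < n)%N by lia.
rewrite /Hmx ltnn n1 subn1 -subn2 scaler_nat mulr2n.
have e (V : zmodType) (a b : V) : a + b - (a - b) = b + b.
  by rewrite opprB addrC addrA subrK.
by rewrite e [RHS]addrA.
Qed.

Lemma shift_fork_mx e r s : <| Xm e n (r + 1), Xm e (n - 1) s |> =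
  - <| Xm e n r, Xm e (n - 1) (s + 1) |>.
Proof.
have -> : (r + 1 = r.+1)%N by lia.
have -> : (s + 1 = s.+1)%N by lia.
rewrite /Xmx !pE; case: e; expand_comm; rewrite addSnnS /alternate /=;
  by case: odd; rewrite /= ?opprK.
Qed.

Lemma last_last_mx e r s :
  <| Xm e (n + 1) (2 * r + 1), Xm e (n + 1) (2 * s + 1) |> = 0.
Proof. by rewrite /Xmx !pE; case: e; expand_comm. Qed.

Lemma last_X_mx e e' r j s : (0 < j < n - 1)%N ->
  <| Xm e (n + 1) (2 * r + 1), Xm e' j s |> = 0.
Proof.
move=> jr; have jN : (j < n)%N by lia.
by rewrite /Xmx !pE /rowp /colp jN; case: e; case: e'; expand_comm.
Qed.

Lemma Xplast_Xpn1_mx r s :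
  <| Xm true (n + 1) (2 * r + 1), Xm true (n - 1) s |> =
  Xm true n (2 * r + s + 1) *~ -2.
Proof.
rewrite /Xmx !pE; expand_comm; rewrite flip_row.
have -> : (2 * r + 1 + s = 2 * r + s + 1)%N by lia.
rewrite two_flip.
by rewrite mulrNz -pmulrn mulr2n [RHS]opprD.
Qed.

Lemma Xplast_Xmn_mx r s :
  <| Xm true (n + 1) (2 * r + 1), Xm false n s |> =
  Xm false (n - 1) (2 * r + s + 1) *~ 2.
Proof.
rewrite /Xmx !pE; expand_comm.
have -> : (2 * r + 1 + s = 2 * r + s + 1)%N by lia.

by rewrite flip_col' two_flip -pmulrn mulr2n.
Qed.

Lemma Xmlast_Xmn1_mx r s :
  <| Xm false (n + 1) (2 * r + 1), Xm false (n - 1) s |> =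
  Xm false n (2 * r + s + 1) *~ 2.
Proof.
rewrite /Xmx !pE; expand_comm.
have -> : (2 * r + 1 + s = 2 * r + s + 1)%N by lia.
by rewrite flip_col two_flip -pmulrn mulr2n.
Qed.

Lemma Xmlast_Xpn_mx r s :
  <| Xm false (n + 1) (2 * r + 1), Xm true n s |> =
  Xm true (n - 1) (2 * r + s + 1) *~ -2.
Proof.
rewrite /Xmx !pE; expand_comm.
have -> : (2 * r + 1 + s = 2 * r + s + 1)%N by lia.
by rewrite flip_row' two_flip mulrNz -pmulrn mulr2n [RHS]opprD.
Qed.

Lemma last_zero_mx r s :
  [/\ <| Xm true (n + 1) (2 * r + 1), Xm false (n - 1) s |> = 0,
      <| Xm true (n + 1) (2 * r + 1), Xm true n s |> = 0,
      <| Xm false (n + 1) (2 * r + 1), Xm true (n - 1) s |> = 0 &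
      <| Xm false (n + 1) (2 * r + 1), Xm false n s |> = 0].
Proof. by rewrite /Xmx !pE; split; expand_comm. Qed.

Lemma commute_fork_mx e r s : ~~ odd (r + s) ->
  <| Xm e (n - 1) r, Xm e n s |> = 0.
Proof.
move=> ev; rewrite /Xmx !pE; case: e; expand_comm.
  by rewrite fmx_even0 ?alternate0 ?oppr0 //; lia.
have -> : F (negi n (n - 2)) (n - 2) (r + s) = 0.
  rewrite -{2}[(n - 2)%N](negiK (n := n)) ?fmx_even0 //.
    by rewrite negi_lt //; lia.
  by lia.
by rewrite ?alternate0 ?oppr0.
Qed.

Lemma serre_fork_mx e i j r1 r2 s : fork n i j ->
  <| Xm e i r1, <| Xm e i r2, Xm e j s |> |> = 0.
Proof.
rewrite /fork !xpair_eqE => /orP[] /andP[/eqP-> /eqP->];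
  by rewrite /Xmx !pE; case: e; expand_comm.
Qed.

Lemma triple_mx e r s u :
  <| Xm e n s, <| Xm e (n - 2) r, Xm e (n - 1) u |> |> =
  alternate (s + u) <| Xm e (n - 1) u, <| Xm e (n - 2) r, Xm e n s |> |>.
Proof.
rewrite /Xmx !pE; case: e; expand_comm;
  have -> : (u + (r + s) = s + (r + u))%N by lia.
  rewrite /alternate !oddD; do 3 case: (odd _); rewrite //=.
  rewrite /alternate !oddD; do 3 case: (odd _); rewrite //=.
Qed.

Lemma quad1_mx e r s : <| <| Xm e n 0, Xm e (n - 2) r |>,
  <| Xm e n 0, Xm e (n - 1) s |> |> = 0.
Proof. by rewrite /Xmx !pE; case: e; expand_comm. Qed.

Lemma quad2_mx e r s : <| <| Xm e (n - 1) 0, Xm e (n - 2) 0 |>,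
  <| Xm e (n - 1) s, Xm e n r |> |> = 0.
Proof. by rewrite /Xmx !pE; case: e; expand_comm. Qed.

Lemma six_mx i r s : i = n \/ i = (n - 1)%N ->
  <| <| Xm true i s, <| Xm true (n - 2) 0, Xm true (n - 3) 0 |> |>,
    <| <| Xm true (n - 1) 0, Xm true (n - 2) 0 |>, Xm true n r |> |> = 0.
Proof. by case=> ->; rewrite /Xmx !pE; expand_comm. Qed.

Lemma five_mx i r s : i = n \/ i = (n - 1)%N ->
  <| <| Xm true i s, Xm true (n - 2) 0 |>,
    <| <| Xm true (n - 1) 0, Xm true (n - 2) 0 |>, Xm true n r |> |> = 0.
Proof. by case=> ->; rewrite /Xmx !pE; expand_comm. Qed.

End SpecialBrackets.

Section Relations.
Variables (K : fieldType) (n : nat) (B : algType K).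
Variable iota : twcur K n -> B.
Hypotheses (iota_lin : linear iota)
  (iota_lie : forall x y, iota (lie x y) = <| iota x, iota y |>).
Variable psi : {lrmorphism free_alg K (Lgen n) -> B}.
Hypothesis psi_gen : forall g : Lgen n, psi (fgen g) = iota (symtw K n (val g)).
Hypothesis n_gt3 : (3 < n)%N.

Ltac lift := lazymatch goal with
  | |- lifts _ _ <| _, _ |> _ => eapply (lifts_comm iota_lie); lift
  | |- lifts _ _ (- _) _ => eapply (liftsN iota_lin); lift
  | |- lifts _ _ (_%:~R *: _) _ => eapply (liftsMz iota_lin); lift
  | |- lifts _ _ ((-1) ^+ _ *: _) _ => eapply (lifts_alt iota_lin); lift
  | |- lifts _ _ (_ *: _) _ => eapply (liftsZ iota_lin); lift
  | |- lifts _ _ (_ - _) _ =>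
     eapply (liftsD iota_lin); [|eapply (liftsN iota_lin)]; lift
  | |- lifts _ _ 0 _ => exact: (lifts0 iota_lin)
  | |- lifts _ _ (LH _ _ _ _) _ => apply: (lifts_H psi_gen n_gt3)
  | |- lifts _ _ (LX _ _ _ _ _) _ => apply: (lifts_X psi_gen n_gt3)
  end.

Ltac degree :=
  repeat match goal with
    | H : is_true (Hdef _ _ _) |- _ => move: H
    | H : is_true (Xdef _ _ _) |- _ => move: H end;
  rewrite /Xdef /Hdef; repeat case: ifP => ?; lia.

Ltac degree0 := rewrite /Xdef /=; lia.

Ltac degree_fork :=
  match goal with H : is_true (fork _ _ _) |- _ =>
    move: H; rewrite /fork !xpair_eqE /Xdef => ?; case: ifP => ?; lia end.

Theorem presentation_rel u v : Lrel u v -> psi u = psi v.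
Proof.
have [n_gt0 n_gt1] : (0 < n)%N /\ (1 < n)%N by lia.
have Xdef_n j s : Xdef n j s -> j != (n + 1)%N -> (0 < j <= n)%N.
  by rewrite /Xdef; case: odd; lia.
have Hdef_n i r : Hdef n i r -> (0 < i <= n)%N.
  by rewrite /Hdef; case: odd; lia.
have HH i r j s : Hdef n i r -> Hdef n j s ->
    <| Hmx K n i r, Hmx K n j s |> = 0.
  move=> Hi Hj; have wt0 a k t : wt n t a k k = 0.
    by rewrite /wt !subrr alternate0 addr0.
  have c0 k : (k < 2 * n)%N -> <| Hmx K n i r, fmx K n k k s |> = 0.
    move=> kN; rewrite Hmx_comm ?Hdef_n // /wtH; last exact: Hdef_n Hi.
    by case: ifP => _; rewrite !wt0 ?subrr ?addr0 mulr0z.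
  by rewrite [Hmx K n j s]/Hmx; case: ifP => jN;
    rewrite commDr ?commNr !c0 ?oppr0 ?addr0 //; have := Hdef_n _ _ Hj; lia.
have HX e i r j s : Hdef n i r -> (0 < j <= n)%N ->
    <| Hmx K n i r, Xmx K n e j s |> =
    Xmx K n e j (r + s) *~ (pm e * cartan_tw n r i j).
  move=> Hi jr; apply: Hmx_Xmx => //; [exact: Hdef_n Hi|by case/andP: jr|].
  exact: wtH_cartan.
have HXl e i r s : Hdef n i r -> <| Hmx K n i r, Xmx K n e (n + 1) s |> =
    Xmx K n e (n + 1) (r + s) *~
    (pm e * if odd r then 0 else 2 * delta i n - 2 * delta i (n - 1)).
  move=> Hi; apply: Hmx_Xmx => //; [exact: Hdef_n Hi|by rewrite addn1|].
  exact: wtH_last.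
(* [lift] follows the syntax of both sides of a relation and builds the corresponding matrices, so
   each relation becomes a matrix identity plus range conditions on the symbols. *)
case; intros; (eapply lifts_eq; [lift | lift | ]);
  try (lazymatch goal with |- is_true _ => by [] end);
  try (lazymatch goal with
  | |- is_true (Hdef _ _ _) => degree | |- is_true (Xdef _ _ 0) => degree0
  | |- is_true (Xdef _ _ _) => first [degree | degree_fork] end).
- exact: HH.
- by apply: HX => //; apply: (Xdef_n j s).
- by rewrite HXl // ifT // mulr0 mulr0z.
- by rewrite HXl // ifN.
- exact: XpXm_mx.
- by rewrite XpnXm_mx ?ifN //; apply: (Xdef_n j s).
- by rewrite XpnXm_mx ?ifT //; apply: (Xdef_n j s).
- exact: XpnXmn1_even_mx.
- exact: XpnXmn1_mx.
- by rewrite XpXmn_mx ?ifN //; apply: (Xdef_n j r).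
- by rewrite XpXmn_mx ?ifT //; apply: (Xdef_n j r).
- exact: Xpn1Xmn_even_mx.
- exact: Xpn1Xmn_mx.
- exact: XpXm_last_mx.
- exact: Xmx_shift.
- exact: shift_fork_mx.
- exact: last_last_mx.
- exact: Xmx_self.
- have jr := Xdef_n j s ltac:(assumption) ltac:(lia).
  by apply: last_X_mx => //; lia.
- exact: Xplast_Xpn1_mx.
- by have [] := last_zero_mx K n_gt3 r s.
- exact: Xplast_Xmn_mx.
- by have [] := last_zero_mx K n_gt3 r s.
- exact: Xmlast_Xmn1_mx.
- by have [] := last_zero_mx K n_gt3 r s.
- exact: Xmlast_Xpn_mx.
- by have [] := last_zero_mx K n_gt3 r s.
- exact: Xmx_commute.
- exact: commute_fork_mx.
- exact: serre_fork_mx.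
- exact: Xmx_serre.
- exact: triple_mx.
- exact: quad1_mx.
- by apply: six_mx => //; left.
- by apply: five_mx => //; left.
- exact: quad2_mx.
- by apply: six_mx => //; right.
- by apply: five_mx => //; right.
Qed.

End Relations.

(** * The elements f_ij^r of L and their images *)

Section Entries.
Variables (K : fieldType) (A : algType K) (m : nat).
Local Notation n := m.+2.
Variables (H : nat -> nat -> A) (X : bool -> nat -> nat -> A).
Local Notation x := (chain_unit n X).
Local Notation p := (pfam m X).
Local Notation q := (qfam m X).

(* For odd r the matrix unit F_ii u^r is not traceless; [diag_entry i r]      *)
(* stands for (F_ii - F_00) u^r in that case.                                 *)
Definition diag_entry i r : A :=
  if odd r then - \sum_(0 <= l < i) H l.+1 r
  else 2%:R^-1 *: (H n r - H n.-1 r) + \sum_(i <= l < n.-1) H l.+1 r.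

(** Intended for [i + j < 2 * n], on or above the antidiagonal. Positions beyond both chains are
    reached by a bracket across the fork, with the degree on the first factor; [entry] fills the
    other half by the symmetry of F_ij. *)
Definition half_entry i j r : A :=
  if (i < n)%N then
    if (j < n)%N then if i == j then diag_entry i r else x true i j r
    else if i == m.+1 then if odd r then X true (n + 1) r else 0
    else if j == n then p false i r
    else - <| p true i r, p false (negi n j) 0 |>
  else if j == m.+1 then if odd r then X false (n + 1) r else 0
  else if i == n then q false j r
  else <| q true j r, q false (negi n i) 0 |>.

Definition entry i j r : A :=
  if (i + j < 2 * n)%N then half_entry i j r
  else - alternate r (half_entry (negi n j) (negi n i) r).

Section Tracking.
Local Notation M := 'M[{poly K}]_(2 * n).
Local Notation F := (fmx K n).
Hypothesis two_neq0 : 2%:R != 0 :> K.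
Variable T : A -> M -> Prop.
Hypotheses (T0 : T 0 0)
  (TD : forall v w y z, T v y -> T w z -> T (v + w) (y + z))
  (TZ : forall c v y, T v y -> T (c *: v) (c%:P *: y))
  (TC : forall v w y z, T v y -> T w z -> T <| v, w |> <| y, z |>).
Hypotheses (TH : forall i r, Hdef n i r -> T (H i r) (Hmx K n i r))
  (TX : forall e i r, Xdef n i r -> T (X e i r) (Xmx K n e i r)).

Let TN v y : T v y -> T (- v) (- y).
Proof. by move/(TZ (-1)); rewrite scaleN1r polyCN scaleN1r. Qed.

Let Tconv v y z : T v y -> y = z -> T v z.
Proof. by move=> vy <-. Qed.

(** The last index of the chain [c = false] stands for the index -n, hence for position [n] of the
    matrix. *)
Definition place c i : nat := if i == m.+1 then last_node m c else i.

Lemma node_place c i : (i <= m)%N ->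
  [/\ (0 < node n c i <= n)%N, rowp n (node n c i) = i
    & colp n (node n c i) = place c i.+1].
Proof.
rewrite /node /rowp /colp /place /last_node => im.
case: (eqVneq i.+2 n) => [[->]|ne].
  by rewrite eqxx; case: c; rewrite /= ?ltnSn ?ltnn ?eqxx; split=> //; lia.
have -> : (i.+1 < n)%N by lia.
have -> : (i.+1 == m.+1) = false by lia.
by split=> //; lia.
Qed.

Let place_low c i : (i <= m)%N -> place c i = i.
Proof. by rewrite /place => im; rewrite ltn_eqF. Qed.

Let place_top c : place c m.+1 = last_node m c.
Proof. by rewrite /place eqxx. Qed.

Let place_range c i : (i <= m.+1)%N -> (place c i <= n)%N /\ (i <= place c i)%N.
Proof. by rewrite /place /last_node; case: eqVneq => [->|]; case: c; lia. Qed.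

Let TXnode e c l r : (l <= m)%N -> T (chainX n X c e l r)
  (if e then F l (place c l.+1) r else F (place c l.+1) l r).
Proof.
move=> lm; have [nr rE cE] := node_place c lm.
apply: Tconv (TX _ _) _; first by rewrite /Xdef; case: odd; lia.
by rewrite /Xmx rE cE.
Qed.

Lemma raise_tracks c i j r : (i < j)%N -> (j <= m.+1)%N ->
  T (raise (chainX n X c true) i j r) (F i (place c j) r).
Proof.
elim: j r => // j IH r; rewrite ltnS leq_eqVlt => /orP[/eqP-> jm|ij jm].
  by rewrite raise1; exact: TXnode.
rewrite raiseS //.
apply: Tconv (TC (IH 0 ij (ltnW jm)) (TXnode true c r jm)) _.
have [h1 h2] := place_range c jm.
rewrite (place_low c jm) fmx_comm; try lia; decide_indices.
by rewrite !(alternate0, subr0, addr0).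
Qed.

Lemma lower_tracks c i j r : (j < i)%N -> (i <= m.+1)%N ->
  T (lower (chainX n X c false) i j r) (F (place c i) j r).
Proof.
elim: i r => // i IH r; rewrite ltnS leq_eqVlt => /orP[/eqP-> im|ji im].
  by rewrite /= eqxx; exact: TXnode.
rewrite /= (ltn_eqF ji).
apply: Tconv (TC (TXnode false c r im) (IH 0 ji (ltnW im))) _.
have [h1 h2] := place_range c im.
rewrite (place_low c im) fmx_comm; try lia; decide_indices.
by rewrite !(alternate0, subr0, addr0) addn0.
Qed.

Lemma unit_tracks c i j r : (i <= m.+1)%N -> (j <= m.+1)%N -> i != j ->
  T (x c i j r) (F (place c i) (place c j) r).
Proof.
move=> im jm; rewrite neq_ltn /chain_unit /unit_of => /orP[ij|ji].
  by rewrite ij (place_low c (_ : i <= m)%N); [exact: raise_tracks|lia].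
by rewrite ltnNge (ltnW ji) /= (place_low c (_ : j <= m)%N);
  [exact: lower_tracks|lia].
Qed.

Definition diag_mx_value i r := F i i r - (if odd r then F 0 0 r else 0).

Let H_low l r : (l < m.+1)%N -> T (H l.+1 r) (F l l r - F l.+1 l.+1 r).
Proof.
move=> lm; apply: Tconv (TH _) _; first by rewrite /Hdef; case: odd; lia.
by rewrite /Hmx ifT.
Qed.

Let sum_low a b r : (a <= b)%N -> (b <= m.+1)%N ->
  T (\sum_(a <= l < b) H l.+1 r) (F a a r - F b b r).
Proof.
move=> ab; elim: b ab => [|b IH] ab bm.
  have -> : a = 0%N by lia.
  by rewrite big_geq // subrr.
have [lt|ge] := ltnP a b.+1; last first.
  have -> : a = b.+1 by lia.
  by rewrite big_geq // subrr.
rewrite big_nat_recr //=.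
apply: Tconv (TD (IH lt (ltnW bm)) (H_low r bm)) _.
by rewrite addrA subrK.
Qed.

Lemma diag_tracks i r : (i < n)%N -> T (diag_entry i r) (diag_mx_value i r).
Proof.
move=> iN; rewrite /diag_entry /diag_mx_value; case: ifP => od.
  by apply: Tconv (TN (sum_low r (leq0n i) _)) _ => //; rewrite opprB.
have ev : ~~ odd r by rewrite od.
have Hn : T (H n r) (F m m r + F m.+1 m.+1 r).
  apply: Tconv (TH _) _; first by rewrite /Hdef (negbTE ev); lia.
  by rewrite /Hmx ltnn subn2.
(* Half the difference of H_n and H_{n-1} is F_ii u^r for the last [i < n]; the telescoping sum then
   leads down to the given index. *)
have Tn := TZ 2%:R^-1 (TD Hn (TN (H_low r (ltnSn m)))).
apply: Tconv (TD Tn (sum_low r _ (leqnn _))) _ => //.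
have -> : F m m r + F m.+1 m.+1 r - (F m m r - F m.+1 m.+1 r) =
    2%:R *: F m.+1 m.+1 r.
  by rewrite scaler_nat mulr2n opprB addrC addrA subrK.
rewrite scalerA -(rmorph_nat polyC) -polyCM mulVf // scale1r.
by rewrite subr0 addrC subrK.
Qed.

Let p_tracks c i r : (i <= m)%N -> T (p c i r) (F i (last_node m c) r).
Proof.
move=> im; rewrite -place_top -{2}(place_low c im).
by apply: unit_tracks => //; lia.
Qed.

Let q_tracks c i r : (i <= m)%N -> T (q c i r) (F (last_node m c) i r).
Proof.
move=> im; rewrite -place_top -{2}(place_low c im).
by apply: unit_tracks => //; lia.
Qed.

Definition entry_value i j r :=
  F i j r - (if (i == j) && odd r then F 0 0 r else 0).

Lemma half_tracks i j r : (i < 2 * n)%N -> (j < 2 * n)%N -> (i + j < 2 * n)%N ->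
  T (half_entry i j r) (entry_value i j r).
Proof.
move=> iN jN ij; rewrite /half_entry /entry_value.
case: ltnP => iltn.
  case: ltnP => jltn.
    case: eqVneq => [<-|ne]; first exact: diag_tracks.
    by rewrite subr0; apply: Tconv (unit_tracks true r _ _ ne) _ => //;
      rewrite /place /=; repeat case: eqP => [->|_].
  have ne : i != j by lia.
  rewrite (negbTE ne) subr0.
  case: eqVneq => [ei|ni].
    have ej : j = n by lia.
    rewrite ei ej; case: ifP => od.
      apply: Tconv (TX _ _) _; first by rewrite /Xdef od; lia.
      by rewrite /Xmx /rowp /colp addn1 ltnNge leqnSn /= gtn_eqF.
    have nE : negi n m.+1 = n by rewrite /negi; lia.
    by have := @fmx_even0 K n m.+1 r; rewrite nE => ->; rewrite ?od //; lia.
  case: eqVneq => [->|nj].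
    by apply: Tconv (p_tracks false r _) _ => //; lia.
  have im : (i <= m)%N by lia.
  have jm : (negi n j <= m)%N by rewrite /negi; lia.
  apply: Tconv (TN (TC (p_tracks true r im) (p_tracks false 0 jm))) _.
  rewrite /= fmx_comm ?negi_lt //; try lia; decide_indices.
  by rewrite negiK // !(alternate0, subr0, addr0, sub0r, opprK) addn0.
have ne : i != j by lia.
rewrite (negbTE ne) subr0.
case: eqVneq => [ej|nj].
  have ei : i = n by lia.
  rewrite ei ej; case: ifP => od.
    apply: Tconv (TX _ _) _; first by rewrite /Xdef od; lia.
    by rewrite /Xmx /rowp /colp addn1 ltnNge leqnSn /= gtn_eqF.
  have nE : negi n n = m.+1 by rewrite /negi; lia.
  by have := @fmx_even0 K n n r; rewrite nE => ->; rewrite ?od //; lia.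
case: eqVneq => [->|ni].
  by apply: Tconv (q_tracks false r _) _ => //; lia.
have jm : (j <= m)%N by lia.
have im : (negi n i <= m)%N by rewrite /negi; lia.
apply: Tconv (TC (q_tracks true r jm) (q_tracks false 0 im)) _.
rewrite /= fmx_comm ?negi_lt //; try lia; decide_indices.
by rewrite negiK // !(alternate0, subr0, addr0, sub0r, opprK) addn0 add0r.
Qed.

(** Each entry is built from generators by linear operations and brackets, so any relation [T]
    respecting these reaches it. It is used once to compute the images of entries and once, ignoring
    the matrix, to show that entries normalize a subspace. *)
Lemma entry_tracks i j r : (i < 2 * n)%N -> (j < 2 * n)%N ->
  T (entry i j r) (entry_value i j r).
Proof.
move=> iN jN; rewrite /entry; case: ltnP => ij; first exact: half_tracks.
have sE : (negi n j + negi n i < 2 * n)%N by rewrite /negi; lia.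
have h := half_tracks r (negi_lt jN) (negi_lt iN) sE.
have ha : T (alternate r (half_entry (negi n j) (negi n i) r))
    (alternate r (entry_value (negi n j) (negi n i) r)).
  by rewrite /alternate; case: odd => //; exact: TN.
apply: Tconv (TN ha) _; rewrite /entry_value fmx_negi // alternateD alternateN.
have -> : (negi n j == negi n i) = (i == j) by rewrite /negi; lia.
rewrite alternateK opprD opprK /alternate; congr (_ - _).
by case: (i == j) => /=; case: (odd r); rewrite /= ?opprK ?oppr0.
Qed.

End Tracking.
End Entries.

(** * Symmetry of the entries and stability of their span *)

Section EntryRelations.
Variables (K : fieldType) (A : algType K) (m : nat).
Hypotheses (two_neq0 : 2%:R != 0 :> K) (m_gt1 : (1 < m)%N).
Local Notation n := m.+2.
Variable phi : {lrmorphism free_alg K (Lgen n) -> A}.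
Hypothesis phi_rel : forall x y, Lrel x y -> phi x = phi y.

Local Notation H := (genH phi).
Local Notation X := (genX phi).
Local Notation x := (chain_unit n X).
Local Notation p := (pfam m X).
Local Notation q := (qfam m X).
Local Notation f := (entry m H X).
Local Notation hf := (half_entry m H X).

Let px c := pfam_vector two_neq0 m_gt1 phi_rel c.
Let qx c := covector_dual (qfam_covector two_neq0 m_gt1 phi_rel c).
Let p_sym := fork_sym (ltnW m_gt1) (px true) (px false)
  (pfam_fork two_neq0 m_gt1 phi_rel true).
Let q_sym := fork_sym (ltnW m_gt1) (qx true) (qx false)
  (qfam_fork two_neq0 m_gt1 phi_rel true).

Let anti0 r (a : A) : ~~ odd r -> a = - (-1) ^+ r *: a -> a = 0.
Proof.
move=> ev; rewrite -signr_odd (negbTE ev) expr0 scaleN1r.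
exact: torsion2.
Qed.

(** At equal indices and in even degree [fork_sym] says that the bracket is its own negative; the
    corner entries are zero by definition. *)
Lemma half_antidiag i r : (i < 2 * n)%N -> ~~ odd r ->
  hf i (negi n i) r = 0.
Proof.
move=> iN ev; rewrite /half_entry.
case: ltnP => iltn.
  have -> : (negi n i < n)%N = false by rewrite /negi; lia.
  rewrite (negbTE ev); case: eqVneq => // ni.
  have -> : (negi n i == n) = false by rewrite /negi; lia.
  have im : (i <= m)%N by lia.
  by rewrite negiK // (anti0 ev (p_sym r im im)) oppr0.
rewrite (negbTE ev); case: eqVneq => // nj.
have -> : (i == n) = false by move: nj; rewrite /negi; lia.
have jm : (negi n i <= m)%N by move: nj; rewrite /negi; lia.
exact: (anti0 ev (q_sym r jm jm)).
Qed.

(** Off the antidiagonal this is how [entry] extends [half_entry]; on it the two sides involve the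
    same element, which must vanish in even degree. *)
Lemma entry_antisym i j r : (i < 2 * n)%N -> (j < 2 * n)%N ->
  f (negi n j) (negi n i) r = - alternate r (f i j r).
Proof.
move=> iN jN; rewrite /entry !negiK //.
have sE : (negi n j + negi n i = 4 * n - 2 - (i + j))%N by rewrite /negi; lia.
rewrite sE; case: (ltngtP (i + j) (2 * n - 1)%N) => ij.
- have -> : (4 * n - 2 - (i + j) < 2 * n)%N = false by lia.
  by have -> : (i + j < 2 * n)%N by lia.
- have -> : (4 * n - 2 - (i + j) < 2 * n)%N by lia.
  have -> : (i + j < 2 * n)%N = false by lia.
  by rewrite alternateN alternateK opprK.
have -> : (4 * n - 2 - (i + j) < 2 * n)%N by lia.
have -> : (i + j < 2 * n)%N by lia.
have ej : j = negi n i by rewrite /negi; lia.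
rewrite ej negiK // /alternate; case: ifP => [_|/negbT ev].
  by rewrite opprK.
by rewrite half_antidiag // oppr0.
Qed.

Section AdEntry.
Variable V : A -> Prop.
Hypotheses (V0 : V 0) (VD : forall a b, V a -> V b -> V (a + b)).
Hypothesis VZ : forall c a, V a -> V (c *: a).
Hypothesis Ventry : forall i j r, (i < 2 * n)%N -> (j < 2 * n)%N ->
  V (f i j r).

Let VN := closedN VZ.

Let Vhalf i j r : (i < 2 * n)%N -> (j < 2 * n)%N -> (i + j < 2 * n)%N ->
  V (hf i j r).
Proof. by move=> iN jN ij; have := Ventry r iN jN; rewrite /entry ij. Qed.

Let Vunit i j r : (i < n)%N -> (j < n)%N -> i != j -> V (x true i j r).
Proof.
move=> iN jN ne; have := @Vhalf i j r.
by rewrite /half_entry iN jN (negbTE ne); apply; lia.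
Qed.

Let Vx i j r : (i <= m)%N -> (j <= m)%N -> i != j -> V (x true i j r).
Proof. by move=> im jm; apply: Vunit; lia. Qed.

Let Vp c i r : (i <= m)%N -> V (p c i r).
Proof.
move=> im; case: c; first by apply: Vunit; lia.
have := @Vhalf i n r; rewrite /half_entry ltnn eqxx.
have -> : (i < n)%N by lia.
have -> : (i == m.+1) = false by lia.
by apply; lia.
Qed.

Let Vq c i r : (i <= m)%N -> V (q c i r).
Proof.
move=> im; case: c; first by apply: Vunit; lia.
have := @Vhalf n i r; rewrite /half_entry ltnn eqxx.
have -> : (i == m.+1) = false by lia.
by apply; lia.
Qed.

Let VPle i j r : (i <= j)%N -> (j <= m)%N -> V <| p true i r, p false j 0 |>.
Proof.
move=> ij jm; have := @Vhalf i (negi n j) r.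
rewrite /half_entry negiK; last lia.
have -> : (i < n)%N by lia.
have -> : (negi n j < n)%N = false by rewrite /negi; lia.
have -> : (i == m.+1) = false by lia.
have -> : (negi n j == n) = false by rewrite /negi; lia.
move=> h; rewrite -[<| _, _ |>]opprK; apply/VN/h; rewrite ?/negi; lia.
Qed.

Let VP i j r : (i <= m)%N -> (j <= m)%N -> V <| p true i r, p false j 0 |>.
Proof.
move=> im jm; have [ij|ji] := leqP i j; first exact: VPle.
by rewrite p_sym //; apply/VZ/VPle => //; exact: ltnW.
Qed.

Let VQle i j r : (i <= j)%N -> (j <= m)%N -> V <| q true i r, q false j 0 |>.
Proof.
move=> ij jm; have := @Vhalf (negi n j) i r.
rewrite /half_entry negiK; last lia.
have -> : (negi n j < n)%N = false by rewrite /negi; lia.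
have -> : (i == m.+1) = false by lia.
have -> : (negi n j == n) = false by rewrite /negi; lia.
by apply; rewrite ?/negi; lia.
Qed.

Let VQ i j r : (i <= m)%N -> (j <= m)%N -> V <| q true i r, q false j 0 |>.
Proof.
move=> im jm; have [ij|ji] := leqP i j; first exact: VQle.
by rewrite q_sym //; apply/VZ/VQle => //; exact: ltnW.
Qed.

Let VY e r : odd r -> V (X e m.+3 r).
Proof.
move=> od; case: e.
  have := @Vhalf m.+1 n r; rewrite /half_entry ltnSn ltnn eqxx od addn1.
  by apply; lia.
have := @Vhalf n m.+1 r; rewrite /half_entry ltnn eqxx od addn1.
by apply; lia.
Qed.

Let Vdiag i r : (i < n)%N -> V (diag_entry m H i r).
Proof.
move=> iN; have := @Vhalf i i r; rewrite /half_entry iN eqxx.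
by apply; lia.
Qed.

Let VH i r : Hdef n i r -> V (H i r).
Proof.
rewrite /Hdef => ir; have [lt|ge] := ltnP i n.
  have [i' ei] : exists i', i = i'.+1 by exists i.-1; lia.
  have im : (i' < m.+1)%N by lia.
  have -> : H i r = diag_entry m H i' r - diag_entry m H i'.+1 r.
    rewrite ei /diag_entry; case: odd.
      by rewrite big_nat_recr //= opprK addrA addNr add0r.
    by rewrite (big_ltn im) opprD addrACA subrr add0r addrK.
  by apply: VD; [|apply: VN]; apply: Vdiag; lia.
have ei : i = n by move: ir; case: odd; lia.
have ev : odd r = false by apply/negP => od; move: ir; rewrite od ei; lia.
have -> : H i r = diag_entry m H m r + diag_entry m H m.+1 r.
  rewrite ei /diag_entry ev big_nat1 big_geq // addr0.
  rewrite addrAC -scalerDl.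
  have -> : 2%:R^-1 + 2%:R^-1 = 1 :> K.
    by apply: (mulfI two_neq0); rewrite mulrDr mulfV // mulr1.
  by rewrite scale1r subrK.
by apply: VD; apply: Vdiag; lia.
Qed.

(** Each kind of entry (unit, Cartan element, X_{n+1}, fork bracket) has its own stability lemma
    above; the lower half follows by the sign rule. *)
Lemma ad_entry e l t i j r : (1 <= l <= n)%N ->
  (i < 2 * n)%N -> (j < 2 * n)%N -> V <| X e l t, f i j r |>.
Proof.
move=> ln.
have adu := ad_unit two_neq0 m_gt1 phi_rel V0 VD VZ Vx Vp Vq VP VQ VY VH e t.
have adH i' r' := ad_H (i := i') (r := r') two_neq0 m_gt1 phi_rel VZ Vx Vp Vq
  e t ln.
have adY d r' := ad_Y (r := r') two_neq0 m_gt1 phi_rel V0 VZ Vp Vq d e t ln.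
have adP i' j' r' := ad_fork (i := i') (j := j') two_neq0 m_gt1 phi_rel V0 VD VZ
  Vx Vp Vq VP e true t r' 0 ln.
have adQ i' j' r' := ad_cofork (i := i') (j := j') two_neq0 m_gt1 phi_rel V0 VD
  VZ Vx Vp Vq VQ e true t r' 0 ln.
have half i' j' r' : (i' < 2 * n)%N -> (j' < 2 * n)%N -> (i' + j' < 2 * n)%N ->
    V <| X e l t, hf i' j' r' |>.
  move=> iN jN ij; rewrite /half_entry; case: ltnP => iltn.
    case: ltnP => jltn.
      case: eqVneq => [_|ne]; last by apply: adu.
      have adHs s : V <| X e l t, \sum_(s <= k < m.+1) H k.+1 r' |>.
        rewrite comm_sumr big_nat_cond; apply: closed_sum => // k /andP[kr _].
        by apply: adH => //; rewrite /Hdef; case: odd; lia.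
      rewrite /diag_entry; case: ifP => od.
        rewrite commNr; apply: VN; rewrite comm_sumr big_nat_cond.
        apply: closed_sum => // k /andP[kr _].
        by apply: adH => //; rewrite /Hdef; case: odd; lia.
      rewrite commDr; apply: VD; last exact: adHs.
      rewrite commZr; apply: VZ; rewrite commDr commNr.
      by apply: VD; [|apply: VN]; apply: adH; rewrite // /Hdef od; lia.
    case: eqVneq => [_|ni].
      case: ifP => od; last by rewrite comm0r.
      by rewrite addn1; apply: adY.
    case: eqVneq => [_|nj]; first by apply: adu => //; lia.
    by rewrite commNr; apply/VN/adP; rewrite /negi; lia.
  case: eqVneq => [_|nj].
    case: ifP => od; last by rewrite comm0r.
    by rewrite addn1; apply: adY.
  case: eqVneq => [_|ni]; first by apply: adu => //; lia.
  by apply/adQ; rewrite /negi; lia.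
move=> iN jN; rewrite /entry; case: ltnP => ij; first exact: half.
rewrite commNr comm_alternater; apply: VN.
have h : V <| X e l t, hf (negi n j) (negi n i) r |>.
  by apply: half; rewrite /negi; lia.
by rewrite /alternate; case: odd => //; exact: VN.
Qed.

Lemma genH_closed i r : Hdef n i r -> V (H i r).
Proof. exact: VH. Qed.

Lemma genX_entry_closed e i r : Xdef n i r -> V (X e i r).
Proof.
rewrite /Xdef => ir; have [le|gt] := leqP i n.
  by apply: (genX_closed two_neq0 m_gt1 Vx Vp Vq); lia.
have od : odd r by move: ir; case: odd => //; lia.
have -> : i = m.+3 by move: ir; rewrite od; lia.
exact: VY.
Qed.

End AdEntry.

Section LieGeneration.
Variable P : A -> Prop.
Hypotheses (PN : forall a, P a -> P (- a))
  (PC : forall a b, P a -> P b -> P <| a, b |>).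
Hypothesis PX : forall e l t, (1 <= l <= n)%N -> P (X e l t).

Let last_range c : (1 <= last_node m c <= n)%N.
Proof. by case: c => /=; lia. Qed.

(** Up to sign X_{n+1} is the bracket of a vector and a covector of different chains at the top
    index, so the generators with label at most n produce it. *)
Lemma lie_genX e i r : Xdef n i r -> P (X e i r).
Proof.
rewrite /Xdef => ir; have [le|gt] := leqP i n; first by apply: PX; lia.
have od : odd r by move: ir; case: odd => //; lia.
have -> : i = m.+3 by move: ir; rewrite od; lia.
have := pq_pairing two_neq0 m_gt1 phi_rel (~~ e) r 0 (leqnn m) (leqnn m).
rewrite eqxx /zfam addn0 od negbK pfam_m qfam_m => E.
by rewrite -[X _ _ _]opprK -E; apply/PN/PC; apply/PX/last_range.
Qed.

Lemma lie_genH i r : Hdef n i r -> P (H i r).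
Proof.
have n_gt3 : (3 < n)%N by lia.
rewrite /Hdef => ir; have [lt|ge] := ltnP i n.
  have iN : (1 <= i <= n - 1)%N by lia.
  have := phi_rel (Lrel_XpXm K r 0 iN iN).
  rewrite (phi_comm phi) linearZ /delta eqxx /= scale1r addn0 => E.
  by rewrite /genH -E; apply: PC; apply: PX; lia.
have ei : i = n by move: ir; case: odd; lia.
have ev : ~~ odd (r + 0).
  by rewrite addn0; apply/negP => od; move: ir; rewrite od ei; lia.
have Xn : Xdef n n 0 by rewrite /Xdef /=; lia.
have j1 : n != (n - 1)%N by lia.
have j2 : n != (n + 1)%N by lia.
have := phi_rel (Lrel_XpnXm_even K Xn j1 j2 ev).
rewrite (phi_comm phi) linearZ /delta eqxx /= scale1r addn0 => E.
by rewrite ei /genH -E; apply: PC; apply: PX; lia.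
Qed.

End LieGeneration.
End EntryRelations.

(** * Universal properties of the algebras involved *)

Section FreeAlgebraUniqueness.
Variables (K : fieldType) (Y : choiceType).

Lemma word_alg_hom_ext (A : algType K) (f g : {lrmorphism word_alg K Y -> A}) :
  (forall y, f << fmu y >> = g << fmu y >>) -> f =1 g.
Proof.
move=> fg a.
have word (s : seq Y) (k : {fmonom Y}) : k = s :> seq Y ->
    f << k >> = g << k >>.
  elim: s k => [|y s IH] k ek.
    have -> : k = mone by apply: val_inj; rewrite /= ek fm1.
    have -> : << mone >> = 1 :> word_alg K Y by [].
    by rewrite !rmorph1.
  have [w ew] : exists w : {fmonom Y}, w = s :> seq Y.
    by exists (FMonom s).
  have -> : << k >> = << fmu y >> * << w >> :> word_alg K Y.
    rewrite [RHS]malgM_def fgmulUU mulr1; congr (<< 1 *g _ >>).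
    by apply: val_inj; rewrite /= ek fmM fmU ew.
  by rewrite !rmorphM /= fg (IH w ew).
have fZ c u : f (c *: u) = c *: f u by exact: linearZ.
have gZ c u : g (c *: u) = c *: g u by exact: linearZ.
rewrite [a]monalgE !rmorph_sum; apply: eq_bigr => k _.
have -> : << a@_k *g k >> = a@_k *: << k >> :> word_alg K Y.
  by rewrite -mul_malgC malgM_def fgmulUU mulr1 mul1m.
apply: (etrans (fZ _ _)); rewrite (word k k) //; exact/esym/gZ.
Qed.

Lemma free_alg_hom_ext (A : algType K) (f g : {lrmorphism free_alg K Y -> A}) :
  (forall y, f (fgen y) = g (fgen y)) -> f =1 g.
Proof.
move: f g; rewrite /fgen /free_alg unlock => f g.
exact: word_alg_hom_ext.
Qed.

End FreeAlgebraUniqueness.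

(* The library makes this an algebra over K[u]; targets of algebra morphisms  *)
(* have to be algebras over K.                                                *)
Definition polymx (K : fieldType) (m : nat) : Type := 'M[{poly K}]_(2 * m.+2).

Section PolyMatrix.
Variables (K : fieldType) (m : nat).
Local Notation M := (polymx K m).

HB.instance Definition _ := GRing.PzRing.on M.

Lemma polymx_neq0 : (1 : M) != 0.
Proof.
apply/eqP => /matrixP/(_ (Ordinal (isT : 0 < 2 * m.+2)%N)).
move/(_ (Ordinal (isT : 0 < 2 * m.+2)%N)) => /eqP.
by rewrite !mxE eqxx oner_eq0.
Qed.

HB.instance Definition _ := GRing.PzSemiRing_isNonZero.Build M polymx_neq0.

Definition polymx_scale (c : K) (x : M) : M :=
  (c%:P *: (x : 'M[{poly K}]_(2 * m.+2)) : 'M[{poly K}]_(2 * m.+2)).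

Fact polymx_scaleA a b x :
  polymx_scale a (polymx_scale b x) = polymx_scale (a * b) x.
Proof. by rewrite /polymx_scale scalerA polyCM. Qed.

Fact polymx_scale1 : left_id 1 polymx_scale.
Proof. by move=> x; rewrite /polymx_scale scale1r. Qed.

Fact polymx_scaleDr : right_distributive polymx_scale +%R.
Proof. by move=> c x y; rewrite /polymx_scale scalerDr. Qed.

Fact polymx_scaleDl x : {morph polymx_scale^~ x : a b / a + b}.
Proof. by move=> a b; rewrite /polymx_scale polyCD scalerDl. Qed.

HB.instance Definition _ := GRing.Zmodule_isLmodule.Build K M
  polymx_scaleA polymx_scale1 polymx_scaleDr polymx_scaleDl.

Fact polymx_scaleAl (c : K) (x y : M) : c *: (x * y) = (c *: x) * y.
Proof. exact: (scalemxAl c%:P). Qed.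

HB.instance Definition _ := GRing.Lmodule_isLalgebra.Build K M polymx_scaleAl.

Fact polymx_scaleAr (c : K) (x y : M) : c *: (x * y) = x * (c *: y).
Proof. exact: (scalemxAr c%:P). Qed.

HB.instance Definition _ := GRing.Lalgebra_isAlgebra.Build K M polymx_scaleAr.

End PolyMatrix.

Section CoefSum.
Variables (K : fieldType) (A : lmodType K).
Implicit Types (g : nat -> A) (a b : {poly K}).

(** The K-linear map on polynomials determined by sending u^r to [g r]. *)
Definition coef_comb g a : A := \sum_(r < size a) a`_r *: g r.

Lemma coef_combE g a d : (size a <= d)%N ->
  coef_comb g a = \sum_(r < d) a`_r *: g r.
Proof.
move=> ad; rewrite /coef_comb -!(big_mkord xpredT (fun r => a`_r *: g r)).
rewrite [RHS](big_cat_nat _ ad) //=.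
have -> : \sum_(size a <= r < d) a`_r *: g r = 0; last by rewrite addr0.
rewrite big_nat_cond big1 // => r /andP[/andP[ar _] _].
by rewrite nth_default ?scale0r.
Qed.

Lemma coef_comb_linear g c a b :
  coef_comb g (c%:P * a + b) = c *: coef_comb g a + coef_comb g b.
Proof.
pose d := maxn (size (c%:P * a + b)) (maxn (size a) (size b)).
rewrite !(@coef_combE _ _ d) ?leq_max ?leqnn ?orbT //.
rewrite scaler_sumr -big_split; apply: eq_bigr => r _ /=.
by rewrite coefD coefCM scalerDl scalerA.
Qed.

Lemma coef_combXn g r : coef_comb g 'X^r = g r.
Proof.
rewrite /coef_comb size_polyXn big_ord_recr /= coefXn eqxx scale1r.
rewrite big1 ?add0r //.
by move=> i _; rewrite coefXn ltn_eqF // scale0r.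
Qed.

Lemma coef_comb0 g : coef_comb g 0 = 0.
Proof. by rewrite /coef_comb size_poly0 big_ord0. Qed.

End CoefSum.

Section Quotients.
Variables (K : fieldType) (Y : choiceType).
Variable Rel : free_alg K Y -> free_alg K Y -> Prop.

Lemma pproj_zmod_morphism : zmod_morphism (pproj Rel).
Proof.
move=> x y; rewrite pprojD; congr (_ + _).
by apply: (addrI (pproj Rel y)); rewrite -pprojD !subrr pproj0.
Qed.

Lemma pproj_monoid_morphism : monoid_morphism (pproj Rel).
Proof. by split; [exact: pproj1|exact: pprojM]. Qed.

Lemma pproj_rel x y : Rel x y -> pproj Rel x = pproj Rel y.
Proof.
move=> xy; apply/pproj_eq; rewrite -[x - y]addr0 -[x - y]mul1r -[1 * _]mulr1.
by apply: IdealGenD xy _; exact: IdealGen0.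
Qed.

End Quotients.

Section Projections.
Variables (K : fieldType).

Definition uea_proj (g : lieAlgType K) : {lrmorphism free_alg K g -> uea g} :=
  HB.pack (pproj (@uea_rel K g) : free_alg K g -> uea g)
   (GRing.isZmodMorphism.Build _ (uea g) _
     (@pproj_zmod_morphism K g (@uea_rel K g)))
   (GRing.isMonoidMorphism.Build _ (uea g) _
     (@pproj_monoid_morphism K g (@uea_rel K g)))
   (GRing.isScalable.Build K _ (uea g) *:%R _ (@pprojZ K g (@uea_rel K g))).

Definition Lalg_proj n : {lrmorphism free_alg K (Lgen n) -> Lalg K n} :=
  HB.pack (pproj (@Lrel K n) : free_alg K (Lgen n) -> Lalg K n)
   (GRing.isZmodMorphism.Build _ (Lalg K n) _
     (@pproj_zmod_morphism K _ (@Lrel K n)))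
   (GRing.isMonoidMorphism.Build _ (Lalg K n) _
     (@pproj_monoid_morphism K _ (@Lrel K n)))
   (GRing.isScalable.Build K _ (Lalg K n) *:%R _ (@pprojZ K _ (@Lrel K n))).

Lemma Lalg_lift n (B : algType K) (f : {lrmorphism free_alg K (Lgen n) -> B}) :
  (forall x y, Lrel x y -> f x = f y) ->
  exists g : {lrmorphism Lalg K n -> B}, forall x, g (Lalg_proj n x) = f x.
Proof.
move=> /presented_ex[g [gZ gE]].
pose G : {lrmorphism Lalg K n -> B} := HB.pack (g : Lalg K n -> B)
  (GRing.isZmodMorphism.Build (Lalg K n) B g (raddfB g))
  (GRing.isMonoidMorphism.Build (Lalg K n) B g (conj (rmorph1 g) (rmorphM g)))
  (GRing.isScalable.Build K (Lalg K n) B *:%R g gZ).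
by exists G.
Qed.

Lemma uea_lift (g : lieAlgType K) (B : algType K) (f : g -> B) :
  linear f -> (forall x y, f (lie x y) = <| f x, f y |>) ->
  exists F : {lrmorphism uea g -> B}, forall x, F (uea_proj g (fgen x)) = f x.
Proof.
move=> f_lin f_lie; have [h hE] := free_alg_ex f.
have hrel x y : uea_rel x y -> h x = h y.
  case=> [a u v|u v].
    by rewrite linearP /= !hE f_lin.
  by rewrite hE f_lie -!hE /comm rmorphB !rmorphM.
have [G [GZ GE]] := presented_ex hrel.
pose F : {lrmorphism uea g -> B} := HB.pack (G : uea g -> B)
  (GRing.isZmodMorphism.Build (uea g) B G (raddfB G))
  (GRing.isMonoidMorphism.Build (uea g) B G (conj (rmorph1 G) (rmorphM G)))
  (GRing.isScalable.Build K (uea g) B *:%R G GZ).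
by exists F => x; rewrite -hE -GE.
Qed.

Lemma uea_proj_linear (g : lieAlgType K) :
  linear (fun x : g => uea_proj g (fgen x)).
Proof.
move=> a x y; rewrite -linearP; apply: pproj_rel; exact: UeaLinear.
Qed.

Lemma uea_proj_lie (g : lieAlgType K) (x y : g) :
  uea_proj g (fgen (lie x y)) = <| uea_proj g (fgen x), uea_proj g (fgen y) |>.
Proof.
rewrite /comm -!rmorphM -rmorphB; apply/esym/pproj_rel; exact: UeaBracket.
Qed.

End Projections.

(** * The linear section and the isomorphism *)

Section Isomorphism.
Variables (K : fieldType) (m : nat).
Hypotheses (two_neq0 : 2%:R != 0 :> K) (m_gt1 : (1 < m)%N).
Local Notation n := m.+2.
Local Notation g := (twcur K n).
Local Notation L := (Lalg K n).
Local Notation U := (uea g).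
Local Notation M := (polymx K m).
Local Notation H := (genH (Lalg_proj K n)).
Local Notation X := (genX (Lalg_proj K n)).
Local Notation f := (entry m H X).
Local Notation iota := (fun y : g => uea_proj g (fgen y)).

Let n_gt3 : (3 < n)%N. Proof. by lia. Qed.

Let Lproj_rel x y : Lrel x y -> Lalg_proj K n x = Lalg_proj K n y.
Proof. exact: pproj_rel. Qed.

Let val_linear : linear (fun y : g => val y : M).
Proof. by []. Qed.

Let val_lie (x y : g) : (val (lie x y) : M) = <| (val x : M), val y |>.
Proof. by []. Qed.

(** Here [iota] is the inclusion of g into matrices; [Psi_ex] uses the canonical map into the
    enveloping algebra. *)
Lemma rho_ex : exists rho : {lrmorphism L -> M},
  forall s : Lgen n, rho (Lalg_proj K n (fgen s)) = val (symtw K n (val s)).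
Proof.
have [psi psiE] := free_alg_ex
  (fun s : Lgen n => (val (symtw K n (val s)) : M)).
have [rho rhoE] := Lalg_lift (presentation_rel val_linear val_lie psiE n_gt3).
by exists rho => s; rewrite rhoE psiE.
Qed.

Lemma Psi_ex : exists Psi : {lrmorphism L -> U},
  forall s : Lgen n, Psi (Lalg_proj K n (fgen s)) = iota (symtw K n (val s)).
Proof.
have [psi psiE] := free_alg_ex (fun s : Lgen n => iota (symtw K n (val s))).
have [Psi PsiE] := Lalg_lift
  (presentation_rel (@uea_proj_linear K g) (@uea_proj_lie K g) psiE n_gt3).
by exists Psi => s; rewrite PsiE psiE.
Qed.

(* A linear section of rho; the factor 1/2 is due to F_{-j,-i} = +- F_ij.     *)
Definition section_map (x : M) : L :=
  2%:R^-1 *: \sum_(i < 2 * n) \sum_(j < 2 * n) coef_comb (f i j) (x i j).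
Local Notation phi := section_map.

Lemma section_map_linear c (x y : M) : phi (c *: x + y) = c *: phi x + phi y.
Proof.
rewrite /section_map scalerA (mulrC c) -scalerA -scalerDr.
congr (_ *: _); rewrite scaler_sumr -big_split.
apply: eq_bigr => i _; rewrite scaler_sumr -big_split.
by apply: eq_bigr => j _; rewrite !mxE coef_comb_linear.
Qed.

Let phi0 : phi 0 = 0.
Proof.
rewrite /section_map big1 ?scaler0 // => i _; rewrite big1 // => j _.
by rewrite mxE coef_comb0.
Qed.

Let phiD x y : phi (x + y) = phi x + phi y.
Proof. by have := section_map_linear 1 x y; rewrite !scale1r. Qed.

Let phiZ c x : phi (c *: x) = c *: phi x.
Proof. by have := section_map_linear c x 0; rewrite phi0 !addr0. Qed.

Let phiN x : phi (- x) = - phi x.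
Proof. by rewrite -scaleN1r phiZ scaleN1r. Qed.

Let phi_alt r x : phi (alternate r x) = alternate r (phi x).
Proof. by rewrite /alternate; case: odd; rewrite ?phiN. Qed.

Lemma section_map_emx i j r : (i < 2 * n)%N -> (j < 2 * n)%N ->
  phi (emx K n i j r) = 2%:R^-1 *: f i j r.
Proof.
move=> iN jN; rewrite /section_map (bigD1 (Ordinal iN)) //=.
rewrite (bigD1 (Ordinal jN)) //=.
rewrite mxE !eqxx coef_combXn big1 ?addr0; last first.
  move=> b; rewrite -val_eqE /= => /negbTE bj.
  by rewrite mxE bj andbF coef_comb0.
rewrite big1 ?addr0 // => a; rewrite -val_eqE /= => /negbTE ai.
by rewrite big1 // => b _; rewrite mxE ai coef_comb0.
Qed.

(** The two matrix units in F_ij contribute the same amount by [entry_antisym], and the factor 1/2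
    compensates. *)
Lemma section_map_fmx i j r : (i < 2 * n)%N -> (j < 2 * n)%N ->
  phi (fmx K n i j r) = f i j r.
Proof.
move=> iN jN; rewrite /fmx phiD phiN phi_alt !section_map_emx ?negi_lt //.
rewrite (entry_antisym two_neq0 m_gt1 Lproj_rel) // scalerN alternateN opprK.
have -> : 2%:R^-1 *: alternate r (f i j r) = alternate r (2%:R^-1 *: f i j r).
  by rewrite /alternate; case: odd; rewrite ?scalerN.
rewrite alternateK -scalerDl.
have -> : 2%:R^-1 + 2%:R^-1 = 1 :> K.
  by apply: (mulfI two_neq0); rewrite mulrDr mulfV // mulr1.
exact: scale1r.
Qed.

Let f00 r : odd r -> f 0 0 r = 0.
Proof.
by move=> od; rewrite /entry /half_entry /= /diag_entry od big_geq ?oppr0.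
Qed.

Lemma section_map_value i j r : (i < 2 * n)%N -> (j < 2 * n)%N ->
  phi (entry_value K m i j r) = f i j r.
Proof.
move=> iN jN; rewrite /entry_value phiD phiN section_map_fmx //.
case: ifP => [/andP[_ od]|_]; last by rewrite phi0 subr0.
by rewrite section_map_fmx // f00 // subr0.
Qed.

Lemma section_map_ind (P : L -> Prop) : P 0 ->
  (forall a b, P a -> P b -> P (a + b)) -> (forall c a, P a -> P (c *: a)) ->
  (forall i j r, (i < 2 * n)%N -> (j < 2 * n)%N -> P (f i j r)) ->
  forall x, P (phi x).
Proof.
move=> P0 PD PZ Pf x; apply: (PZ).
apply: (big_ind P) => // i _; apply: (big_ind P) => // j _.
by apply: (big_ind P) => // r _; apply/PZ/Pf.
Qed.

Let mxsum (I : Type) (s : seq I) (F : I -> M) a b :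
  (\sum_(i <- s) F i : 'M[{poly K}]_(2 * n)) a b =
  \sum_(i <- s) (F i : 'M[{poly K}]_(2 * n)) a b.
Proof. by apply: (big_morph (fun y : M => y a b)) => [y z|]; rewrite mxE. Qed.

Let coef_comb_mx (G : nat -> M) (c : {poly K}) a b :
  (coef_comb G c : 'M[{poly K}]_(2 * n)) a b =
  \sum_(r < size c) c`_r *: (G r : 'M[{poly K}]_(2 * n)) a b.
Proof. by rewrite mxsum; apply: eq_bigr => r _; rewrite mxE mul_polyC. Qed.

Lemma coef_comb_emx i j c a b :
  (coef_comb (emx K n i j : nat -> M) c : 'M[{poly K}]_(2 * n)) a b =
  if (a == i :> nat) && (b == j :> nat) then c else 0.
Proof.
rewrite coef_comb_mx; case: ifP => e.
  by rewrite -[RHS]coefK poly_def; apply: eq_bigr => r _; rewrite mxE e.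
by rewrite big1 // => r _; rewrite mxE e scaler0.
Qed.

Lemma coef_comb_alternate i j c a b :
  (coef_comb (fun r => alternate r (emx K n i j r) : M) c
    : 'M[{poly K}]_(2 * n)) a b =
  if (a == i :> nat) && (b == j :> nat) then c \Po - 'X else 0.
Proof.
rewrite coef_comb_mx; case: ifP => e.
  rewrite comp_polyE; apply: eq_bigr => r _.
  congr (_ *: _); rewrite exprNn -signr_odd /alternate; case: odd;
    by rewrite !mxE e ?expr1 ?expr0 ?mulN1r ?mul1r.
rewrite big1 // => r _; rewrite /alternate.
by case: odd; rewrite !mxE e ?oppr0 scaler0.
Qed.

Let coef_combB (F G : nat -> M) c :
  coef_comb (fun r => F r - G r) c = coef_comb F c - coef_comb G c.
Proof.
rewrite /coef_comb -sumrB; apply: eq_bigr => r _.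
by rewrite scalerBr.
Qed.

Let single (y : 'I_(2 * n) -> 'I_(2 * n) -> {poly K}) (k l : 'I_(2 * n)) :
  \sum_i \sum_j (if (k == i) && (l == j) then y i j else 0) = y k l.
Proof.
rewrite (bigD1 k) //= (bigD1 l) //= !eqxx big1 ?addr0; last first.
  by move=> j; rewrite eq_sym => /negbTE->.
rewrite big1 ?addr0 // => i; rewrite eq_sym => /negbTE->.
by rewrite big1.
Qed.

Lemma section_mapK (rho : {lrmorphism L -> M}) :
  (forall i j r, (i < 2 * n)%N -> (j < 2 * n)%N ->
     rho (f i j r) = entry_value K m i j r) ->
  forall y : g, rho (phi (val y)) = val y.
Proof.
move=> rhof [x xg]; have /twcur_predP[tx ttx] := xg => /=.
pose F0 r : M := if odd r then fmx K n 0 0 r else 0.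
(* The image splits into the plain matrix units, their twisted partners, and the diagonal F_00
   corrections in odd degree. *)
have rhoE : rho (phi x) = 2%:R^-1 *:
    (\sum_(i < 2 * n) \sum_(j < 2 * n)
       coef_comb (emx K n i j : nat -> M) (x i j)
     - \sum_(i < 2 * n) \sum_(j < 2 * n) coef_comb (fun r => alternate r
         (emx K n (negi n j) (negi n i) r) : M) (x i j)
     - \sum_(i < 2 * n) coef_comb F0 (x i i)).
  rewrite linearZ /= raddf_sum -sumrB -sumrB; congr (_ *: _).
  apply: eq_bigr => i _; rewrite raddf_sum.
  have -> : coef_comb F0 (x i i) = \sum_(j < 2 * n)
      coef_comb (fun r => if i == j then F0 r else 0) (x i j).
    rewrite (bigD1 i) //= eqxx big1 ?addr0 // => j ji.
    rewrite eq_sym (negbTE ji) /coef_comb big1 // => r _.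
    by rewrite scaler0.
  rewrite -sumrB -sumrB; apply: eq_bigr => j _.
  rewrite -!coef_combB raddf_sum; apply: eq_bigr => r _.
  rewrite [LHS]linearZ /= rhof //; congr (_ *: _).
  rewrite /entry_value /fmx /F0; congr (_ - _).
  by rewrite -val_eqE; case: (_ == _).
(* The correction does not depend on [i], so by linearity it sees only the trace of [x], which is
   zero. *)
rewrite rhoE; have -> : \sum_i coef_comb F0 (x i i) = 0.
  have lin (s : seq 'I_(2 * n)) : \sum_(i <- s) coef_comb F0 (x i i) =
      coef_comb F0 (\sum_(i <- s) x i i).
    elim: s => [|i s IH]; first by rewrite !big_nil coef_comb0.
    rewrite !big_cons IH.
    have := coef_comb_linear F0 1 (x i i) (\sum_(j <- s) x j j).
    by rewrite mul1r scale1r => ->.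
  by rewrite lin -[X in coef_comb F0 X]/(\tr x) tx coef_comb0.
have -> : \sum_(i < 2 * n) \sum_(j < 2 * n)
    coef_comb (emx K n i j : nat -> M) (x i j) = x :> M.
  apply/matrixP => a b; rewrite mxsum -[RHS](single (fun i j => x i j)).
  apply: eq_bigr => i _; rewrite mxsum; apply: eq_bigr => j _.
  by rewrite coef_comb_emx.
(* The sum of the twisted partners is the negative of [ttau x], and [x] is fixed by [ttau]. *)
have -> : \sum_(i < 2 * n) \sum_(j < 2 * n) coef_comb (fun r => alternate r
    (emx K n (negi n j) (negi n i) r) : M) (x i j) = - (x : M).
  apply/matrixP => a b; rewrite mxsum -[in RHS]ttx !mxE rmorphN opprK /=.
  rewrite -(single (fun i j => x i j \Po - 'X)).
  apply: eq_bigr => i _; rewrite mxsum; apply: eq_bigr => j _.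
  rewrite coef_comb_alternate andbC; congr (if _ && _ then _ else _).
    by rewrite -val_eqE /= /negi; have := ltn_ord b; have := ltn_ord i; lia.
  by rewrite -val_eqE /= /negi; have := ltn_ord a; have := ltn_ord j; lia.
have two_half (y : M) : 2%:R^-1 *: (y + y) = y.
  by rewrite -mulr2n -scaler_nat scalerA mulVf // scale1r.
by rewrite opprK subr0 two_half.
Qed.

Lemma isomorphism_ex : exists F : {lrmorphism U -> L}, bijective F.
Proof.
have [rho rhoE] := rho_ex; have [Psi PsiE] := Psi_ex.
(* Recording both images of [v] at once ties [Psi] to [rho]: both come from the same element of
   g. *)
pose T (v : L) (x : M) :=
  exists y : g, [/\ Psi v = iota y, rho v = val y & val y = x].
have iotaP : linear iota := @uea_proj_linear K g.
have iotaD y z : iota (y + z) = iota y + iota z.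
  by have := iotaP 1 y z; rewrite !scale1r.
have iota0 : iota 0 = 0 by apply: (addrI (iota 0)); rewrite -iotaD !addr0.
have iotaZ c y : iota (c *: y) = c *: iota y.
  by have := iotaP c y 0; rewrite iota0 !addr0.
have T0 : T 0 0 by exists 0; rewrite !raddf0 iota0.
have TD v w y z : T v y -> T w z -> T (v + w) (y + z).
  case=> a [va ra <-] [b [wb rb <-]]; exists (a + b).
  by rewrite !raddfD /= va ra wb rb -iotaD.
have TZ c v y : T v y -> T (c *: v) (c%:P *: y).
  case=> a [va ra <-]; exists (c *: a); split=> //.
    by rewrite linearZ /= va -iotaZ.
  by rewrite linearZ /= ra.
have TC v w y z : T v y -> T w z -> T <| v, w |> <| y, z |>.
  case=> a [va ra <-] [b [wb rb <-]]; exists (lie a b); split=> //.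
    by rewrite /comm rmorphB !rmorphM /= va wb; apply/esym/uea_proj_lie.
  by rewrite /comm rmorphB !rmorphM /= ra rb.
have Tsym s : sym_def n s -> T (Lalg_proj K n (Lsym K n s)) (symmx K n s).
  move=> sdef; exists (symtw K n s); rewrite /Lsym insubT PsiE rhoE.
  by split=> //; rewrite symtwE //; lia.
have TH i r : Hdef n i r -> T (H i r) (Hmx K n i r) by exact: (Tsym (SymH i r)).
have TX e i r : Xdef n i r -> T (X e i r) (Xmx K n e i r).
  exact: (Tsym (SymX e i r)).
have Tf i j r (iN : (i < 2 * n)%N) (jN : (j < 2 * n)%N) :=
  entry_tracks two_neq0 T0 TD TZ TC TH TX r iN jN.
have rhof i j r : (i < 2 * n)%N -> (j < 2 * n)%N ->
    rho (f i j r) = entry_value K m i j r.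
  by move=> iN jN; have [y [_ -> ->]] := Tf i j r iN jN.
have rhoK := section_mapK rhof.
(* Phrasing the span as a fixed-point condition makes [rho] visibly injective on it. *)
pose V v := phi (rho v) = v.
have V0 : V 0 by rewrite /V raddf0.
have VD v w : V v -> V w -> V (v + w) by rewrite /V raddfD phiD => -> ->.
have VZ c v : V v -> V (c *: v) by rewrite /V linearZ phiZ => ->.
have Vf i j r : (i < 2 * n)%N -> (j < 2 * n)%N -> V (f i j r).
  by move=> iN jN; rewrite /V rhof // section_map_value.
have Vphi x : V (phi x) by exact: section_map_ind.
(* The normalizer of V; by Jacobi it is closed under brackets, which spares a direct computation of
   brackets of entries. *)
pose N w := forall v, V v -> V <| w, v |>.
have N0 : N 0 by move=> v _; rewrite comm0l.
have ND v w : N v -> N w -> N (v + w).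
  by move=> Nv Nw z Vz; rewrite commDl; apply: VD; [apply: Nv|apply: Nw].
have NZ c v : N v -> N (c *: v).
  by move=> Nv z Vz; rewrite commZl; apply/VZ/Nv.
have NN v : N v -> N (- v) by rewrite -scaleN1r; exact: NZ.
have NC v w : N v -> N w -> N <| v, w |>.
  move=> Nv Nw z Vz.
  have -> : <| <| v, w |>, z |> =
      <| v, <| w, z |> |> + (-1) *: <| w, <| v, z |> |>.
    by rewrite (comm_jacobi v) scaleN1r addrK.
  by apply: VD; [apply/Nv/Nw|apply/VZ/Nw/Nv].
have NX e l t : (1 <= l <= n)%N -> N (X e l t).
  move=> ln v <-; apply: (section_map_ind (P := fun v => V <| X e l t, v |>)).
  - by rewrite comm0r.
  - by move=> a b Va Vb; rewrite commDr; exact: VD.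
  - by move=> c a Va; rewrite commZr; exact: VZ.
  - by move=> i j r iN jN;
      exact: (ad_entry two_neq0 m_gt1 Lproj_rel V0 VD VZ Vf).
have Nf i j r : (i < 2 * n)%N -> (j < 2 * n)%N -> N (f i j r).
  move=> iN jN; apply: (entry_tracks (T := fun v (_ : 'M_(2 * n)) => N v)
    two_neq0 N0 _ _ _ _ _ r iN jN) => [v w _ _|c v _|v w _ _|i' r'|e i' r'].
  - exact: ND.
  - exact: NZ.
  - exact: NC.
  - exact: (lie_genH m_gt1 Lproj_rel NC NX).
  - exact: (lie_genX two_neq0 m_gt1 Lproj_rel NN NC NX).
have Nphi x : N (phi x) by exact: section_map_ind.
pose h (y : g) : L := phi (val y).
have h_lin : linear h by move=> c y z; rewrite /h -section_map_linear.
have h_lie y z : h (lie y z) = <| h y, h z |>.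
  (* The bracket lies in V, so it may be replaced by [phi] of its image under [rho], where it is a
     commutator of matrices. *)
  have <- : V <| h y, h z |> by apply: Nphi; exact: Vphi.
  by rewrite /h /comm rmorphB !rmorphM /= !rhoK.
have [F FE] := uea_lift h_lin h_lie.
have Psi_h y : Psi (h y) = iota y.
  (* Some element of g accounts for both images; comparing with [rhoK] identifies it with [y]. *)
  have [y' [e1 e2]] : exists y', Psi (h y) = iota y' /\ rho (h y) = val y'.
    apply: (section_map_ind (P := fun v => exists y', Psi v = iota y' /\
      rho v = val y')).
    - by have [y' [? ? _]] := T0; exists y'.
    - move=> a b [ya [pa ra]] [yb [pb rb]].
      by exists (ya + yb); rewrite !raddfD /= pa ra pb rb -iotaD.
    - move=> c a [ya [pa ra]]; exists (c *: ya).
      by rewrite !linearZ /= pa ra -iotaZ.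
    - by move=> i j r iN jN; have [y' [? ? _]] := Tf i j r iN jN; exists y'.
  by rewrite e1; congr iota; apply: val_inj; rewrite -e2 rhoK.
(* The generators are fixed by [phi] after [rho], so the morphism [F] hits each of them; this yields
   the second inverse identity. *)
have Vgen (s : Lgen n) : V (Lalg_proj K n (fgen s)).
  have -> : fgen s = Lsym K n (val s) by rewrite /Lsym valK.
  case: s => [[i r|e i r] sdef] /=.
    exact: (genH_closed two_neq0 m_gt1 VD VZ Vf).
  exact: (genX_entry_closed two_neq0 m_gt1 Vf).
exists F; exists Psi => [u|v].
  have [w <-] : exists w, uea_proj g w = u by exists (prepr u); exact: preprK.
  apply: (free_alg_hom_ext (f := Psi \o F \o uea_proj g)
    (g := uea_proj g)) => y.
  by rewrite /= FE Psi_h.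
have [w <-] : exists w, Lalg_proj K n w = v by exists (prepr v); exact: preprK.
apply: (free_alg_hom_ext (f := F \o Psi \o Lalg_proj K n)
  (g := Lalg_proj K n)) => s.
by rewrite /= PsiE FE /h -rhoE; exact: Vgen.
Qed.

End Isomorphism.

Unset Implicit Arguments.

Theorem theorem3p53 (R : realType) (n : nat) (hn : (4 < n)%N) :
  exists f : {lrmorphism uea (twcur R[i] n) -> Lalg R[i] n}, bijective f.
Proof.
case: n hn => [|[|m]] // hn; apply: isomorphism_ex; last by lia.
by rewrite Num.Theory.pnatr_eq0.
Qed.
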